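(* Consider the linear model $y=X\beta^*+\varepsilon$ with random sub-Gaussian design, Gaussian noise $\varepsilon\sim N(0,\sigma_\varepsilon^2I_N)$ independent of $X$ with $\sigma_\varepsilon$ unknown, and $\beta^*\in\mathcal{S}(k,s_1,s_2)$. Assume that $X$ is a row-wise $(\sigma_x,\Sigma_x)$-sub-Gaussian random matrix whose covariance $\Sigma_x$ has all eigenvalues in $[c,c']$ for constants $0<c\le c'$ not depending on the dimensions, and that $\Theta_x=\Sigma_x^{-1}$ satisfies $\max_i\sum_j|(\Theta_x)_{ij}|\le M_n$, where $M_n$ is allowed to grow with $n$. Let $\lambda\asymp\sigma_\varepsilon\sqrt{\frac{\log n}{N}}$, $\lambda_g=\lambda\sqrt{\nu/(2d)^{k+1}}$ where $0\le\nu<1$ and $d$ is the maximum degree of the underlying graph, $\mu\asymp\sqrt{\frac{\log n}{N}}$, and assume $s_2/s_1\ge\nu$. Let $\tilde\beta$ be the one-step estimator built from the $k$-th order Graph-Piecewise-Polynomial-Lasso $\hat\beta$ (with tuning parameters $\lambda,\lambda_g$) and the CLIME matrix $\widehat\Theta$ (with tuning parameter $\mu$), and let $$\hat\sigma_\varepsilon=\sqrt{\frac1N\sum_{i=1}^N\left(y_i-X_i^T\hat\beta\right)^2}.$$ If $\frac{s_2\log n}{\sqrt N}\to0$ and $M_n\sqrt{\frac{\log n}{N}}\to0$, then for $j\in[n]$, $$\frac{\sqrt N(\tilde\beta_j-\beta_j^* )}{\hat\sigma_\varepsilon\sqrt{e_j^T\widehat\Theta\Sigma_N\widehat\Theta^Te_j}}\to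 N(0,1)$$ in distribution.
   Context: Graph: $\mathcal{G}=(\mathcal{V},\mathcal{E})$ is a known undirected graph with $n$ nodes labelled $1,\dots,n$, $p$ edges, and maximum degree $d$. Its oriented incidence matrix $F\in\{-1,0,1\}^{p\times n}$ has, for the row corresponding to the edge $(i,j)$ with $i<j$, entry $-1$ in position $i$, $+1$ in position $j$, and $0$ elsewhere. The Laplacian is $L=F^TF$. Graph difference operators: $\Delta^{(1)}=F$, and for $k\ge1$, $\Delta^{(k+1)}=F^T\Delta^{(k)}=L^{(k+1)/2}$ if $k$ is odd, $\Delta^{(k+1)}=F\Delta^{(k)}=FL^{k/2}$ if $k$ is even. $k\ge0$ is a fixed integer. Parameter space: $\mathcal{S}(k,s_1,s_2)=\{\beta\in\mathbb{R}^n:\|\Delta^{(k+1)}\beta\|_0\le s_1,\ \|\beta\|_0\le s_2\}$, where $s_1,s_2>0$ and $\|\cdot\|_0$ counts nonzero entries. Design: a random variable $Z$ is $\sigma$-sub-Gaussian if $\mathbb{E}Z=0$ and $\mathbb{E}e^{tZ}\le e^{\sigma^2t^2/2}$ for all $t\in\mathbb{R}$; a random vector $Z$ is $\sigma$-sub-Gaussian if $\mathbb{E}Z=0$ and $u^TZ$ is $\sigma$-sub-Gaussian for every unit vector $u$. $X\in\mathbb{R}^{N\times n}$, with rows $X_i^T$, is a row-wise $(\sigma_x,\Sigma_x)$-sub-Gaussian random matrix if its rows are i.i.d. from a $\sigma_x$-sub-Gaussian distribution with covariance matrix $\Sigma_x$. Estimators: for $\lambda>0,\lambda_g\ge0$,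 the $k$-th order Graph-Piecewise-Polynomial-Lasso is $$\hat\beta\in\arg\min_{\beta\in\mathbb{R}^n}\ \frac1{2N}\|y-X\beta\|_2^2+\lambda_g\|\Delta^{(k+1)}\beta\|_1+\lambda\|\beta\|_1 .$$ Let $\Sigma_N=\frac1NX^TX$. The CLIME matrix $\widehat\Theta\in\mathbb{R}^{n\times n}$ is a solution of: minimize $\|\Theta\|_{1,1}=\sum_{i,j}|\Theta_{ij}|$ over $\Theta\in\mathbb{R}^{n\times n}$ subject to $\|\Theta\Sigma_N-I_n\|_\infty\le\mu$ (entrywise maximum). The one-step estimator is $\tilde\beta=\hat\beta+\frac1N\widehat\Theta X^T(y-X\hat\beta)$. $e_j$ is the $j$-th column of $I_n$; $[n]=\{1,\dots,n\}$. Asymptotics: $N,n,p,s_1,s_2$ are allowed to increase to $\infty$ (the graph changing accordingly); $k,\nu,\sigma_\varepsilon,\sigma_x$ and the eigenvalue bounds are fixed. $f\asymp g$ means equality of order up to positive constants; the choices $\lambda\asymp g$, $\mu\asymp h$ mean that $\lambda,\mu$ are taken to be $g,h$ times suitable positive constants. *)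

(* Defs.v *)
From HB Require Import structures.
From mathcomp Require Export all_boot all_order all_algebra.
From mathcomp Require Export all_classical all_reals all_analysis.
Export Order.TTheory GRing.Theory Num.Theory.
Export numFieldNormedType.Exports.

Set Implicit Arguments.
Unset Strict Implicit.
Unset Printing Implicit Defensive.

Local Open Scope ring_scope.

Section graph.
Context (n : nat) (e : rel 'I_n).

Definition simple_graph : Prop := symmetric e /\ irreflexive e.

Definition edges : {set 'I_n * 'I_n} :=
  [set ij : 'I_n * 'I_n | ((ij.1 < ij.2)%N && e ij.1 ij.2)].

Definition max_degree : nat := \max_(v < n) #|[set w | e v w]|.

Context (R : realType).

Definition incidence : 'M[R]_(#|edges|, n) :=
  \matrix_(l, v) (if v == (enum_val l).1 then -1
                  else if v == (enum_val l).2 then 1 else 0).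

(* Delta^(k) has one row per edge for k odd and one row per node for k even. *)
Definition diffop_rows (k : nat) : nat := if odd k then #|edges| else n.

Definition diffop_step (k : nat) :
    'M[R]_(diffop_rows k, n) -> 'M[R]_(diffop_rows k.+1, n) :=
  (if odd k as b return 'M[R]_(if b then #|edges| else n, n) ->
                        'M[R]_(if ~~ b then #|edges| else n, n)
   then fun D => incidence^T *m D
   else fun D => incidence *m D).

(* diffop k is Delta^(k+1), so that diffop 0 = Delta^(1) = F. *)
Fixpoint diffop (k : nat) : 'M[R]_(diffop_rows k.+1, n) :=
  match k with
  | 0 => incidence
  | k'.+1 => diffop_step (diffop k')
  end.

End graph.

Local Open Scope classical_set_scope.

Section norms.
Context (R : realType) (n : nat).
Implicit Type v : 'cV[R]_n.

Definition l0norm v : nat := #|[pred i | v i 0 != 0]|.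
Definition l1norm v : R := \sum_i `|v i 0|.
Definition sqr_l2norm v : R := \sum_i v i 0 ^+ 2.

End norms.

Definition param_space (R : realType) (n : nat) (e : rel 'I_n) (k : nat)
    (s1 s2 : R) : set 'cV[R]_n :=
  [set beta | (l0norm (diffop e R k *m beta))%:R <= s1 /\
              (l0norm beta)%:R <= s2].

Section estimators.
Context (R : realType) (N n : nat).
Implicit Types (X : 'M[R]_(N, n)) (y : 'cV[R]_N) (b bhat : 'cV[R]_n).

Definition gpp_lasso_obj (e : rel 'I_n) (k : nat) (lambda lambda_g : R)
    X y b : R :=
  (2 * N%:R)^-1 * sqr_l2norm (y - X *m b)
  + lambda_g * l1norm (diffop e R k *m b) + lambda * l1norm b.

Definition is_gpp_lasso (e : rel 'I_n) (k : nat) (lambda lambda_g : R)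
    X y bhat : Prop :=
  forall b, gpp_lasso_obj e k lambda lambda_g X y bhat
            <= gpp_lasso_obj e k lambda lambda_g X y b.

Definition sample_cov X : 'M[R]_n := N%:R^-1 *: (X^T *m X).

Definition clime_feasible (mu : R) X (Theta : 'M[R]_n) : Prop :=
  forall i j, `|(Theta *m sample_cov X - 1%:M) i j| <= mu.

Definition norm11 (Theta : 'M[R]_n) : R := \sum_i \sum_j `|Theta i j|.

Definition is_clime (mu : R) X (Theta : 'M[R]_n) : Prop :=
  clime_feasible mu X Theta /\
  forall Theta', clime_feasible mu X Theta' -> norm11 Theta <= norm11 Theta'.

Definition one_step X y bhat (Theta : 'M[R]_n) : 'cV[R]_n :=
  bhat + N%:R^-1 *: (Theta *m X^T *m (y - X *m bhat)).

Definition sigma_hat X y bhat : R :=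
  Num.sqrt (N%:R^-1 * \sum_i (y i 0 - (X *m bhat) i 0) ^+ 2).

Definition studentized X y (bstar bhat : 'cV[R]_n) (Theta : 'M[R]_n)
    (j : 'I_n) : R :=
  Num.sqrt N%:R * (one_step X y bhat Theta j 0 - bstar j 0)
  / (sigma_hat X y bhat *
     Num.sqrt ((Theta *m sample_cov X *m Theta^T) j j)).

End estimators.

(* The sigma-algebra on matrices generated by the entries; over the reals it is
   the Borel sigma-algebra of R^(m x n). *)
Definition measure_matrix_display : measure_display -> measure_display.
Proof. exact. Qed.

Section measurable_matrix.
Context d (T : measurableType d) (m n : nat).

Definition matrix_sigma_algebra : set_system 'M[T]_(m, n) :=
  <<s \bigcup_(ij : 'I_m * 'I_n)
        preimage_set_system setT (fun A : 'M[T]_(m, n) => A ij.1 ij.2)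
          measurable >>.

Let matrix_set0 : matrix_sigma_algebra set0.
Proof. exact: sigma_algebra0. Qed.

Let matrix_setC A : matrix_sigma_algebra A -> matrix_sigma_algebra (~` A).
Proof. exact: sigma_algebraC. Qed.

Let matrix_bigcup (F : (set 'M[T]_(m, n))^nat) :
  (forall i, matrix_sigma_algebra (F i)) ->
  matrix_sigma_algebra (\bigcup_i F i).
Proof. exact: sigma_algebra_bigcup. Qed.

HB.instance Definition _ := @isMeasurable.Build (measure_matrix_display d)
  'M[T]_(m, n) matrix_sigma_algebra matrix_set0 matrix_setC matrix_bigcup.

End measurable_matrix.

Section random_variables.
Local Open Scope ereal_scope.
Context d (Om : measurableType d) (R : realType) (P : probability Om R).

(* Taking some of the B i to be setT gives the product rule over every
   subfamily. *)
Definition mutually_independent d' (T' : measurableType d') (I : finType)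
    (Y : I -> Om -> T') : Prop :=
  forall B : I -> set T', (forall i, measurable (B i)) ->
    P (\bigcap_i (Y i @^-1` B i)) = \prod_i P (Y i @^-1` B i).

Definition identically_distributed d' (T' : measurableType d') (I : Type)
    (Y : I -> Om -> T') : Prop :=
  forall i i' (B : set T'), measurable B ->
    P (Y i @^-1` B) = P (Y i' @^-1` B).

Definition independent d1 d2 (T1 : measurableType d1) (T2 : measurableType d2)
    (Y : Om -> T1) (Z : Om -> T2) : Prop :=
  forall A B, measurable A -> measurable B ->
    P (Y @^-1` A `&` Z @^-1` B) = P (Y @^-1` A) * P (Z @^-1` B).

Definition sub_gaussian (sigma : R) (Z : Om -> R) : Prop :=
  'E_P[Z] = 0 /\
  forall t : R, 'M_P Z t <= (expR (sigma ^+ 2 * t ^+ 2 / 2))%:E.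

Definition sub_gaussian_vector (sigma : R) (n : nat) (Z : Om -> 'rV[R]_n) :
    Prop :=
  (forall a, 'E_P[fun w => Z w 0%R a] = 0) /\
  forall u : 'cV[R]_n, sqr_l2norm u = 1%R ->
    sub_gaussian sigma (fun w => (Z w *m u) 0%R 0%R).

Definition sub_gaussian_design (sigma : R) (N n : nat) (Sigma : 'M[R]_n)
    (X : Om -> 'M[R]_(N, n)) : Prop :=
  [/\ mutually_independent (fun i w => row i (X w)),
      identically_distributed (fun i w => row i (X w)),
      forall i, sub_gaussian_vector sigma (fun w => row i (X w)) &
      forall i a b,
        covariance P (fun w => X w i a) (fun w => X w i b) = (Sigma a b)%:E].

(* The law N(0, sigma^2 I_N). *)
Definition gaussian_noise (sigma : R) (N : nat) (eps : Om -> 'cV[R]_N) : Prop :=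
  mutually_independent (fun i w => eps w i 0%R) /\
  forall i (B : set R), measurable B ->
    P ((fun w => eps w i 0%R) @^-1` B) = normal_prob 0 sigma B.

End random_variables.

(* Each W m may live on its own probability space. *)
Definition cvg_in_distribution (R : realType) (d : nat -> measure_display)
    (Om : forall m, measurableType (d m)) (P : forall m, probability (Om m) R)
    (W : forall m, Om m -> R) (law : set R -> \bar R) : Prop :=
  (forall m, measurable_fun setT (W m)) /\
  forall t : R, {for t, continuous (fun r : R => law `]-oo, r])} ->
    P m [set w | W m w <= t] @[m --> \oo] --> law `]-oo, t].

(* Main.v *)
From HB Require Import structures.
Require Import Defs.
From mathcomp Require Import measurable_realfun ring lra.

(** Write L = ln n, h = sqrt (L / N), S for the sample covariance, Theta for
    the CLIME matrix and v for the estimation error of the penalized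
    estimator. The one-step construction satisfies the exact identity

      one_step_j - beta_star_j = <g, eps> / N - ((Theta S - I) v)_j,

    where the score g = X (row j of Theta)^T depends on the design only, and
    the variance estimate (Theta S Theta^T) j j is |g|^2 / N. Hence the
    studentized statistic equals (Z + b) / rho, where

      Z = <g, eps> / (sigma_eps |g|),    rho = sigma_hat / sigma_eps,

    and b is the rescaled bias ([studentizedE]). As the noise is Gaussian and
    independent of the design, Z is exactly standard normal given the design
    ([conditional_standard_normal]). It remains to see that b tends to 0 and
    rho to 1 in probability; the limit law then follows by comparing
    distribution functions ([studentized_cdf_sandwich]).

    The bias is at most sqrt N mu |v|_1, up to a bounded factor, because Theta
    satisfies the constraint of its program. That a feasible matrix exists
    follows from Sigma^-1 S - I = Sigma^-1 (S - Sigma), whose entries are of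
    the order of h by concentration of products of sub-Gaussian variables
    ([max_deviation_bound]): the rows of Sigma^-1 have Euclidean length at
    most 1 / c, whatever their l1 norm is. For v, the operator norm of the
    graph difference operator is at most (2d)^((k+1)/2), and the scaling of
    lambda_g, together with nu <= s2 / s1, makes the graph penalty cost at
    most lambda sqrt s2 |v|_2 ([graph_penalty_le]). The usual cone argument
    for the l1 penalty then applies and gives |v|_1 = O(s2 lambda) and
    |X v|^2 / N = O(s2 lambda^2). So b = O(s2 L / sqrt N), and rho^2 - 1 is of
    the order of s2 L / N plus the fluctuation of |eps|^2 / N
    ([studentized_expansion]).

    Two points need care. The union bounds over the coordinates fail with
    probability of order 1 / n, and n may stay bounded along a subsequence; in
    bounded dimension larger multiples of the noise level are allowed, and the
    inverse of S is itself feasible ([expansion_likely] treats both cases).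
    And h must tend to 0: the row sums of Sigma^-1 are bounded below
    ([precision_row_sum_ge]), so that this is a consequence of the condition
    on M. *)

Set Implicit Arguments.
Unset Strict Implicit.
Unset Printing Implicit Defensive.
Local Open Scope classical_set_scope.
Local Open Scope ring_scope.

(** * Euclidean geometry and graph difference operators *)

Section euclid.
Context (R : realType).

Definition dot n (u v : 'cV[R]_n) : R := \sum_i u i 0 * v i 0.

Lemma dotC n (u v : 'cV[R]_n) : dot u v = dot v u.
Proof. by apply: eq_bigr => i _; rewrite mulrC. Qed.

Lemma dotvv n (u : 'cV[R]_n) : dot u u = sqr_l2norm u.
Proof. by apply: eq_bigr => i _; rewrite -expr2. Qed.

Lemma dotDl n (u v w : 'cV[R]_n) : dot (u + v) w = dot u w + dot v w.
Proof. by rewrite -big_split; apply: eq_bigr => i _; rewrite mxE mulrDl. Qed.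

Lemma dotNl n (u w : 'cV[R]_n) : dot (- u) w = - dot u w.
Proof. by rewrite -sumrN; apply: eq_bigr => i _; rewrite mxE mulNr. Qed.

Lemma dotZl n a (u w : 'cV[R]_n) : dot (a *: u) w = a * dot u w.
Proof. by rewrite mulr_sumr; apply: eq_bigr => i _; rewrite mxE mulrA. Qed.

Lemma dotBl n (u v w : 'cV[R]_n) : dot (u - v) w = dot u w - dot v w.
Proof. by rewrite dotDl dotNl. Qed.

Lemma dotDr n (u v w : 'cV[R]_n) : dot w (u + v) = dot w u + dot w v.
Proof. by rewrite dotC dotDl dotC (dotC w v). Qed.

Lemma dotBr n (u v w : 'cV[R]_n) : dot w (u - v) = dot w u - dot w v.
Proof. by rewrite dotC dotBl dotC (dotC w v). Qed.

Lemma dotZr n a (u w : 'cV[R]_n) : dot w (a *: u) = a * dot w u.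
Proof. by rewrite dotC dotZl dotC. Qed.

Lemma dotE n (u v : 'cV[R]_n) : dot u v = (u^T *m v) 0 0.
Proof. by rewrite mxE; apply: eq_bigr => i _; rewrite mxE. Qed.

Lemma dot_mulmxr m n (u : 'cV[R]_m) (A : 'M[R]_(m, n)) (v : 'cV[R]_n) :
  dot u (A *m v) = dot (A^T *m u) v.
Proof. by rewrite !dotE trmx_mul trmxK mulmxA. Qed.

Lemma dot_delta n (a : 'I_n) (v : 'cV[R]_n) : dot (delta_mx a 0) v = v a 0.
Proof.
rewrite /dot (bigD1 a)//= big1 ?addr0 => [|i ia]; last first.
  by rewrite mxE (negbTE ia) mul0r.
by rewrite mxE !eqxx mul1r.
Qed.

Lemma sqr_l2norm_ge0 n (u : 'cV[R]_n) : 0 <= sqr_l2norm u.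
Proof. by apply: sumr_ge0 => i _; exact: sqr_ge0. Qed.

Lemma sqr_l2norm_eq0 n (u : 'cV[R]_n) : sqr_l2norm u = 0 -> u = 0.
Proof.
move=> u0; apply/matrixP => i j; rewrite ord1 mxE; apply/eqP.
rewrite -sqrf_eq0; apply/eqP.
by apply: (psumr_eq0P _ u0) => // k _; exact: sqr_ge0.
Qed.

Lemma sqr_l2normZ n a (u : 'cV[R]_n) : sqr_l2norm (a *: u) = a ^+ 2 * sqr_l2norm u.
Proof. by rewrite -!dotvv dotZl dotZr mulrA expr2. Qed.

Lemma sqr_l2norm_delta n (a : 'I_n) : sqr_l2norm (delta_mx a 0 : 'cV[R]_n) = 1.
Proof. by rewrite -dotvv dot_delta mxE !eqxx. Qed.

Lemma sqr_l2normB n (u v : 'cV[R]_n) :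
  sqr_l2norm (u - v) = sqr_l2norm u - 2 * dot u v + sqr_l2norm v.
Proof. by rewrite -!dotvv dotBl !dotBr (dotC v u); ring. Qed.

Lemma cauchy_schwarz_sum (I : finType) (P : pred I) (a b : I -> R) :
  (\sum_(i | P i) a i * b i) ^+ 2 <=
  (\sum_(i | P i) a i ^+ 2) * (\sum_(i | P i) b i ^+ 2).
Proof.
set A := \sum_(i | P i) a i ^+ 2; set B := \sum_(i | P i) b i ^+ 2.
set C := \sum_(i | P i) a i * b i.
have A0 : 0 <= A by apply: sumr_ge0 => i _; exact: sqr_ge0.
have B0 : 0 <= B by apply: sumr_ge0 => i _; exact: sqr_ge0.
have H x y : 0 <= x ^+ 2 * A - 2 * (x * y) * C + y ^+ 2 * B.
  have -> : x ^+ 2 * A - 2 * (x * y) * C + y ^+ 2 * B =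
      \sum_(i | P i) (x * a i - y * b i) ^+ 2.
    rewrite /A /B /C !mulr_sumr -sumrB -big_split /=.
    by apply: eq_bigr => i _; ring.
  by apply: sumr_ge0 => i _; exact: sqr_ge0.
have [Bz|Bn] := eqVneq B 0.
  have C0 : C = 0.
    apply: big1 => i Pi; have /(_ i Pi) := psumr_eq0P (fun i (_ : P i) => sqr_ge0 (b i)) Bz.
    by move/eqP; rewrite sqrf_eq0 => /eqP ->; rewrite mulr0.
  by rewrite C0 Bz expr0n mulr0.
have Bp : 0 < B by rewrite lt_def Bn.
have := H B C.
have -> : B ^+ 2 * A - 2 * (B * C) * C + C ^+ 2 * B = B * (A * B - C ^+ 2) by ring.
by rewrite pmulr_rge0// subr_ge0.
Qed.

Lemma cauchy_schwarz n (u v : 'cV[R]_n) :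
  dot u v ^+ 2 <= sqr_l2norm u * sqr_l2norm v.
Proof. exact: cauchy_schwarz_sum. Qed.

Lemma l1norm_ge0 n (u : 'cV[R]_n) : 0 <= l1norm u.
Proof. exact: sumr_ge0. Qed.

Lemma hoelder_dot n (u v : 'cV[R]_n) (h : R) :
  (forall i, `|u i 0| <= h) -> `|dot u v| <= h * l1norm v.
Proof.
move=> uh; apply: (le_trans (ler_norm_sum _ _ _)).
rewrite mulr_sumr; apply: ler_sum => i _.
by rewrite normrM ler_wpM2r.
Qed.

(** Cauchy-Schwarz against the indicator of P. The bound s is real because
    sparsity levels are. *)
Lemma sum_norm_le_sqrt_card n (P : pred 'I_n) (v : 'cV[R]_n) (s : R) :
  #|P|%:R <= s ->
  \sum_(i | P i) `|v i 0| <= Num.sqrt s * Num.sqrt (sqr_l2norm v).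
Proof.
move=> Ps; have s0 : 0 <= s by exact: le_trans Ps.
rewrite -sqrtrM// -(@ger0_norm _ (\sum_(i | P i) _)) ?sumr_ge0//.
rewrite -sqrtr_sqr ler_sqrt; last by rewrite mulr_ge0// sqr_l2norm_ge0.
have := @cauchy_schwarz_sum _ P (fun=> 1) (fun i => `|v i 0|).
under eq_bigr do rewrite mul1r.
move/le_trans; apply.
rewrite ler_pM//.
- by apply: sumr_ge0 => i _; exact: sqr_ge0.
- by apply: sumr_ge0 => i _; exact: sqr_ge0.
- under eq_bigr do rewrite expr1n.
  by rewrite sumr_const.
rewrite /sqr_l2norm [leRHS](bigID P)/= -[leLHS]addr0 lerD//.
  by apply: ler_sum => i _; rewrite real_normK// num_real.
by apply: sumr_ge0 => i _; exact: sqr_ge0.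
Qed.

Lemma l1norm_le_sqrt_dim n (v : 'cV[R]_n) (s : R) : n%:R <= s ->
  l1norm v <= Num.sqrt s * Num.sqrt (sqr_l2norm v).
Proof.
move=> ns; apply: (@sum_norm_le_sqrt_card n xpredT).
by rewrite (eq_card (B := 'I_n))// card_ord.
Qed.

(** A matrix and its transpose have the same operator norm: with w = A^T u,
    |w|^2 = <u, A w> <= |u| |A w|. *)
Lemma sqr_l2norm_mulmx_tr m n (A : 'M[R]_(m, n)) (b : R) : 0 <= b ->
  (forall v, sqr_l2norm (A *m v) <= b * sqr_l2norm v) ->
  forall u, sqr_l2norm (A^T *m u) <= b * sqr_l2norm u.
Proof.
move=> b0 Ab u; set w := A^T *m u.
have [w0|wn0] := eqVneq (sqr_l2norm w) 0.
  by rewrite w0 mulr_ge0// sqr_l2norm_ge0.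
have wp : 0 < sqr_l2norm w by rewrite lt_def wn0 sqr_l2norm_ge0.
have : sqr_l2norm w ^+ 2 <= sqr_l2norm u * (b * sqr_l2norm w).
  rewrite -{1}dotvv {2}/w -dot_mulmxr dotC.
  apply: (le_trans (cauchy_schwarz _ _)).
  by rewrite mulrC; apply: ler_wpM2l => //; exact: sqr_l2norm_ge0.
by rewrite expr2 mulrA ler_pM2r// mulrC.
Qed.
End euclid.

Section graph_operators.
Context (R : realType) (n : nat) (e : rel 'I_n).
Hypothesis eS : symmetric e.
Local Notation d := (max_degree e).

Lemma sum_edges (f : 'I_n * 'I_n -> R) :
  \sum_(l < #|edges e|) f (enum_val l) = \sum_(ij in edges e) f ij.
Proof. by rewrite [RHS]big_enum_val. Qed.

Lemma degree_le (v : 'I_n) : (#|[set w | e v w]%SET| <= d)%N.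
Proof. by rewrite /max_degree (leq_bigmax v). Qed.

Lemma incidence_mulE (v : 'cV[R]_n) (l : 'I_#|edges e|) :
  (incidence e R *m v) l 0 = v (enum_val l).2 0 - v (enum_val l).1 0.
Proof.
rewrite mxE; set ij := enum_val l.
have ij12 : ij.1 != ij.2.
  have : ij \in edges e by exact: enum_valP.
  by rewrite inE => /andP[/ltn_eqF]; rewrite -(inj_eq val_inj) => ->.
rewrite (bigD1 ij.1)//= (bigD1 ij.2)/=; last by rewrite eq_sym.
rewrite big1 => [|i /andP[i1 i2]]; last by rewrite mxE (negbTE i1) (negbTE i2) mul0r.
rewrite !mxE -/ij eqxx [ij.2 == ij.1]eq_sym (negbTE ij12) eqxx.
by rewrite mulN1r mul1r addr0 addrC.
Qed.

(** |F v|^2 sums (v_j - v_i)^2 <= 2 v_i^2 + 2 v_j^2 over the edges, and a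
    vertex lies on at most d of them. *)
Lemma sqr_l2norm_incidence (v : 'cV[R]_n) :
  sqr_l2norm (incidence e R *m v) <= (2 * d)%:R * sqr_l2norm v.
Proof.
rewrite /sqr_l2norm.
under eq_bigr do rewrite incidence_mulE.
rewrite (sum_edges (fun ij => (v ij.2 0 - v ij.1 0) ^+ 2)).
apply: (@le_trans _ _ (\sum_(ij in edges e) 2 * (v ij.1 0 ^+ 2 + v ij.2 0 ^+ 2))).
  apply: ler_sum => ij _; rewrite -subr_ge0.
  have -> : 2 * (v ij.1 0 ^+ 2 + v ij.2 0 ^+ 2) - (v ij.2 0 - v ij.1 0) ^+ 2 =
    (v ij.1 0 + v ij.2 0) ^+ 2 by ring.
  exact: sqr_ge0.
rewrite -mulr_sumr natrM -mulrA ler_pM2l// big_split/=.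
have -> : \sum_(ij in edges e) v ij.1 0 ^+ 2 =
    \sum_(i < n) \sum_(j < n | (i < j)%N && e i j) v i 0 ^+ 2.
  by rewrite pair_big_dep; apply: eq_bigl => ij; rewrite inE.
have -> : \sum_(ij in edges e) v ij.2 0 ^+ 2 =
    \sum_(i < n) \sum_(j < n | (j < i)%N && e i j) v i 0 ^+ 2.
  rewrite [RHS](exchange_big_dep xpredT)//= pair_big_dep.
  by apply: eq_bigl => ij; rewrite inE eS.
rewrite -big_split mulr_sumr; apply: ler_sum => i _ /=.
rewrite !sumr_const -mulrnDr -[leLHS]mulr_natl ler_wpM2r ?sqr_ge0// ler_nat.
apply: leq_trans (degree_le i); rewrite -cardUI.
rewrite [X in (_ + X)%N]eq_card0 ?addn0 => [|j]; last first.
  apply/negP => /andP[/andP[ij _]] /andP[ji _].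
  by have := ltn_trans ij ji; rewrite ltnn.
apply: subset_leq_card; apply/fintype.subsetP => j.
by rewrite !inE => /orP[]/andP[].
Qed.

Lemma sqr_l2norm_incidence_tr (u : 'cV[R]_#|edges e|) :
  sqr_l2norm ((incidence e R)^T *m u) <= (2 * d)%:R * sqr_l2norm u.
Proof. by apply: sqr_l2norm_mulmx_tr => // v; exact: sqr_l2norm_incidence. Qed.

Lemma sqr_l2norm_diffop_step k (D : 'M[R]_(diffop_rows e k, n)) (v : 'cV[R]_n) :
  sqr_l2norm (diffop_step D *m v) <= (2 * d)%:R * sqr_l2norm (D *m v).
Proof.
move: D; rewrite /diffop_step /diffop_rows /=; case: (odd k) => /= D;
  rewrite -mulmxA; [exact: sqr_l2norm_incidence_tr | exact: sqr_l2norm_incidence].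
Qed.

(** Every further difference applies F or its transpose, depending on the
    parity, and either costs a factor 2d. *)
Lemma sqr_l2norm_diffop k (v : 'cV[R]_n) :
  sqr_l2norm (diffop e R k *m v) <= (2 * d)%:R ^+ k.+1 * sqr_l2norm v.
Proof.
elim: k => [|k IH]; first by rewrite expr1; exact: sqr_l2norm_incidence.
rewrite exprS -mulrA; apply: le_trans (ler_wpM2l _ IH) => //.
exact: sqr_l2norm_diffop_step.
Qed.

End graph_operators.

(** * The estimation error of the penalized least squares *)

Section lasso.
Context (R : realType).

(** On the support of w this is the triangle inequality; off the support w + v
    reduces to v. *)
Lemma l1norm_sub_le n (w v : 'cV[R]_n) :
  l1norm w - l1norm (w + v) <=
  \sum_(i | w i 0 != 0) `|v i 0| - \sum_(i | w i 0 == 0) `|v i 0|.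
Proof.
rewrite /l1norm (bigID (fun i => w i 0 != 0))/=.
rewrite [X in _ - X](bigID (fun i => w i 0 != 0))/=.
under [X in (_ + X) - _]eq_bigl do rewrite negbK.
under [X in _ - (_ + X)]eq_bigl do rewrite negbK.
rewrite [X in (_ + X) - _]big1 ?addr0; last by move=> i /eqP ->; rewrite normr0.
rewrite opprD addrA lerB//.
  rewrite -sumrB; apply: ler_sum => i _; rewrite mxE.
  by have := lerB_dist (w i 0) (- v i 0); rewrite opprK normrN; lra.
by apply: ler_sum => i /eqP wi; rewrite mxE wi add0r.
Qed.

Lemma l1norm_sub_le_sqrt n (w v : 'cV[R]_n) (s : R) : (l0norm w)%:R <= s ->
  l1norm w - l1norm (w + v) <= Num.sqrt s * Num.sqrt (sqr_l2norm v).
Proof.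
move=> ws; apply: (le_trans (l1norm_sub_le _ _)).
apply: le_trans (sum_norm_le_sqrt_card _ ws).
by rewrite gerBl sumr_ge0.
Qed.

Context (N n : nat) (e : rel 'I_n) (k : nat) (lambda nu s1 s2 : R).
Context (X : 'M[R]_(N, n)) (eps : 'cV[R]_N) (bstar bhat : 'cV[R]_n).
Let lambda_g := lambda * Num.sqrt (nu / (2 * max_degree e)%:R ^+ k.+1).
Let v := bhat - bstar.
Hypothesis N0 : (0 < N)%N.
Hypothesis eG : simple_graph e.
Hypothesis nu0 : 0 <= nu.
Hypothesis lambda0 : 0 <= lambda.
Hypothesis s10 : 0 < s1.
Hypothesis s20 : 0 < s2.
Hypothesis nus : nu <= s2 / s1.
Hypothesis bstarS : param_space e k s1 s2 bstar.
Hypothesis bhatP : is_gpp_lasso e k lambda lambda_g X (X *m bstar + eps) bhat.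

(** The scaling of lambda_g cancels the operator norm of the graph difference
    operator: the gain in the graph penalty is at most lambda sqrt (nu s1)
    |v|_2, and nu s1 <= s2. Thus the graph penalty costs no more than the l1
    penalty does. *)
Lemma graph_penalty_le :
  lambda_g * (l1norm (diffop e R k *m bstar) - l1norm (diffop e R k *m bhat))
  <= lambda * (Num.sqrt s2 * Num.sqrt (sqr_l2norm v)).
Proof.
have [eS _] := eG; have [bs1 _] := bstarS.
have -> : diffop e R k *m bhat = diffop e R k *m bstar + diffop e R k *m v.
  by rewrite -mulmxDr /v addrC subrK.
rewrite /lambda_g -mulrA ler_wpM2l//.
apply: (le_trans (ler_wpM2l _ (l1norm_sub_le_sqrt _ bs1))).
  exact: sqrtr_ge0.
set D := (2 * max_degree e)%:R ^+ k.+1.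
have D0 : 0 <= D by rewrite exprn_ge0.
have nuD0 : 0 <= nu / D by rewrite divr_ge0.
have nuDs10 : 0 <= nu / D * s1 by rewrite mulr_ge0// ltW.
rewrite mulrA -[X in X * _ <= _](sqrtrM _ nuD0) -(sqrtrM _ nuDs10).
rewrite -(sqrtrM _ (ltW s20)).
rewrite ler_sqrt; last by rewrite mulr_ge0 ?sqr_l2norm_ge0// ltW.
(* without edges D = 0, and the inverse of 0 is 0 *)
have [D00|Dn0] := eqVneq D 0.
  by rewrite D00 invr0 mulr0 !mul0r mulr_ge0 ?sqr_l2norm_ge0// ltW.
have Dp : 0 < D by rewrite lt_def Dn0.
apply: (@le_trans _ _ (nu / D * s1 * (D * sqr_l2norm v))).
  by rewrite ler_wpM2l ?sqr_l2norm_diffop// mulr_ge0 ?divr_ge0// ltW.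
have -> : nu / D * s1 * (D * sqr_l2norm v) = nu * s1 * sqr_l2norm v by field.
by rewrite ler_wpM2r ?sqr_l2norm_ge0// -ler_pdivlMr.
Qed.

(** The objective at bhat is at most its value at bstar; the residual is
    expanded and the graph penalty is absorbed in the middle term. *)
Lemma lasso_basic_inequality :
  (2 * N%:R)^-1 * sqr_l2norm (X *m v) <=
  N%:R^-1 * dot (X^T *m eps) v
  + lambda * (Num.sqrt s2 * Num.sqrt (sqr_l2norm v))
  + lambda * (l1norm bstar - l1norm bhat).
Proof.
have Np : N%:R != 0 :> R by rewrite pnatr_eq0 -lt0n.
have := bhatP bstar; rewrite /gpp_lasso_obj.
have -> : X *m bstar + eps - X *m bhat = eps - X *m v.
  by rewrite /v mulmxBr opprB [RHS]addrCA addrA.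
have -> : X *m bstar + eps - X *m bstar = eps by rewrite addrAC subrr add0r.
rewrite sqr_l2normB dot_mulmxr.
have := graph_penalty_le; rewrite mulrBr [in X in _ -> _ -> X]mulrBr.
have -> : (2 * N%:R)^-1 * (sqr_l2norm eps - 2 * dot (X^T *m eps) v +
    sqr_l2norm (X *m v)) = (2 * N%:R)^-1 * sqr_l2norm eps
    - N%:R^-1 * dot (X^T *m eps) v + (2 * N%:R)^-1 * sqr_l2norm (X *m v).
  by field.
by lra.
Qed.

(** Once lambda / 2 dominates the noise, the nonnegativity of the prediction
    error confines v to a cone: its mass off the support of bstar is
    controlled by its mass on the support and by |v|_2. Cauchy-Schwarz on the
    support concludes. *)
Lemma lasso_cone :
  (forall a, `|(X^T *m eps) a 0 / N%:R| <= lambda / 2) ->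
  (0 < lambda) ->
  l1norm v <= 6 * Num.sqrt s2 * Num.sqrt (sqr_l2norm v) /\
  (2 * N%:R)^-1 * sqr_l2norm (X *m v) <=
    5 / 2 * Num.sqrt s2 * (lambda * Num.sqrt (sqr_l2norm v)).
Proof.
move=> noise lp; have := lasso_basic_inequality.
have noise_le : N%:R^-1 * dot (X^T *m eps) v <= lambda / 2 * l1norm v.
  rewrite -dotZl; apply: (le_trans (ler_norm _)); apply: hoelder_dot => i.
  by rewrite mxE mulrC.
set q := sqr_l2norm v; set B := (2 * N%:R)^-1 * _.
have B0 : 0 <= B by rewrite mulr_ge0 ?sqr_l2norm_ge0.
have diff_le : l1norm bstar - l1norm bhat <=
    \sum_(i | bstar i 0 != 0) `|v i 0| - \sum_(i | bstar i 0 == 0) `|v i 0|.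
  have -> : bhat = bstar + v by rewrite /v addrC subrK.
  exact: l1norm_sub_le.
have vE : l1norm v =
    \sum_(i | bstar i 0 != 0) `|v i 0| + \sum_(i | bstar i 0 == 0) `|v i 0|.
  rewrite /l1norm (bigID (fun i => bstar i 0 != 0))/=; congr (_ + _).
  by apply: eq_bigl => i; rewrite negbK.
have on_support : \sum_(i | bstar i 0 != 0) `|v i 0| <= Num.sqrt s2 * Num.sqrt q.
  by apply: sum_norm_le_sqrt_card; case: bstarS.
have off0 : 0 <= \sum_(i | bstar i 0 == 0) `|v i 0| by exact: sumr_ge0.
move: noise_le diff_le vE on_support off0; rewrite -/q.
set a := \sum_(i | _) _; set b := \sum_(i | _) _; set z := Num.sqrt s2 * _.
move=> h1 h2 h3 h4 h5 h6.
have h7 : B <= lambda * (3 / 2 * a - b / 2 + z).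
  apply: (le_trans h6).
  have := ler_wpM2l lambda0 h2; rewrite h3 in h1; move: h1; lra.
have h8 : lambda * (3 / 2 * a - b / 2 + z) <= lambda * (5 / 2 * z).
  by rewrite ler_wpM2l//; lra.
split; last by apply: le_trans h7 _; apply: (le_trans h8); rewrite /z; lra.
have : 0 <= 3 / 2 * a - b / 2 + z by rewrite -(pmulr_rge0 _ lp) (le_trans B0).
rewrite h3 (_ : 6 * Num.sqrt s2 * Num.sqrt q = 6 * z); last by rewrite /z mulrA.
by lra.
Qed.

(** When the noise level exceeds lambda / 2 the error need not lie in a cone.
    In bounded dimension this weaker inequality is enough, since there the l1
    norm is comparable to the Euclidean one. *)
Lemma lasso_crude (T : R) :
  (forall a, `|(X^T *m eps) a 0 / N%:R| <= T * lambda) ->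
  (2 * N%:R)^-1 * sqr_l2norm (X *m v) <=
    lambda * ((T + 1) * l1norm v + Num.sqrt s2 * Num.sqrt (sqr_l2norm v)).
Proof.
move=> noise; apply: (le_trans lasso_basic_inequality).
have noise_le : N%:R^-1 * dot (X^T *m eps) v <= T * lambda * l1norm v.
  rewrite -dotZl; apply: (le_trans (ler_norm _)); apply: hoelder_dot => i.
  by rewrite mxE mulrC.
have diff_le : l1norm bstar - l1norm bhat <= l1norm v.
  rewrite lerBlDr /l1norm -big_split; apply: ler_sum => i _ /=.
  have -> : bstar i 0 = bhat i 0 - v i 0 by rewrite !mxE; lra.
  by rewrite addrC; exact: ler_normB.
by have := ler_wpM2l lambda0 diff_le; move: noise_le; lra.
Qed.

End lasso.

Section restricted_eigenvalue.
Context (R : realType) (N n : nat) (X : 'M[R]_(N, n)) (Sigma : 'M[R]_n).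

Lemma dot_sample_cov (u v : 'cV[R]_n) :
  dot u (sample_cov X *m v) = N%:R^-1 * dot (X *m u) (X *m v).
Proof. by rewrite /sample_cov -scalemxAl dotZr -mulmxA dot_mulmxr trmxK. Qed.

Lemma quadratic_form_max_le (A : 'M[R]_n) (h : R) (v : 'cV[R]_n) :
  (forall a b, `|A a b| <= h) -> `|dot v (A *m v)| <= h * l1norm v ^+ 2.
Proof.
move=> Ah; rewrite dotC expr2 mulrA; apply: hoelder_dot => a.
by rewrite -dot_delta dot_mulmxr; apply: hoelder_dot => b; rewrite -colE mxE mxE.
Qed.

Context (c h a b lambda : R) (v : 'cV[R]_n).
Hypothesis N0 : (0 < N)%N.
Hypothesis c0 : 0 < c.
Hypothesis Sigmac : forall u, c * sqr_l2norm u <= dot u (Sigma *m u).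
Hypothesis dev : forall i j, `|(sample_cov X - Sigma) i j| <= h.
Hypothesis a0 : 0 <= a.
Hypothesis b0 : 0 <= b.
Hypothesis lambda0 : 0 <= lambda.
Hypothesis va : l1norm v <= a * Num.sqrt (sqr_l2norm v).
Hypothesis vb : (2 * N%:R)^-1 * sqr_l2norm (X *m v) <=
  b * (lambda * Num.sqrt (sqr_l2norm v)).
Hypothesis ha : h * a ^+ 2 <= c / 2.
Hypothesis h0 : 0 <= h.

Let halfE (z : R) : (2 * N%:R)^-1 * z = N%:R^-1 * z / 2.
Proof. by field; rewrite pnatr_eq0 -lt0n. Qed.

(** Under the l1 constraint on v, exchanging Sigma for the sample covariance
    changes the quadratic form by at most h a^2 |v|^2 <= c / 2 |v|^2, so that
    half of the curvature of Sigma remains; it is compared with the upper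
    bound on the prediction error. *)
Lemma lasso_l2_rate : Num.sqrt (sqr_l2norm v) <= 4 * b * lambda / c.
Proof.
set q := Num.sqrt _; have q0 : 0 <= q by exact: sqrtr_ge0.
have qE : sqr_l2norm v = q ^+ 2 by rewrite sqr_sqrtr// sqr_l2norm_ge0.
have Np : N%:R != 0 :> R by rewrite pnatr_eq0 -lt0n.
have lower : c / 2 * q ^+ 2 <= N%:R^-1 * sqr_l2norm (X *m v).
  rewrite -(dotvv (X *m v)) -dot_sample_cov.
  have -> : sample_cov X = Sigma + (sample_cov X - Sigma) by rewrite addrC subrK.
  rewrite mulmxDl dotDr.
  have := quadratic_form_max_le v dev; rewrite ler_norml => /andP[dl _].
  have := Sigmac v; rewrite qE => Sv.
  have l1q : h * l1norm v ^+ 2 <= c / 2 * q ^+ 2.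
    apply: (@le_trans _ _ (h * (a * q) ^+ 2)).
      by rewrite ler_wpM2l// ler_sqr ?nnegrE ?l1norm_ge0// mulr_ge0.
    by rewrite exprMn mulrA ler_wpM2r// sqr_ge0.
  by move: dl Sv l1q; lra.
have upper : c / 2 * q ^+ 2 <= 2 * b * lambda * q.
  apply: (le_trans lower); move: vb.
  by rewrite halfE -/q; lra.
have [->|qn0] := eqVneq q 0; first by rewrite divr_ge0 ?mulr_ge0// ltW.
have qp : 0 < q by rewrite lt_def qn0.
rewrite ler_pdivlMr//.
have {}upper : c / 2 * q <= 2 * b * lambda by rewrite -(ler_pM2r qp); lra.
by lra.
Qed.

Lemma lasso_l1_rate : l1norm v <= 4 * a * b * lambda / c.
Proof.
apply: (le_trans va); apply: (le_trans (ler_wpM2l a0 lasso_l2_rate)).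
by rewrite [leLHS](_ : _ = 4 * a * b * lambda / c)//; ring.
Qed.

Lemma lasso_prediction_rate :
  N%:R^-1 * sqr_l2norm (X *m v) <= 8 * b ^+ 2 * lambda ^+ 2 / c.
Proof.
apply: (@le_trans _ _ (2 * (b * (lambda * Num.sqrt (sqr_l2norm v))))).
  by move: vb; rewrite halfE; lra.
apply: (@le_trans _ _ (2 * (b * (lambda * (4 * b * lambda / c))))).
  by rewrite !ler_wpM2l ?lasso_l2_rate.
by rewrite [leLHS](_ : _ = 8 * b ^+ 2 * lambda ^+ 2 / c)//; ring.
Qed.

End restricted_eigenvalue.

(** * Algebra of the one-step estimator *)

Section one_step_algebra.
Context (R : realType) (N n : nat).
Implicit Types (X : 'M[R]_(N, n)) (Theta : 'M[R]_n) (eps : 'cV[R]_N).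

(** The noise enters the j-th coordinate of the one-step estimator through its
    inner product with this vector. *)
Definition score Theta X (j : 'I_n) : 'cV[R]_N := X *m (row j Theta)^T.

Lemma score_dot Theta X j (w : 'cV[R]_N) :
  (Theta *m X^T *m w) j 0 = dot (score Theta X j) w.
Proof.
transitivity ((row j (Theta *m X^T *m w)) 0 0); first by rewrite [RHS]mxE.
by rewrite !row_mul dotE trmx_mul trmxK.
Qed.

Lemma entry_dot m p (A : 'M[R]_(m, p)) i j :
  A i j = dot (delta_mx i 0) (A *m delta_mx j 0).
Proof. by rewrite dot_delta -colE [RHS]mxE. Qed.

Lemma trmx_mul_delta Theta (j : 'I_n) : Theta^T *m delta_mx j 0 = (row j Theta)^T.
Proof. by rewrite -colE tr_row. Qed.

(** The variance estimate in the statistic is the squared length of the score,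
    so that dividing by its square root standardizes the noise term exactly.
    *)
Lemma score_norm Theta X j :
  (Theta *m sample_cov X *m Theta^T) j j = N%:R^-1 * sqr_l2norm (score Theta X j).
Proof.
by rewrite entry_dot -!mulmxA dot_mulmxr trmx_mul_delta dot_sample_cov dotvv.
Qed.

(** Feasibility keeps (Theta S) j j above 1 / 2, for the sample covariance S,
    while Cauchy-Schwarz bounds its square by (Theta S Theta^T) j j times S j
    j. *)
Lemma clime_variance_lower_bound Theta X j (mu K : R) :
  clime_feasible mu X Theta -> mu <= 1 / 2 -> sample_cov X j j <= K -> 0 < K ->
  (4 * K)^-1 <= N%:R^-1 * sqr_l2norm (score Theta X j).
Proof.
move=> feas mu12 SK K0; set q := N%:R^-1 * _.
have q0 : 0 <= q by rewrite mulr_ge0 ?sqr_l2norm_ge0.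
have diag : (Theta *m sample_cov X) j j =
    N%:R^-1 * dot (score Theta X j) (X *m delta_mx j 0).
  by rewrite entry_dot -!mulmxA dot_mulmxr trmx_mul_delta dot_sample_cov.
have : (Theta *m sample_cov X) j j ^+ 2 <= q * K.
  apply: (@le_trans _ _ (q * sample_cov X j j)); last by rewrite ler_wpM2l.
  rewrite diag entry_dot dot_sample_cov dotvv exprMn /q.
  rewrite [leRHS]mulrACA -[in leRHS]expr2 ler_wpM2l ?sqr_ge0//.
  exact: cauchy_schwarz.
have : 1 / 2 <= (Theta *m sample_cov X) j j.
  have diagB (A : 'M[R]_n) : (A - 1%:M) j j = A j j - 1 by rewrite !mxE eqxx.
  have := feas j j; rewrite diagB.
  by rewrite ler_norml => /andP[+ _]; lra.
move=> h1 h2; rewrite invfM ler_pdivrMr// -div1r mulrC.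
have : (1 / 2) ^+ 2 <= (Theta *m sample_cov X) j j ^+ 2 by rewrite ler_sqr ?nnegrE//; lra.
by lra.
Qed.

Context (X : 'M[R]_(N, n)) (eps : 'cV[R]_N) (bstar bhat : 'cV[R]_n).
Context (Theta : 'M[R]_n) (j : 'I_n) (sigma : R).
Let v := bhat - bstar.
Let y := X *m bstar + eps.

Let residualE : y - X *m bhat = eps - X *m v.
Proof. by rewrite /y /v mulmxBr opprB [RHS]addrCA addrA. Qed.

Lemma sigma_hatE : sigma_hat X y bhat = Num.sqrt (N%:R^-1 * sqr_l2norm (eps - X *m v)).
Proof.
rewrite -residualE /sigma_hat; congr (Num.sqrt (_ * _)).
by apply: eq_bigr => i _; rewrite [in RHS]mxE [in X in _ = (_ + X) ^+ 2]mxE.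
Qed.

(** The correction term removes the first-order effect of the estimation error
    v, of which only (Theta S - I) v is left. *)
Lemma one_step_error : one_step X y bhat Theta j 0 - bstar j 0 =
  N%:R^-1 * dot (score Theta X j) eps
  - dot ((row j (Theta *m sample_cov X - 1%:M))^T) v.
Proof.
have -> : dot ((row j (Theta *m sample_cov X - 1%:M))^T) v =
    ((Theta *m sample_cov X - 1%:M) *m v) j 0.
  by rewrite dotE trmxK -row_mul mxE.
rewrite /one_step residualE mulmxBr scalerBr -score_dot mulmxBl mul1mx.
rewrite /sample_cov -scalemxAr -scalemxAl !mulmxA.
have addE (u w : 'cV[R]_n) : (u + w) j 0 = u j 0 + w j 0 by rewrite mxE.
have oppE (u : 'cV[R]_n) : (- u) j 0 = - u j 0 by rewrite mxE.
have scaleE t (w : 'cV[R]_n) : (t *: w) j 0 = t * w j 0 by rewrite mxE.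
rewrite !(addE, oppE, scaleE).
by ring.
Qed.

Lemma studentizedE (rho := sigma_hat X y bhat / sigma)
    (q := N%:R^-1 * sqr_l2norm (score Theta X j)) :
  (0 < N)%N -> 0 < sigma -> 0 < sqr_l2norm (score Theta X j) -> 0 < rho ->
  studentized X y bstar bhat Theta j =
  (dot (score Theta X j) eps / (sigma * Num.sqrt (sqr_l2norm (score Theta X j)))
   - Num.sqrt N%:R * dot ((row j (Theta *m sample_cov X - 1%:M))^T) v
     / (sigma * Num.sqrt q)) / rho.
Proof.
move=> N0 sigma0; rewrite /studentized score_norm one_step_error -/q /rho.
set g := sqr_l2norm _ => g0 rho0.
set D := dot _ v; set S := dot _ eps.
have Np : 0 < N%:R :> R by rewrite ltr0n.
have -> : Num.sqrt q = Num.sqrt g / Num.sqrt N%:R.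
  by rewrite /q mulrC sqrtrM ?sqrtrV// ltW.
have s1 : Num.sqrt g != 0 by rewrite gt_eqF// sqrtr_gt0.
have s2 : Num.sqrt N%:R != 0 :> R by rewrite gt_eqF// sqrtr_gt0.
have s3 : sigma_hat X y bhat != 0.
  by apply/eqP => h; move: rho0; rewrite h mul0r ltxx.
have -> : N%:R^-1 = (Num.sqrt N%:R * Num.sqrt N%:R)^-1 :> R.
  by rewrite -expr2 sqr_sqrtr// ltW.
field; by rewrite s1 s2 s3 gt_eqF.
Qed.

Lemma bias_le (mu : R) :
  clime_feasible mu X Theta ->
  `|dot ((row j (Theta *m sample_cov X - 1%:M))^T) v| <= mu * l1norm v.
Proof. by move=> feas; apply: hoelder_dot => i; rewrite mxE mxE; exact: feas. Qed.

End one_step_algebra.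

(** * Quadratic forms and eigenvalues *)

Section rayleigh.
Context (R : realType).

Lemma continuous_sum_fun (T : topologicalType) n (F : 'I_n -> T -> R) :
  (forall i, continuous (F i)) -> continuous (fun x => \sum_i F i x).
Proof.
move=> cF; elim: (index_enum _) => [|i s IH].
  by under eq_fun do rewrite big_nil; move=> x; exact: cvg_cst.
under eq_fun do rewrite big_cons.
by move=> x; apply: cvgD; [exact: cF|exact: IH].
Qed.

Lemma dot_tr_continuous n (A : 'M[R]_n) :
  continuous (fun x : 'rV[R]_n => dot x^T (A *m x^T)).
Proof.
rewrite (_ : (fun _ => _) = fun x : 'rV[R]_n =>
    \sum_i (x 0 i * \sum_j A i j * x 0 j)); last first.
  apply/funext => x; apply: eq_bigr => i _; rewrite !mxE.
  by congr (_ * _); apply: eq_bigr => j _; rewrite mxE.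
apply: continuous_sum_fun => i x; apply: continuousM; first exact: coord_continuous.
apply: continuous_sum_fun => j {}x; apply: continuousM; first exact: cst_continuous.
exact: coord_continuous.
Qed.

(** Along the line x + t w with w = B x the form equals 2 t |w|^2 + t^2 r. It
    is nonnegative for every t, which forces w = 0. *)
Lemma psd_kernel n (B : 'M[R]_n) (x : 'cV[R]_n) : B^T = B ->
  (forall w, 0 <= dot w (B *m w)) -> dot x (B *m x) = 0 -> B *m x = 0.
Proof.
move=> BS psd xB; apply: sqr_l2norm_eq0; rewrite -dotvv.
set w := B *m x; set s := dot w w; set r := dot w (B *m w).
have r0 : 0 <= r by exact: psd.
(* a small enough negative multiple of s; the denominator r + 1 also covers r
   = 0 *)
pose t := - s / (r + 1).
have : 0 <= 2 * t * s + t ^+ 2 * r.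
  have := psd (x + t *: w); rewrite mulmxDr -scalemxAr !dotDl !dotDr !dotZl !dotZr.
  rewrite xB -/w -/s -/r.
  have -> : dot x (B *m w) = s by rewrite dot_mulmxr BS.
  by rewrite (_ : 0 + _ + _ = 2 * t * s + t ^+ 2 * r)//; ring.
have r1 : r + 1 != 0 by rewrite gt_eqF// ltr_wpDl.
have -> : 2 * t * s + t ^+ 2 * r = - (s ^+ 2 * ((r + 2) / (r + 1) ^+ 2)).
  by rewrite /t; field.
rewrite oppr_ge0 pmulr_lle0; last first.
  by rewrite divr_gt0 ?exprn_gt0//; lra.
by move=> s2; apply/eqP; rewrite -sqrf_eq0 eq_le s2 sqr_ge0.
Qed.

(** By compactness the form attains its minimum m on the unit sphere at some
    x0. The form of A - m I is then nonnegative and vanishes at x0, so x0 is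
    an eigenvector for m, and m >= c. *)
Lemma eigenvalue_lower_bound n (A : 'M[R]_n) (c : R) : A^T = A ->
  (forall a, eigenvalue A a -> c <= a) ->
  forall v : 'cV[R]_n, c * sqr_l2norm v <= dot v (A *m v).
Proof.
move=> AS eigc v; have [->|vn0] := eqVneq v 0.
  by rewrite mulmx0 -dotvv /dot !big1 ?mulr0// => i _; rewrite mxE mul0r.
pose S := [set x : 'rV[R]_n | sqr_l2norm x^T = 1].
have norm_continuous : continuous (fun x : 'rV[R]_n => sqr_l2norm x^T).
  rewrite (_ : (fun x => _) = (fun x : 'rV[R]_n => dot x^T (1%:M *m x^T))).
    exact: dot_tr_continuous.
  by apply/funext => x; rewrite mul1mx dotvv.
have normalize (w : 'cV[R]_n) : w != 0 ->
    S (((Num.sqrt (sqr_l2norm w))^-1 *: w)^T).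
  move=> wn0; rewrite /S /= trmxK sqr_l2normZ exprVn sqr_sqrtr ?sqr_l2norm_ge0//.
  rewrite mulVf//; apply: contra wn0 => /eqP w0.
  by apply/eqP; exact: sqr_l2norm_eq0.
have S0 : S !=set0 by eexists; exact: normalize vn0.
have cS : compact S.
  apply: (@subclosed_compact _ _ [set x : 'rV[R]_n |
      forall i, `[(-1 : R), 1]%classic (x ord0 i)]).
  - rewrite (_ : S = (fun x : 'rV[R]_n => sqr_l2norm x^T) @^-1` [set 1]) //.
    by apply: preimage_closed => //; exact: closed1.
  - by apply: (@rV_compact _ _ (fun=> `[(-1 : R), 1]%classic)) => i; exact: segment_compact.
  - move=> x Sx i; rewrite /= in_itv/= -ler_norml -(@ler_sqr _ `|_|) ?nnegrE//.
    rewrite expr1n real_normK ?num_real// -[leRHS]Sx /sqr_l2norm (bigD1 i)//= mxE.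
    by rewrite lerDl sumr_ge0// => k _; exact: sqr_ge0.
have cf : {within S, continuous (fun x : 'rV[R]_n => dot x^T (A *m x^T))}.
  by apply: continuous_subspaceT; exact: dot_tr_continuous.
have [x0 /set_mem Sx0 minx0] := EVT_min_rV S0 cS cf.
set m := dot x0^T (A *m x0^T) in minx0.
have rayleigh (w : 'cV[R]_n) : m * sqr_l2norm w <= dot w (A *m w).
  have [->|wn0] := eqVneq w 0.
    by rewrite mulmx0 -dotvv /dot !big1 ?mulr0// => i _; rewrite mxE mul0r.
  have := minx0 _ (mem_set (normalize _ wn0)).
  rewrite trmxK -scalemxAr dotZl dotZr mulrA -expr2 exprVn.
  rewrite sqr_sqrtr ?sqr_l2norm_ge0// mulrC -ler_pdivlMr ?invr_gt0 ?invrK//.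
    by rewrite lt_def sqr_l2norm_ge0 andbT; apply: contra wn0 => /eqP /sqr_l2norm_eq0 ->.
suff cm : c <= m.
  by apply: le_trans (rayleigh v); rewrite ler_wpM2r// sqr_l2norm_ge0.
apply: eigc; apply/eigenvalueP; exists x0; last first.
  apply/eqP => x00; move: Sx0; rewrite x00 /S /= trmx0 -dotvv /dot big1.
    by move/eqP; rewrite eq_sym oner_eq0.
  by move=> i _; rewrite mxE mul0r.
apply: trmx_inj; rewrite trmx_mul AS linearZ /=.
apply/eqP; rewrite -subr_eq0; apply/eqP.
have -> : A *m x0^T - m *: x0^T = (A - m%:M) *m x0^T.
  by rewrite mulmxBl mul_scalar_mx.
apply: psd_kernel.
- by rewrite linearB /= AS tr_scalar_mx.
- move=> w; rewrite mulmxBl mul_scalar_mx dotBr dotZr dotvv subr_ge0.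
  exact: rayleigh.
- rewrite mulmxBl mul_scalar_mx dotBr dotZr dotvv -/m.
  by move: Sx0; rewrite /S /= => ->; rewrite mulr1 subrr.
Qed.

Section inverse.
Context (n : nat) (A : 'M[R]_n) (c : R).
Hypothesis c0 : 0 < c.
Hypothesis Ac : forall v : 'cV[R]_n, c * sqr_l2norm v <= dot v (A *m v).

Lemma coercive_unitmx : A \in unitmx.
Proof.
rewrite -unitmx_tr -row_free_unit; apply/row_freeP.
have [//|] := boolP (row_free A^T); first by move/row_freeP.
rewrite -kermx_eq0 => /rowV0Pn[u uker un0]; exfalso.
have /eqP uA : u *m A^T == 0 by rewrite -sub_kermx.
have := Ac u^T; rewrite -[A *m _]trmxK trmx_mul trmxK uA trmx0.
rewrite /dot big1 => [|i _]; last by rewrite [X in _ * X]mxE mulr0.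
rewrite pmulr_rle0// => u0; move: un0.
rewrite -trmx_eq0 (@sqr_l2norm_eq0 _ _ u^T) ?eqxx//.
by apply/eqP; rewrite eq_le u0 sqr_l2norm_ge0.
Qed.

(** With w = A^-1 u, c |w|^2 <= <w, u> <= |w| |u|. *)
Lemma sqr_l2norm_invmx (u : 'cV[R]_n) :
  sqr_l2norm (invmx A *m u) <= (c^-1) ^+ 2 * sqr_l2norm u.
Proof.
set w := invmx A *m u; set q := sqr_l2norm w; set p := sqr_l2norm u.
have cq : c * q <= dot w u.
  by have := Ac w; rewrite /w mulmxA mulmxV ?coercive_unitmx// mul1mx.
have q0 : 0 <= q by exact: sqr_l2norm_ge0.
have h : (c * q) ^+ 2 <= q * p.
  apply: le_trans (cauchy_schwarz w u).
  by rewrite ler_sqr ?nnegrE// ?mulr_ge0 ?(ltW c0)// (le_trans _ cq)// mulr_ge0// ltW.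
have [->|qn0] := eqVneq q 0; first by rewrite mulr_ge0 ?sqr_ge0 ?sqr_l2norm_ge0.
have qp : 0 < q by rewrite lt_def qn0.
rewrite exprVn mulrC ler_pdivlMr ?exprn_gt0//.
rewrite -(ler_pM2l qp); apply: le_trans h.
by rewrite [leRHS](_ : _ = q * (q * c ^+ 2))//; ring.
Qed.

End inverse.
End rayleigh.

(** * Changes of variables *)

Section comparison_sets.
Context d (T : measurableType d) (R : realType) (f g : T -> R).
Hypotheses (mf : measurable_fun setT f) (mg : measurable_fun setT g).

Lemma measurable_le_set : measurable [set x | f x <= g x].
Proof.
rewrite -[X in measurable X]setTI.
by have /(_ measurableT [set true]) := measurable_fun_ler mf mg; apply.
Qed.

Lemma measurable_lt_set : measurable [set x | f x < g x].
Proof.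
rewrite -[X in measurable X]setTI.
by have /(_ measurableT [set true]) := measurable_fun_ltr mf mg; apply.
Qed.

End comparison_sets.

Section weighted_integral.
Local Open Scope ereal_scope.
Context d1 d2 (X : measurableType d1) (Y : measurableType d2) (R : realType).
Context (phi : X -> Y) (mphi : measurable_fun setT phi).
Context (mu : {measure set X -> \bar R}) (nu : {measure set Y -> \bar R}).
Context (W : X -> R) (mW : measurable_fun setT W) (W0 : forall x, (0 <= W x)%R).
Hypothesis nuE : forall B, measurable B ->
  \int[mu]_(x in phi @^-1` B) (W x)%:E = nu B.

Import HBNNSimple.

(** One change of variables for several uses: densities (phi the identity),
    image measures (W = 1), affine substitutions, and the integration of one
    factor of a product of independent variables against its law (W the
    product of the others). It holds for indicators by hypothesis, and extends
    through simple functions by monotone convergence. *)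
Lemma ge0_integral_weight (f : Y -> \bar R) :
  measurable_fun setT f -> (forall y, 0 <= f y) ->
  \int[mu]_x (f (phi x) * (W x)%:E) = \int[nu]_y f y.
Proof.
move=> mf f0; have mT := @measurableT _ Y.
pose f_ := nnsfun_approx mT mf.
have mpre r n : measurable (phi @^-1` (f_ n @^-1` [set r])).
  by rewrite -[X in measurable X]setTI; exact: mphi.
have mfphi n : measurable_fun setT (fun x => (f_ n (phi x))%:E).
  by apply/measurable_EFinP; apply: measurableT_comp.
have mind r n : measurable_fun setT (fun x => \1_(f_ n @^-1` [set r]) (phi x) : R).
  rewrite (_ : (fun _ => _) = \1_(phi @^-1` (f_ n @^-1` [set r]))).
    exact: measurable_indic.
  by [].
transitivity (limn (fun n => \int[mu]_x ((f_ n (phi x))%:E * (W x)%:E))).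
  rewrite -monotone_convergence//; last 3 first.
    - by move=> n; apply: emeasurable_funM => //; exact/measurable_EFinP.
    - by move=> n x _; rewrite mule_ge0// lee_fin.
    - move=> x _ m n mn; apply: lee_wpmul2r; rewrite lee_fin//.
      exact/lefP/nd_nnsfun_approx.
  apply: eq_integral => x _; apply/esym/cvg_lim => //.
  apply: cvgeZr => //; exact: cvg_nnsfun_approx.
transitivity (limn (fun n => \int[nu]_y (f_ n y)%:E)); last first.
  rewrite -monotone_convergence//; last 3 first.
    - by move=> n; exact/measurable_EFinP.
    - by move=> n x _; rewrite lee_fin.
    - by move=> x _ m n mn; rewrite lee_fin; exact/lefP/nd_nnsfun_approx.
  apply: eq_integral => y _; apply/cvg_lim => //.
  exact: cvg_nnsfun_approx.
congr (limn _); apply/funext => n.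
under eq_integral => x _.
  rewrite fimfunE -fsumEFin// ge0_mule_fsuml; last first.
    by move=> r; rewrite nnfun_muleindic_ge0.
  over.
rewrite ge0_integral_fsum//; last 2 first.
  - move=> r; apply: emeasurable_funM; last exact/measurable_EFinP.
    apply/measurable_EFinP; apply: measurable_funM => //.
    exact: mind.
  - by move=> r x _; rewrite mule_ge0 ?[0 <= (W _)%:E]lee_fin// EFinM nnfun_muleindic_ge0.
under [RHS]eq_integral do rewrite fimfunE -fsumEFin//.
rewrite ge0_integral_fsum//; last 2 first.
  - by move=> r; exact/measurable_EFinP/measurable_funM.
  - by move=> r x _; rewrite nnfun_muleindic_ge0.
apply: eq_fsbigr => r _; rewrite integralZl_indic_nnsfun// integral_indic//= setIT.
have [r0|r0] := ltP r 0%R.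
  rewrite preimage_nnfun0// measure0 mule0 integral0_eq// => x _.
  by rewrite indic0 mulr0 mul0e.
under eq_integral do rewrite EFinM -muleA.
rewrite ge0_integralZl//=; last 2 first.
  - apply: emeasurable_funM; last exact/measurable_EFinP.
    by apply/measurable_EFinP; exact: mind.
  - by move=> x _; rewrite mule_ge0 ?lee_fin.
rewrite -nuE// [in RHS]integral_mkcond; congr (_ * _); apply: eq_integral => x _.
rewrite patchE indicE.
have -> : (phi x \in f_ n @^-1` [set r]) = (x \in phi @^-1` (f_ n @^-1` [set r])).
  by apply/idP/idP; rewrite !inE.
by case: ifP => _; rewrite ?mul1e ?mul0e.
Qed.
End weighted_integral.

Section affine_change.
Local Open Scope ereal_scope.
Context (R : realType).
Local Notation mu := (@lebesgue_measure R).

Lemma measurable_affine (a c : R) :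
  measurable_fun (setT : set (measurableTypeR R)) (fun x : R => (a * x + c)%R : measurableTypeR R).
Proof. by apply: measurable_funD => //; exact: measurable_funM. Qed.

(** The scaled image measure gives every interval its length, hence is the
    Lebesgue measure. *)
Lemma lebesgue_measure_affine (a c : R) (A : set R) : a != 0%R -> measurable A ->
  `|a|%:E * mu [set x | A (a * x + c)%R] = mu A.
Proof.
move=> a0 mA; apply/esym.
pose g := fun x : R => (a * x + c)%R : measurableTypeR R.
have mg : measurable_fun setT g := measurable_affine a c.
pose m : {measure set (measurableTypeR R) -> \bar R} :=
  measure_function_pushforward__canonical__measure_function_Measure mu mg.
pose k : {nonneg R} := NngNum (normr_ge0 a).
transitivity ((mscale k m : {measure set (measurableTypeR R) -> \bar R}) A); last by [].
apply: lebesgue_measure_unique => //.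
move=> _ [[l u]] _ <-.
change (mu `]l, u]%classic = `|a|%:E * mu (g @^-1` `]l, u]%classic)).
have dE (x y : R) : (x - y = a * ((x - c) / a - (y - c) / a))%R by field.
have [an|ap|] := ltgtP a 0%R; last by move/eqP: a0.
- rewrite (_ : g @^-1` _ = `[((u - c) / a)%R, ((l - c) / a)%R[%classic); last first.
    apply/seteqP; split => x; rewrite /g/= !in_itv/= => /andP[];
      rewrite ?ler_ndivrMr ?ltr_ndivlMr ?ler_ndivrMr ?ltr_ndivlMr// => h1 h2;
      apply/andP; split; lra.
  rewrite !lebesgue_measure_itv/= !lte_fin.
  have -> : ((u - c) / a < (l - c) / a = (l < u))%R.
    by rewrite ltr_ndivrMr// divfK// ltrD2r.
  case: ifP => _; last by rewrite mule0.
  by rewrite -!EFinB -EFinM ltr0_norm// mulNr -mulrN opprB -dE.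
- rewrite (_ : g @^-1` _ = `]((l - c) / a)%R, ((u - c) / a)%R]%classic); last first.
    apply/seteqP; split => x; rewrite /g/= !in_itv/= => /andP[];
      rewrite ?ltr_pdivrMr ?ler_pdivlMr// => h1 h2; apply/andP; split; lra.
  rewrite !lebesgue_measure_itv/= !lte_fin.
  have -> : ((l - c) / a < (u - c) / a = (l < u))%R.
    by rewrite ltr_pdivrMr// divfK// ltrD2r.
  case: ifP => _; last by rewrite mule0.
  by rewrite -!EFinB -EFinM gtr0_norm// -dE.
Qed.

Lemma ge0_integral_affine (a c : R) (f : R -> \bar R) : a != 0%R ->
  measurable_fun setT f -> (forall x, 0 <= f x) ->
  \int[mu]_x (f (a * x + c)%R * `|a|%:E) = \int[mu]_x f x.
Proof.
move=> a0 mf f0.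
have := (@ge0_integral_weight _ _ _ _ R _ (measurable_affine a c) mu mu (fun=> `|a|%R) (@measurable_cst _ _ _ _ _ _) (fun=> normr_ge0 a) _ f mf f0).
apply.
move=> B mB; rewrite integral_cst//.
  exact: (lebesgue_measure_affine c a0 mB).
by rewrite -[X in measurable X]setTI; exact: measurable_affine.
Qed.

End affine_change.

(** * Scaling and convolution of normal laws *)

Section normal_law.
Context (R : realType).
Local Notation mu := (@lebesgue_measure R).
Implicit Types (s t a m : R).

Lemma normal_peakE s : normal_peak s = `|s|^-1 * (Num.sqrt (pi *+ 2))^-1.
Proof.
rewrite /normal_peak -mulrnAr sqrtrM ?sqr_ge0// sqrtr_sqr invfM//.
Qed.

Lemma sqr_double s : s ^+ 2 *+ 2 = 2 * s ^+ 2.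
Proof. by rewrite mulr_natl. Qed.

Lemma ge0_integral_normal_prob m s (f : R -> \bar R) :
  measurable_fun [set: measurableTypeR R] f -> (forall x, 0 <= f x)%E ->
  (\int[normal_prob m s]_x f x = \int[mu]_x (f x * (normal_pdf m s x)%:E))%E.
Proof.
move=> mf f0; apply/esym.
have mid : measurable_fun (setT : set (measurableTypeR R))
  (@id R : measurableTypeR R -> measurableTypeR R) by exact: measurable_id.
exact: (@ge0_integral_weight _ _ _ _ R _ mid mu (normal_prob m s) (normal_pdf m s)
  (@measurable_normal_pdf R m s) (@normal_pdf_ge0 R m s) _ f mf f0).
Qed.

Lemma normal_pdf_scale s a y : s != 0 -> a != 0 ->
  normal_pdf 0 s y = normal_pdf 0 (s * a) (a * y + 0) * `|a|.
Proof.
move=> s0 a0; rewrite !normal_pdfE ?mulf_neq0// !normal_peakE normrM invfM.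
rewrite /normal_fun !subr0 addr0.
have -> : - (a * y) ^+ 2 / ((s * a) ^+ 2 *+ 2) = - y ^+ 2 / (s ^+ 2 *+ 2).
  by rewrite !sqr_double; field; rewrite s0 a0.
have an0 : `|a| != 0 by rewrite normr_eq0.
have sn0 : `|s| != 0 by rewrite normr_eq0.
set q := (Num.sqrt _)^-1; set e := expR _; field.
by rewrite an0 sn0.
Qed.

Lemma normal_prob_scale s a (A : set R) : s != 0 -> a != 0 -> measurable A ->
  normal_prob 0 s [set y | A (a * y)] = normal_prob 0 (s * a) A.
Proof.
move=> s0 a0 mA; rewrite /normal_prob integral_mkcond [RHS]integral_mkcond.
rewrite -[RHS](@ge0_integral_affine R a 0)//.
- apply: eq_integral => y _; rewrite !patchE.
  have -> : (y \in [set y | A (a * y)]) = (a * y + 0 \in A).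
    by apply/idP/idP; rewrite !inE /= addr0.
  by case: ifP => _; rewrite ?mul0e// (normal_pdf_scale y s0 a0) EFinM.
- apply/(measurable_restrictT _ _).1 => //.
  by apply/measurable_EFinP/measurable_funTS; exact: measurable_normal_pdf.
- by move=> x; rewrite patchE; case: ifP; rewrite // lee_fin normal_pdf_ge0.
Qed.

(** Completing the square in y: the joint density of y and z = x + a y is the
    density of z times the conditional density of y given z, which is again
    normal. *)
Lemma normal_pdf_convolution s t a (r := Num.sqrt (s ^+ 2 + (a * t) ^+ 2)) y z :
  s != 0 -> t != 0 ->
  normal_pdf 0 t y * normal_pdf 0 s (z - a * y) =
  normal_pdf 0 r z * normal_pdf (a * t ^+ 2 * z / r ^+ 2) (s * t / r) y.
Proof.
move=> s0 t0.
have r2 : r ^+ 2 = s ^+ 2 + (a * t) ^+ 2 by rewrite sqr_sqrtr// addr_ge0 ?sqr_ge0.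
have rr0 : s ^+ 2 + (a * t) ^+ 2 != 0.
  by rewrite gt_eqF// ltr_wpDr ?sqr_ge0// lt_def sqrf_eq0 s0 sqr_ge0.
have r0 : r != 0 by rewrite -sqrf_eq0 r2.
rewrite !normal_pdfE ?mulf_neq0 ?invr_eq0// mulrACA [RHS]mulrACA.
rewrite /normal_fun -!expRD; congr (_ * expR _).
  rewrite !normal_peakE normrM normfV normrM.
  by field; rewrite !normr_eq0 s0 t0 r0 gt_eqF// sqrtr_gt0 pmulrn_lgt0// pi_gt0.
rewrite !sqr_double !exprMn !exprVn r2 !subr0.
by field; rewrite s0 t0 rr0.
Qed.

Lemma normal_prob_convolution s t a (A : set R) :
  s != 0 -> t != 0 -> measurable A ->
  (\int[normal_prob 0 t]_y normal_prob 0 s [set x | A (x + a * y)%R] =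
   normal_prob 0 (Num.sqrt (s ^+ 2 + (a * t) ^+ 2)) A)%E.
Proof.
move=> s0 t0 mA; set r := Num.sqrt _.
pose g (yz : R * R) := normal_pdf 0 t yz.1 * normal_pdf 0 s (yz.2 - a * yz.1) *
   \1_A yz.2.
have mg : measurable_fun [set: measurableTypeR R * measurableTypeR R] g.
  apply: measurable_funM; first apply: measurable_funM.
  - by apply: measurableT_comp => //; exact: measurable_normal_pdf.
  - apply: measurableT_comp; first exact: measurable_normal_pdf.
    by apply: measurable_funB => //; exact: measurable_funM.
  - by apply: measurableT_comp => //; exact: measurable_indic.
have g0 yz : 0 <= g yz.
  by rewrite !mulr_ge0 ?normal_pdf_ge0.
have inner y : ((normal_prob 0 s [set x | A (x + a * y)%R] * (normal_pdf 0 t y)%:E) =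
    \int[mu]_z (g (y, z))%:E)%E.
  have -> : (normal_prob 0 s [set x | A (x + a * y)%R] =
      \int[mu]_z ((normal_pdf 0 s (z - a * y))%:E * (\1_A z)%:E))%E.
    rewrite /normal_prob integral_mkcond.
    rewrite -[RHS](@ge0_integral_affine R 1 (a * y))//; last 2 first.
    - apply/measurable_EFinP; apply: measurable_funM.
        by apply: measurableT_comp => //; [exact: measurable_normal_pdf|exact: measurable_funB].
      exact: measurable_indic.
    - by move=> z; rewrite mule_ge0// lee_fin normal_pdf_ge0.
    apply: eq_integral => x _; rewrite patchE normr1 mule1 mul1r addrK indicE.
    have -> : (x \in [set x | A (x + a * y)]) = (x + a * y \in A).
      by apply/idP/idP; rewrite !inE.
    by case: ifP => _; rewrite ?mule1 ?mule0.
  rewrite muleC -ge0_integralZl//=; last 3 first.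
  - apply: emeasurable_funM; apply/measurable_EFinP.
      by apply: measurableT_comp => //; [exact: measurable_normal_pdf|exact: measurable_funB].
    exact: measurable_indic.
  - by move=> z _; rewrite mule_ge0// lee_fin normal_pdf_ge0.
  - by rewrite lee_fin normal_pdf_ge0.
  by apply: eq_integral => z _; rewrite -!EFinM mulrA.
rewrite ge0_integral_normal_prob//; last first.
  pose C := (fun yx : measurableTypeR R * measurableTypeR R =>
    (yx.2 + a * yx.1 : measurableTypeR R)) @^-1` A.
  have mC : measurable C.
    rewrite -[C]setTI.
    suff : measurable_fun [set: measurableTypeR R * measurableTypeR R]
      (fun yx : measurableTypeR R * measurableTypeR R =>
        (yx.2 + a * yx.1 : measurableTypeR R)) by apply.
    by apply: measurable_funD => //; apply: measurable_funM.
  rewrite (_ : (fun y => _) = normal_prob 0 s \o xsection C).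
    exact: measurable_fun_xsection.
  apply/funext => y /=; congr (normal_prob 0 s _).
  by apply/seteqP; split => x; rewrite /xsection /= inE.
under eq_integral do rewrite inner.
rewrite (@fubini_tonelli _ _ _ _ _ mu mu (EFin \o g))//=; last by move/measurable_EFinP : mg.
rewrite /normal_prob [RHS]integral_mkcond; apply: eq_integral => z _.
rewrite patchE; case: ifPn => [zA|zA].
  transitivity (\int[mu]_y ((normal_pdf 0 r z)%:E *
     (normal_pdf (a * t ^+ 2 * z / r ^+ 2) (s * t / r) y)%:E))%E.
    apply: eq_integral => y _; rewrite /g /= indicE zA mulr1.
    by rewrite normal_pdf_convolution// EFinM.
  rewrite ge0_integralZl//=; last 3 first.
  - by apply/measurable_EFinP; exact: measurable_normal_pdf.
  - by move=> y _; rewrite lee_fin normal_pdf_ge0.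
  - by rewrite lee_fin normal_pdf_ge0.
  by rewrite integral_normal_pdf mule1.
by apply: integral0_eq => y _; rewrite /g /= indicE (negbTE zA) mulr0.
Qed.
End normal_law.

(** * Exponential moments of normal and sub-Gaussian variables *)

Section normal_moments.
Context (R : realType).
Local Notation mu := (@lebesgue_measure R).
Implicit Types (s t a : R).

Lemma integral_normal_scaled k m s (f : R -> R) : 0 <= k ->
  (forall x, f x = k * normal_pdf m s x) -> (\int[mu]_x (f x)%:E = k%:E)%E.
Proof.
move=> k0 fE; under eq_integral do rewrite fE EFinM.
rewrite ge0_integralZl//=.
- by rewrite integral_normal_pdf mule1.
- by apply/measurable_EFinP; exact: measurable_normal_pdf.
- by move=> x _; rewrite lee_fin normal_pdf_ge0.
Qed.

(** Completing the square turns the integrand into a multiple of the normal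
    density centred at s^2 t. *)
Lemma normal_mgf s t : s != 0 ->
  (\int[mu]_x (expR (t * x) * normal_pdf 0 s x)%:E = (expR (s ^+ 2 * t ^+ 2 / 2))%:E)%E.
Proof.
move=> s0; apply: (@integral_normal_scaled _ (s ^+ 2 * t) s); first exact: expR_ge0.
move=> x; rewrite !normal_pdfE// /normal_fun mulrCA [RHS]mulrCA -!expRD.
by congr (_ * expR _); rewrite sqr_double; field.
Qed.

(** The integrand is a multiple of the normal density with standard deviation
    s / sqrt (1 - 2 a s^2). *)
Lemma normal_exp_sqr s a : s != 0 -> 2 * a * s ^+ 2 < 1 ->
  (\int[mu]_x (expR (a * x ^+ 2) * normal_pdf 0 s x)%:E =
   ((Num.sqrt (1 - 2 * a * s ^+ 2))^-1)%:E)%E.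
Proof.
move=> s0 as1; set k := Num.sqrt _.
have k2 : k ^+ 2 = 1 - 2 * a * s ^+ 2 by rewrite sqr_sqrtr// subr_ge0 ltW.
have k0 : 0 < k by rewrite sqrtr_gt0 subr_gt0.
have kn0 : k != 0 by rewrite gt_eqF.
apply: (@integral_normal_scaled _ 0 (s / k)); first by rewrite invr_ge0 ltW.
move=> x; rewrite !normal_pdfE ?mulf_neq0 ?invr_eq0// /normal_fun.
rewrite mulrCA -expRD [RHS]mulrA; congr (_ * expR _).
  rewrite !normal_peakE normrM normfV (gtr0_norm k0).
  set q := (Num.sqrt _)^-1; field.
  by rewrite normr_eq0 s0 kn0.
rewrite !subr0 !sqr_double exprMn exprVn k2; field.
by rewrite s0 gt_eqF// subr_gt0.
Qed.

End normal_moments.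

Section sub_gaussian.
Context d (T : measurableType d) (R : realType) (P : probability T R).
Local Notation mu := (@lebesgue_measure R).

Lemma mmt_gen_funE (Z : T -> R) t :
  ('M_P Z t = \int[P]_w (expR (t * Z w))%:E)%E.
Proof.
rewrite /mmt_gen_fun unlock; apply: eq_integral => w _ /=.
by rewrite mulrC.
Qed.

(** Averaging exp (t x Z) over a standard normal x gives exp (t^2 Z^2 / 2). By
    Tonelli the expectation over Z can be taken first, where the sub-Gaussian
    bound replaces Z by a normal variable of standard deviation sigma; what
    remains is a normal integral of exp (x^2 / 4). *)
Lemma sub_gaussian_exp_sqr (sigma : R) (Z : T -> R) : 0 < sigma ->
  measurable_fun setT Z -> sub_gaussian P sigma Z ->
  (\int[P]_w (expR (Z w ^+ 2 / (4 * sigma ^+ 2)))%:E <= 2%:E)%E.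
Proof.
move=> sigma0 mZ [_ sg].
have sn0 : sigma != 0 by rewrite gt_eqF.
(* chosen so that t^2 / 2 = 1 / (4 sigma^2) *)
pose t := (Num.sqrt 2 * sigma)^-1.
have t2 : t ^+ 2 = (2 * sigma ^+ 2)^-1.
  by rewrite exprVn exprMn sqr_sqrtr.
pose g (wx : T * R) := expR (t * Z wx.1 * wx.2) * normal_pdf 0 1 wx.2.
have g0 wx : 0 <= g wx by rewrite mulr_ge0 ?expR_ge0 ?normal_pdf_ge0.
have mg : measurable_fun [set: T * measurableTypeR R] g.
  apply: measurable_funM; last by apply: measurableT_comp => //; exact: measurable_normal_pdf.
  apply: measurableT_comp => //; apply: measurable_funM => //.
  by apply: measurable_funM => //; exact: measurableT_comp.
have -> : (\int[P]_w (expR (Z w ^+ 2 / (4 * sigma ^+ 2)))%:E =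
    \int[P]_w \int[mu]_x (g (w, x))%:E)%E.
  apply: eq_integral => w _; rewrite /g /= normal_mgf ?oner_neq0//.
  congr (expR _)%:E; rewrite expr1n mul1r exprMn t2; field.
  exact: sn0.
rewrite (@fubini_tonelli _ _ _ _ _ P mu (EFin \o g))//=; last by move/measurable_EFinP : mg.
apply: (@le_trans _ _ (\int[mu]_x (expR (4^-1 * x ^+ 2) * normal_pdf 0 1 x)%:E)%E).
  apply: ge0_le_integral => //=.
  - by move=> x _; apply: integral_ge0 => w _; rewrite lee_fin.
  - apply: (@measurable_fun_fubini_tonelli_G _ _ _ _ _ P (EFin \o g)) => //.
      by move/measurable_EFinP : mg.
  - apply/measurable_EFinP; apply: measurable_funM; last exact: measurable_normal_pdf.
    apply: measurableT_comp => //; apply: measurable_funM => //; exact: measurable_funX.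
  move=> x _; rewrite /g /=.
  under eq_integral do rewrite mulrC EFinM.
  rewrite ge0_integralZl//=; last 2 first.
  - apply/measurable_EFinP; apply: measurableT_comp => //; apply: measurable_funM => //.
    exact: measurable_funM.
  - by rewrite lee_fin normal_pdf_ge0.
  rewrite mulrC EFinM lee_wpmul2l// ?lee_fin ?normal_pdf_ge0//.
  have := sg (t * x); rewrite mmt_gen_funE.
  under eq_integral do rewrite mulrAC.
  move/le_trans; apply; rewrite lee_fin ler_expR exprMn t2.
  rewrite (_ : _ / 2 = 4^-1 * x ^+ 2)//; field.
  exact: sn0.
rewrite normal_exp_sqr ?oner_neq0//; last by rewrite expr1n mulr1; lra.
rewrite lee_fin expr1n mulr1 -[leRHS]invrK lef_pV2 ?posrE ?invr_gt0 ?sqrtr_gt0//; last lra.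
rewrite -[leLHS]ger0_norm// -sqrtr_sqr ler_sqrt; lra.
Qed.

End sub_gaussian.

(** * Expectations of products of independent variables *)

Section independent_product.
Context d (Om : measurableType d) (R : realType) (P : probability Om R).
Context d' (T : measurableType d') (I : finType) (Y : I -> Om -> T).
Hypothesis mY : forall i, measurable_fun setT (Y i).
Hypothesis indep : mutually_independent P Y.

Lemma mutually_independent_comp d2 (T2 : measurableType d2) (f : I -> T -> T2) :
  (forall i, measurable_fun setT (f i)) ->
  mutually_independent P (fun i w => f i (Y i w)).
Proof.
move=> mf B mB; apply: (indep (B := fun i => f i @^-1` B i)) => i.
by rewrite -[X in measurable X]setTI; exact: mf.
Qed.

(** Induction on the list s of the indices whose factor is not an indicator.
    When all factors are indicators the claim is independence itself.
    Otherwise, the induction hypothesis with the factor at i0 replaced by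
    indicators says that the product of the other factors, as a density, has
    on the events of Y i0 a constant multiple c of the law of Y i0; the factor
    at i0 is then integrated against this law. *)
Let expect_prod_from (s : seq I) (F : I -> T -> R) :
  (forall i, measurable_fun setT (F i)) ->
  (forall i x, 0 <= F i x) ->
  (forall i, \int[P]_w (F i (Y i w))%:E < +oo)%E ->
  (forall i, i \notin s -> exists2 B, measurable B & F i = \1_B) ->
  (\int[P]_w (\prod_i F i (Y i w))%:E = \prod_i \int[P]_w (F i (Y i w))%:E)%E.
Proof.
elim: s F => [|i0 s IH] F mF F0 Foo FB.
  have {}FB i : exists B, measurable B /\ F i = \1_B.
    by have [//|B mB ->] := FB i; exists B.
  have [B BP] := choice FB.
  have mYB i : measurable (Y i @^-1` B i).
    by rewrite -[X in measurable X]setTI; apply: mY => //; case: (BP i).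
  have prod_indic w : \prod_i F i (Y i w) = \1_(\bigcap_i (Y i @^-1` B i)) w.
    have [all_in|/existsNP[i notin]] := pselect (forall i, B i (Y i w)).
      transitivity (1 : R); last first.
        have h : (\bigcap_i (Y i @^-1` B i)) w by move=> i _; exact: all_in.
        by rewrite indicE mem_set.
      by apply: big1 => i _; case: (BP i) => _ ->; rewrite indicE mem_set.
    transitivity (0 : R); last by rewrite indicE memNset//= => h; exact/notin/h.
    by rewrite (bigD1 i)//=; case: (BP i) => _ ->; rewrite indicE memNset ?mul0r.
  under eq_integral do rewrite prod_indic.
  rewrite integral_indic//; last first.
    by apply: fin_bigcap_measurable => //; exact: finite_finset.
  rewrite setIT; transitivity (\prod_i P (Y i @^-1` B i))%E.
    by apply: indep => i; case: (BP i).
  apply: eq_bigr => i _; case: (BP i) => mB ->.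
  rewrite -[in LHS](setIT (_ @^-1` _)) -integral_indic//.
pose G i w := F i (Y i w).
have mG i : measurable_fun setT (G i) by exact: measurableT_comp.
have c0 : (0 <= \prod_(i | i != i0) \int[P]_w (G i w)%:E)%E.
  by apply: prode_ge0 => i _; apply: integral_ge0 => w _; rewrite lee_fin F0.
have cfin : (\prod_(i | i != i0) \int[P]_w (G i w)%:E)%E \is a fin_num.
  apply: prode_fin_num => i _; rewrite ge0_fin_numE ?Foo//.
  by apply: integral_ge0 => w _; rewrite lee_fin F0.
pose c : {nonneg R} := NngNum (fine_ge0 c0).
pose law : {measure set T -> \bar R} :=
  measure_function_pushforward__canonical__measure_function_Measure P (mY i0).
pose W w := \prod_(i | i != i0) G i w.
have mW : measurable_fun setT W.
  rewrite /W; under eq_fun do rewrite -big_filter.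
  by apply: measurable_prod => i _; exact: mG.
have W0 w : 0 <= W w by apply: prodr_ge0 => i _; exact: F0.
have nuE (B : set T) : measurable B -> (\int[P]_(w in Y i0 @^-1` B) (W w)%:E =
    mscale c law B)%E.
  move=> mB; pose F' i := if i == i0 then \1_B else F i.
  have mYB : measurable (Y i0 @^-1` B).
    by rewrite -[X in measurable X]setTI; exact: mY.
  have indB : (\int[P]_w (F' i0 (Y i0 w))%:E = P (Y i0 @^-1` B))%E.
    rewrite /F' eqxx; rewrite -[in RHS](setIT (_ @^-1` _)) -integral_indic//.
  transitivity (\int[P]_w (\prod_i F' i (Y i w))%:E)%E.
    rewrite integral_mkcond; apply: eq_integral => w _; rewrite patchE.
    rewrite (bigD1 i0)//= [in F' i0]/F' eqxx indicE.
    rewrite (eq_bigr (fun i => G i w)); last by move=> i /negbTE ne; rewrite /F' ne.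
    case: ifPn => [|]; first by rewrite inE /= => h; rewrite mem_set// mul1r.
    by rewrite notin_setE /= => h; rewrite memNset// mul0r.
  rewrite IH.
  - rewrite (bigD1 i0)//= indB muleC; congr (_ * _)%E.
    rewrite /= fineK//; apply: eq_bigr => i /negbTE ne.
    by rewrite /F' ne.
  - by move=> i; rewrite /F'; case: ifP => // _; exact: measurable_indic.
  - by move=> i x; rewrite /F'; case: ifP.
  - move=> i; have [->|ne] := eqVneq i i0; last by rewrite /F' (negbTE ne).
    by rewrite indB (le_lt_trans (probability_le1 _ _))// ltry.
  - move=> i is_; rewrite /F'; case: ifPn => [_|ne]; first by exists B.
    by apply: FB; rewrite in_cons negb_or ne.
have weight := ge0_integral_weight (mY i0) (nu := mscale c law)
  mW W0 nuE (f := EFin \o F i0).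
transitivity (\int[P]_w ((F i0 (Y i0 w))%:E * (W w)%:E))%E.
  by apply: eq_integral => w _; rewrite (bigD1 i0)//= -EFinM.
rewrite weight; last 2 first.
- exact/measurable_EFinP.
- by move=> y; rewrite lee_fin.
rewrite ge0_integral_mscale//=; last 2 first.
- exact/measurable_EFinP.
- by move=> y _; rewrite lee_fin.
rewrite ge0_integral_pushforward//=; last 2 first.
- exact/measurable_EFinP.
- by move=> y _; rewrite lee_fin.
by rewrite [RHS](bigD1 i0)//= fineK// muleC.
Qed.

Lemma expect_prod (F : I -> T -> R) :
  (forall i, measurable_fun setT (F i)) ->
  (forall i x, 0 <= F i x) ->
  (forall i, \int[P]_w (F i (Y i w))%:E < +oo)%E ->
  (\int[P]_w (\prod_i F i (Y i w))%:E = \prod_i \int[P]_w (F i (Y i w))%:E)%E.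
Proof.
move=> mF F0 Foo; apply: (expect_prod_from (s := enum I)) => // i.
by rewrite mem_enum.
Qed.

End independent_product.

(** * Chernoff bounds *)

Section chernoff.
Context d (Om : measurableType d) (R : realType) (P : probability Om R).

(** Markov's inequality for exp (s X) + exp (- s X), which is at least exp (s
    a) where |X| >= a. *)
Lemma two_sided_chernoff (X : Om -> R) (s a b : R) : 0 <= s ->
  measurable_fun setT X ->
  (\int[P]_w (expR (s * X w))%:E <= b%:E)%E ->
  (\int[P]_w (expR (- s * X w))%:E <= b%:E)%E ->
  (P [set w | (a <= `|X w|)%R] <= (2 * b * expR (- (s * a)))%:E)%E.
Proof.
move=> s0 mX bp bm.
have mE u : measurable_fun setT (fun w => expR (u * X w)).
  by apply: measurableT_comp => //; exact: measurable_funM.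
have mA : measurable [set w | (a <= `|X w|)%R].
  by apply: measurable_le_set => //; exact: measurableT_comp.
rewrite -[X in P X]setIT -integral_indic//.
apply: (@le_trans _ _ (\int[P]_w ((expR (- (s * a)))%:E *
   ((expR (s * X w))%:E + (expR (- s * X w))%:E)))%E).
  apply: ge0_le_integral => //=.
  - by apply/measurable_EFinP; exact: measurable_indic.
  - apply: emeasurable_funM => //; apply: emeasurable_funD; apply/measurable_EFinP; exact: mE.
  - move=> w _; rewrite -EFinD -EFinM lee_fin indicE.
    have [|_] := boolP (w \in _); last by rewrite mulr_ge0 ?addr_ge0 ?expR_ge0.
    rewrite inE /= => aX; rewrite mulrDr -!expRD.
    have : 1 <= expR (- (s * a) + s * X w) \/ 1 <= expR (- (s * a) + - s * X w).
      move: aX; rewrite ler_normr => /orP[aX|aX]; [left|right].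
        by apply: le_trans (expR_ge1Dx _); rewrite lerDl addrC subr_ge0 ler_wpM2l.
      apply: le_trans (expR_ge1Dx _); rewrite lerDl addrC subr_ge0.
      by rewrite mulNr -mulrN ler_wpM2l.
    have := expR_ge0 (- (s * a) + s * X w); have := expR_ge0 (- (s * a) + - s * X w).
    by move=> ? ? []; lra.
rewrite ge0_integralZl//=; last 2 first.
- apply: emeasurable_funD; apply/measurable_EFinP; exact: mE.
- by move=> w _; rewrite -EFinD lee_fin addr_ge0// expR_ge0.
rewrite ge0_integralD//=; last 2 first.
- by apply/measurable_EFinP; exact: mE.
- by apply/measurable_EFinP; exact: mE.
rewrite (_ : 2 * b * _ = expR (- (s * a)) * (b + b)); last by ring.
by rewrite EFinM lee_wpmul2l ?lee_fin ?expR_ge0// EFinD leeD.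
Qed.

Context (N : nat) (U : 'I_N -> Om -> R).
Hypothesis mU : forall i, measurable_fun setT (U i).
Hypothesis indep : mutually_independent P U.

(** The optimal exponent is s = t / (2 C); the constraint t <= 2 C s0 keeps it
    in the range where the moment generating functions are controlled. *)
Lemma chernoff_sum (m C s0 t : R) : 0 < C -> 0 < t -> t <= 2 * C * s0 ->
  (forall i s, `|s| <= s0 ->
    (\int[P]_w (expR (s * (U i w - m)))%:E <= (expR (C * s ^+ 2))%:E)%E) ->
  (P [set w | (N%:R * t <= `|\sum_i (U i w - m)|)%R] <=
   (2 * expR (- (N%:R * t ^+ 2 / (4 * C))))%:E)%E.
Proof.
move=> C0 t0 ts mgf; pose s := t / (2 * C).
have s_ge0 : 0 <= s by rewrite divr_ge0 ?mulr_ge0 ?ltW.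
have ss0 : s <= s0 by rewrite ler_pdivrMr ?mulr_gt0// mulrC.
have mgf_sum u : `|u| <= s0 ->
    (\int[P]_w (expR (u * \sum_i (U i w - m)))%:E <= (expR (C * u ^+ 2 * N%:R))%:E)%E.
  move=> us0.
  pose F (i : 'I_N) x := expR (u * (x - m)).
  have mF i : measurable_fun setT (F i).
    by apply: measurableT_comp => //; apply: measurable_funM => //; exact: measurable_funB.
  have F0 i x : 0 <= F i x by exact: expR_ge0.
  have Foo i : (\int[P]_w (F i (U i w))%:E < +oo)%E.
    by apply: le_lt_trans (mgf i u us0) _; rewrite ltry.
  under eq_integral do rewrite mulr_sumr expR_sum.
  rewrite (expect_prod mU indep mF F0 Foo).
  have -> : expR (C * u ^+ 2 * N%:R) = \prod_(i < N) expR (C * u ^+ 2).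
    by rewrite prodr_const card_ord expRM_natr.
  rewrite -prodEFin.
  apply: (proj2 (big_ind2 (fun x y => 0 <= x /\ x <= y)%E _ _ _)) => //.
  - by move=> x1 y1 x2 y2 [? ?] [? ?]; split; [exact: mule_ge0|exact: lee_pmul].
  - by move=> i _; split; [apply: integral_ge0 => w _; rewrite lee_fin|exact: mgf].
have mS : measurable_fun setT (fun w => \sum_i (U i w - m)).
  by apply: measurable_sum => i; exact: measurable_funB.
have bp := mgf_sum s; have bm := mgf_sum (- s).
rewrite sqrrN normrN ger0_norm// in bp bm.
have := @two_sided_chernoff _ s (N%:R * t) (expR (C * s ^+ 2 * N%:R)) s_ge0 mS (bp ss0) (bm ss0).
move=> /le_trans; apply; rewrite lee_fin -mulrA -expRD ler_wpM2l// ler_expR.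
rewrite (_ : C * s ^+ 2 * N%:R - s * (N%:R * t) = - (N%:R * t ^+ 2 / (4 * C)))//.
by rewrite /s; field; rewrite gt_eqF.
Qed.

End chernoff.

Section normal_tail.
Context (R : realType).

Lemma normal_tail (t : R) : 0 < t ->
  (normal_prob 0 1 [set x : R | t <= `|x|]%R <= (2 * expR (- (t ^+ 2 / 2)))%:E)%E.
Proof.
move=> t0.
have mgf u : u ^+ 2 = t ^+ 2 ->
    (\int[normal_prob 0 1]_x (expR (u * x))%:E <= (expR (t ^+ 2 / 2))%:E)%E.
  have mE : measurable_fun setT (fun x : R => expR (u * x)).
    by apply: measurableT_comp => //; exact: measurable_funM.
  move=> ut; rewrite ge0_integral_normal_prob//; last exact/measurable_EFinP.
  under eq_integral do rewrite -EFinM.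
  by rewrite normal_mgf ?oner_neq0// expr1n mul1r ut.
have mid : measurable_fun [set: measurableTypeR R] (@id R) by exact: measurable_id.
have := two_sided_chernoff t (ltW t0) mid (mgf t erefl) (mgf (- t) (sqrrN t)).
move=> /le_trans; apply; rewrite lee_fin -mulrA -expRD ler_wpM2l// ler_expR.
by rewrite -expr2; lra.
Qed.

End normal_tail.

Section centered_mgf.
Context d (Om : measurableType d) (R : realType) (P : probability Om R).

Lemma expR_le_quadratic (x : R) : expR x <= 1 + x + x ^+ 2 * expR `|x|.
Proof.
have h1 : expR x - 1 <= x * expR x.
  have := expR_ge1Dx (- x); rewrite expRN => h.
  have := ler_wpM2r (expR_ge0 x) h; rewrite mulVf ?expR_eq0// mulrDl mul1r mulNr; lra.
have [x0|x0] := leP 0 x.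
  have := ler_wpM2l x0 h1; rewrite ger0_norm// expr2 -mulrA; lra.
have h2 : 1 + x <= expR x := expR_ge1Dx x.
have h3 : 1 <= expR `|x| by apply: le_trans (expR_ge1Dx _); rewrite lerDl.
have h4 : x * expR x <= x * (1 + x) by rewrite ler_nM2l.
have h5 : x ^+ 2 <= x ^+ 2 * expR `|x| by rewrite ler_peMr ?sqr_ge0.
by move: h5; rewrite expr2; lra.
Qed.

Lemma sqr_le_expR (x : R) : 0 <= x -> x ^+ 2 <= 2 * expR x.
Proof.
by move=> x0; have := @expR_ge1Dxn R x 1 x0; rewrite (_ : 2`!%:R = 2)//; lra.
Qed.

Lemma exp_moment_abs_le (U : Om -> R) (tau : R) : 0 < tau ->
  measurable_fun setT U ->
  (\int[P]_w (expR (tau * `|U w|))%:E <= 2%:E)%E ->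
  (\int[P]_w `|(U w)%:E| <= (2 / tau)%:E)%E.
Proof.
move=> tau0 mU bnd.
have mE : measurable_fun setT (fun w => expR (tau * `|U w|)).
  by apply: measurableT_comp => //; apply: measurable_funM => //; exact: measurableT_comp.
have tauV0 : (0 <= tau^-1%:E)%E by rewrite lee_fin invr_ge0 ltW.
apply: (@le_trans _ _ (\int[P]_w (tau^-1%:E * (expR (tau * `|U w|))%:E))%E).
  apply: ge0_le_integral => //=.
  - by apply/measurable_EFinP; exact: measurableT_comp.
  - by apply: emeasurable_funM => //; exact/measurable_EFinP.
  - move=> w _; rewrite -EFinM lee_fin mulrC ler_pdivlMr// mulrC.
    by apply: le_trans (expR_ge1Dx _); rewrite lerDr.
rewrite ge0_integralZl//=; last exact/measurable_EFinP.
by rewrite (mulrC 2) EFinM; apply: lee_wpmul2l.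
Qed.

Lemma exp_moment_integrable (U : Om -> R) (tau : R) : 0 < tau ->
  measurable_fun setT U ->
  (\int[P]_w (expR (tau * `|U w|))%:E <= 2%:E)%E ->
  P.-integrable setT (EFin \o U).
Proof.
move=> tau0 mU bnd; apply/integrableP; split; first exact/measurable_EFinP.
exact: le_lt_trans (exp_moment_abs_le tau0 mU bnd) (ltry _).
Qed.

Lemma exp_moment_mean_le (U : Om -> R) (tau m : R) : 0 < tau ->
  measurable_fun setT U ->
  (\int[P]_w (expR (tau * `|U w|))%:E <= 2%:E)%E ->
  (\int[P]_w (U w)%:E = m%:E)%E -> `|m| <= 2 / tau.
Proof.
move=> tau0 mU bnd meanU.
rewrite -lee_fin -[(`|m|)%:E]/(`|m%:E|)%E -meanU.
apply: le_trans (exp_moment_abs_le tau0 mU bnd).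
by apply: le_abse_integral => //; exact/measurable_EFinP.
Qed.

(** In the quadratic bound on exp (s U) the linear term integrates to s m. As
    |s| <= tau / 2, half of the exponential moment absorbs the factor exp |s
    U| and the other half absorbs U^2. *)
Lemma mgf_centered (U : Om -> R) (tau m s : R) : 0 < tau ->
  measurable_fun setT U ->
  (\int[P]_w (expR (tau * `|U w|))%:E <= 2%:E)%E ->
  (\int[P]_w (U w)%:E = m%:E)%E ->
  `|s| <= tau / 2 ->
  (\int[P]_w (expR (s * (U w - m)))%:E <= (expR (16 / tau ^+ 2 * s ^+ 2))%:E)%E.
Proof.
move=> tau0 mU bnd meanU stau.
have iU := exp_moment_integrable tau0 mU bnd.
have mE : measurable_fun setT (fun w => expR (tau * `|U w|)).
  by apply: measurableT_comp => //; apply: measurable_funM => //; exact: measurableT_comp.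
have iE : P.-integrable setT (fun w => (expR (tau * `|U w|))%:E).
  apply/integrableP; split; first exact/measurable_EFinP.
  under eq_integral do rewrite gee0_abs ?lee_fin ?expR_ge0//.
  by rewrite (le_lt_trans bnd)// ltry.
have tn0 : tau != 0 by rewrite gt_eqF.
pose k := 8 / tau ^+ 2 * s ^+ 2.
have k0 : 0 <= k by rewrite mulr_ge0 ?sqr_ge0// divr_ge0 ?sqr_ge0.
have pw w : expR (s * U w) <= 1 + s * U w + k * expR (tau * `|U w|).
  apply: (le_trans (expR_le_quadratic _)); rewrite lerD2l normrM exprMn.
  pose x := tau * `|U w| / 2.
  have x0 : 0 <= x by rewrite !mulr_ge0// ltW.
  have Ux : U w ^+ 2 = 4 / tau ^+ 2 * x ^+ 2.
    rewrite -[LHS]real_normK ?num_real//.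
    by rewrite /x; field.
  have h1 : expR (`|s| * `|U w|) <= expR x.
    by rewrite ler_expR /x mulrAC ler_wpM2r.
  have h2 : x ^+ 2 * expR (`|s| * `|U w|) <= 2 * expR (tau * `|U w|).
    apply: (@le_trans _ _ (2 * expR x * expR x)).
      by rewrite ler_pM ?sqr_ge0 ?expR_ge0 ?sqr_le_expR.
    by rewrite -mulrA -expRD /x -splitr.
  rewrite Ux /k.
  have -> : s ^+ 2 * (4 / tau ^+ 2 * x ^+ 2) * expR (`|s| * `|U w|) =
    s ^+ 2 * (4 / tau ^+ 2) * (x ^+ 2 * expR (`|s| * `|U w|)) by ring.
  have -> : 8 / tau ^+ 2 * s ^+ 2 * expR (tau * `|U w|) =
    s ^+ 2 * (4 / tau ^+ 2) * (2 * expR (tau * `|U w|)) by field.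
  by rewrite ler_wpM2l// mulr_ge0 ?sqr_ge0// divr_ge0 ?sqr_ge0.
have bound : (\int[P]_w (expR (s * U w))%:E <= (1 + s * m + 2 * k)%:E)%E.
  have i1 : P.-integrable setT (fun w => (1 + s * U w)%:E).
    under eq_fun do rewrite EFinD EFinM.
    apply: integrableD => //; first exact: finite_measure_integrable_cst.
    exact: integrableZl.
  apply: (@le_trans _ _ (\int[P]_w ((1 + s * U w)%:E + k%:E * (expR (tau * `|U w|))%:E))%E).
    apply: ge0_le_integral => //=.
    - by apply/measurable_EFinP; apply: measurableT_comp => //; exact: measurable_funM.
    - have /integrableP[mi _] := i1; apply: emeasurable_funD => //.
      by apply: emeasurable_funM => //; exact/measurable_EFinP.
    - by move=> w _; rewrite -EFinM -EFinD lee_fin.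
  rewrite integralD//=; last exact: integrableZl.
  have -> : (\int[P]_w (1 + s * U w)%:E = (1 + s * m)%:E)%E.
    under eq_integral do rewrite EFinD EFinM.
    rewrite integralD//=; [|exact: finite_measure_integrable_cst|exact: integrableZl].
    by rewrite integral_cst//= probability_setT mule1 integralZl// meanU.
  rewrite [leRHS]EFinD; apply: leeD => //.
  by rewrite integralZl//= (mulrC 2) [leRHS]EFinM lee_wpmul2l ?lee_fin.
have -> : (\int[P]_w (expR (s * (U w - m)))%:E =
    (expR (- (s * m)))%:E * \int[P]_w (expR (s * U w))%:E)%E.
  rewrite -ge0_integralZl//=.
  - by apply: eq_integral => w _; rewrite -EFinM -expRD mulrBr addrC.
  - by apply/measurable_EFinP; apply: measurableT_comp => //; exact: measurable_funM.
apply: (@le_trans _ _ ((expR (- (s * m)))%:E * (expR (s * m + 2 * k))%:E)%E).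
  rewrite lee_wpmul2l ?lee_fin ?expR_ge0// (le_trans bound)// lee_fin -addrA.
  exact: expR_ge1Dx.
rewrite -EFinM -expRD lee_fin ler_expR addKr /k.
by rewrite [leLHS](_ : _ = 16 / tau ^+ 2 * s ^+ 2)//; field.
Qed.

End centered_mgf.

(** * Measurability of matrix operations *)

Section matrix_measurability.
Context d (T : measurableType d) (m n : nat).

Lemma measurable_coord i j :
  measurable_fun [set: 'M[T]_(m, n)] (fun A : 'M[T]_(m, n) => A i j).
Proof.
move=> _ B mB; rewrite setTI; apply: sub_sigma_algebra.
by exists (i, j) => //; exists B => //; rewrite setTI.
Qed.

Lemma measurable_matrixP d' (Om : measurableType d') (f : Om -> 'M[T]_(m, n)) :
  measurable_fun setT f <-> (forall i j, measurable_fun setT (fun w => f w i j)).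
Proof.
split=> [mf i j|mf].
  by apply: (measurableT_comp (measurable_coord i j)).
apply: (measurability
  (\bigcup_(ij : 'I_m * 'I_n) preimage_set_system setT
    (fun A : 'M[T]_(m, n) => A ij.1 ij.2) measurable)) => //.
move=> _ [_ [[i j] _ [B mB <-]] <-].
by have := mf i j measurableT B mB; rewrite !setTI.
Qed.

End matrix_measurability.

Section real_functions.
Context d (T : measurableType d) (R : realType).
Implicit Types f g : T -> R.

(** The inverse equals x exp (- ln (x^2)), also at x = 0. *)
Lemma measurable_funV f : measurable_fun setT f -> measurable_fun setT (fun w => (f w)^-1).
Proof.
move=> mf.
rewrite (_ : (fun w => _) = fun w => f w * expR (- ln (f w ^+ 2))); last first.
  apply/funext => w; have [->|fw] := eqVneq (f w) 0; first by rewrite invr0 mul0r.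
  rewrite expRN lnK ?posrE ?exprn_even_gt0// expr2 invfM mulrA divff ?mul1r//.
apply: measurable_funM => //; apply: measurableT_comp => //.
apply: measurableT_comp => //; apply: measurableT_comp; first exact: measurable_ln.
exact: measurable_funX.
Qed.

Lemma measurable_fun_sqrt f : measurable_fun setT f ->
  measurable_fun setT (fun w => Num.sqrt (f w)).
Proof.
move=> mf; apply: measurableT_comp => //; apply: continuous_measurable_fun.
exact: sqrt_continuous.
Qed.

Lemma measurable_fun_mulmx m n p (A : T -> 'M[R]_(m, n)) (B : T -> 'M[R]_(n, p)) :
  measurable_fun setT A -> measurable_fun setT B ->
  measurable_fun setT (fun w => A w *m B w).
Proof.
move=> /measurable_matrixP mA /measurable_matrixP mB; apply/measurable_matrixP => i j.
under eq_fun do rewrite mxE.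
by apply: measurable_sum => k; apply: measurable_funM.
Qed.

Lemma measurable_fun_trmx m n (A : T -> 'M[R]_(m, n)) :
  measurable_fun setT A -> measurable_fun setT (fun w => (A w)^T).
Proof.
move=> /measurable_matrixP mA; apply/measurable_matrixP => i j.
by under eq_fun do rewrite mxE; exact: mA.
Qed.

Lemma measurable_fun_addmx m n (A B : T -> 'M[R]_(m, n)) :
  measurable_fun setT A -> measurable_fun setT B ->
  measurable_fun setT (fun w => A w + B w).
Proof.
move=> /measurable_matrixP mA /measurable_matrixP mB; apply/measurable_matrixP => i j.
by under eq_fun do rewrite mxE; apply: measurable_funD.
Qed.

Lemma measurable_fun_oppmx m n (A : T -> 'M[R]_(m, n)) :
  measurable_fun setT A -> measurable_fun setT (fun w => - A w).
Proof.
move=> /measurable_matrixP mA; apply/measurable_matrixP => i j.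
by under eq_fun do rewrite mxE; apply: measurableT_comp.
Qed.

Lemma measurable_fun_scalemx m n a (A : T -> 'M[R]_(m, n)) :
  measurable_fun setT A -> measurable_fun setT (fun w => a *: A w).
Proof.
move=> /measurable_matrixP mA; apply/measurable_matrixP => i j.
by under eq_fun do rewrite mxE; apply: measurable_funM.
Qed.

Lemma measurable_fun_dot n (u v : T -> 'cV[R]_n) :
  measurable_fun setT u -> measurable_fun setT v ->
  measurable_fun setT (fun w => dot (u w) (v w)).
Proof.
move=> /measurable_matrixP mu /measurable_matrixP mv.
by apply: measurable_sum => k; apply: measurable_funM.
Qed.

Lemma measurable_fun_sqr_l2norm n (u : T -> 'cV[R]_n) :
  measurable_fun setT u -> measurable_fun setT (fun w => sqr_l2norm (u w)).
Proof. by move=> mu; under eq_fun do rewrite -dotvv; exact: measurable_fun_dot. Qed.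

Lemma measurable_fun_row m n (A : T -> 'M[R]_(m, n)) i :
  measurable_fun setT A -> measurable_fun setT (fun w => row i (A w)).
Proof.
move=> /measurable_matrixP mA; apply/measurable_matrixP => i' j.
by under eq_fun do rewrite mxE; exact: mA.
Qed.

Lemma measurable_fun_sample_cov N n (X : T -> 'M[R]_(N, n)) :
  measurable_fun setT X -> measurable_fun setT (fun w => sample_cov (X w)).
Proof.
move=> mX; apply: measurable_fun_scalemx; apply: measurable_fun_mulmx => //.
exact: measurable_fun_trmx.
Qed.

End real_functions.

(** * Linear combinations of Gaussian noise *)

Section gaussian_sum.
Context d (Om : measurableType d) (R : realType) (P : probability Om R).
Context (N : nat) (Y : 'I_N -> Om -> R) (sigma : R).
Hypothesis mY : forall i, measurable_fun setT (Y i).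
Hypothesis indep : mutually_independent P Y.
Hypothesis sigma0 : sigma != 0.
Hypothesis lawY : forall i (B : set R), measurable B ->
  P (Y i @^-1` B) = normal_prob 0 sigma B.

(** Standard deviations obtained by scaling and by convolution agree up to
    sign only. *)
Lemma normal_prob_sqr (s t : R) (A : set R) : s ^+ 2 = t ^+ 2 ->
  normal_prob 0 s A = normal_prob 0 t A.
Proof.
move=> st; rewrite /normal_prob; apply: eq_integral => x _.
have s0 : (s == 0) = (t == 0) by rewrite -sqrf_eq0 st sqrf_eq0.
by rewrite /normal_pdf s0; case: ifP => // _; rewrite /normal_peak /normal_fun st.
Qed.

Context (a : 'I_N -> R) (i0 : 'I_N).
Hypothesis a0 : a i0 != 0.

Let sd (s : seq 'I_N) := sigma * Num.sqrt (\sum_(i <- i0 :: s) a i ^+ 2).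

Let sd2 s : sd s ^+ 2 = sigma ^+ 2 * \sum_(i <- i0 :: s) a i ^+ 2.
Proof. by rewrite exprMn sqr_sqrtr// sumr_ge0// => i _; exact: sqr_ge0. Qed.

Let sd_neq0 s : sd s != 0.
Proof.
rewrite -sqrf_eq0 sd2 mulf_neq0 ?sqrf_eq0// big_cons gt_eqF// ltr_wpDr//.
  by rewrite sumr_ge0// => i _; exact: sqr_ge0.
by rewrite lt_def sqrf_eq0 a0 sqr_ge0.
Qed.

Let outside (s : seq 'I_N) (B : 'I_N -> set R) :=
  [set w | forall i, i \notin i0 :: s -> B i (Y i w)].

Let measurable_outside s B : (forall i, measurable (B i)) -> measurable (outside s B).
Proof.
move=> mB; rewrite (_ : outside s B = \bigcap_(i in [set i | i \notin i0 :: s]) (Y i @^-1` B i)) //.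
apply: fin_bigcap_measurable => [|i _]; first exact: finite_finset.
by rewrite -[X in measurable X]setTI; exact: mY.
Qed.

Let mS s : measurable_fun setT (fun w => \sum_(i <- i0 :: s) a i * Y i w).
Proof. by apply: measurable_sum => i; exact: measurable_funM. Qed.

(** The law of a partial sum is carried along together with arbitrary events
    on the coordinates outside it: adding the next coordinate requires that it
    be independent of the partial sum, given the remaining events. Starting
    from an index i0 with a nonzero coefficient keeps every partial sum
    nondegenerate. *)
Let partial_law s : uniq (i0 :: s) ->
  forall (A : set R) (B : 'I_N -> set R), measurable A -> (forall i, measurable (B i)) ->
  (P ([set w | A (\sum_(i <- i0 :: s) a i * Y i w)%R] `&` outside s B) =
   normal_prob 0 (sd s) A * \prod_(i | i \notin i0 :: s) P (Y i @^-1` B i))%E.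
Proof.
elim: s => [|i1 s IH] us A B mA mB.
  pose B' i := if i == i0 then [set x | A (a i0 * x)] else B i.
  have mB0 : measurable [set x : R | A (a i0 * x)].
    have : measurable_fun setT (fun x : R => a i0 * x) by exact: measurable_funM.
    by move=> /(_ measurableT A mA); rewrite setTI.
  transitivity (P (\bigcap_i (Y i @^-1` B' i))).
    congr (P _); apply/seteqP; split => [w [/= Aw Bw] i _|w Bw].
      rewrite /= /B'; have [->|ne] := eqVneq i i0.
        by move: Aw; rewrite big_seq1.
      by apply: Bw; rewrite inE.
    split=> [|i] /=.
      by have := Bw i0 Logic.I; rewrite /= /B' eqxx big_seq1.
    rewrite inE => ne; have := Bw i Logic.I.
    by rewrite /= /B' (negbTE ne).
  transitivity (\prod_i P (Y i @^-1` B' i))%E.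
    by apply: indep => i; rewrite /B'; case: ifP.
  rewrite (bigD1 i0)//=; congr (_ * _)%E.
    rewrite /B' eqxx lawY// (normal_prob_scale sigma0 a0 mA).
    by apply: normal_prob_sqr; rewrite sd2 big_seq1 exprMn.
  apply: eq_big => [i|i ne]; first by rewrite inE.
  by rewrite /B' (negbTE ne).
have us' : uniq (i0 :: s).
  by move: us; rewrite /= inE negb_or => /andP[/andP[_ ->] /andP[_ ->]].
have i1s : i1 \notin i0 :: s.
  move: us; rewrite /= !inE !negb_or => /andP[/andP[ne _] /andP[-> _]].
  by rewrite eq_sym ne.
have sumE w : \sum_(i <- [:: i0, i1 & s]) a i * Y i w =
    \sum_(i <- i0 :: s) a i * Y i w + a i1 * Y i1 w.
  by rewrite !big_cons; ring.
have notinE i : (i \notin [:: i0, i1 & s]) = (i \notin i0 :: s) && (i != i1).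
  by rewrite !inE !negb_or; case: (i == i0); case: (i == i1); rewrite ?andbT ?andbF.
pose c := (\prod_(i | i \notin [:: i0, i1 & s]) P (Y i @^-1` B i))%E.
have IHc (A' B' : set R) : measurable A' -> measurable B' ->
    (P ([set w | A' (\sum_(i <- i0 :: s) a i * Y i w)%R] `&` (Y i1 @^-1` B') `&`
       outside (i1 :: s) B) = normal_prob 0 (sd s) A' * normal_prob 0 sigma B' * c)%E.
  move=> mA' mB'; pose B'' i := if i == i1 then B' else B i.
  have -> : [set w | A' (\sum_(i <- i0 :: s) a i * Y i w)] `&` (Y i1 @^-1` B') `&`
      outside (i1 :: s) B =
      [set w | A' (\sum_(i <- i0 :: s) a i * Y i w)] `&` outside s B''.
    rewrite -setIA; congr (_ `&` _); apply/seteqP; split => [w [/= Bi1 Bw] i is_|w Bw].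
      rewrite /B''; have [->//|ne] := eqVneq i i1.
      by apply: Bw; rewrite notinE is_.
    split=> [|i] /=; first by have := Bw i1 i1s; rewrite /B'' eqxx.
    by rewrite notinE => /andP[is_ ne]; have := Bw i is_; rewrite /B'' (negbTE ne).
  rewrite IH//; last by move=> i; rewrite /B''; case: ifP.
  rewrite -muleA; congr (_ * _)%E; rewrite (bigD1 i1)//=; congr (_ * _)%E.
    by rewrite /B'' eqxx lawY.
  apply: eq_big => [i|i /andP[_ ne]]; first by rewrite notinE.
  by rewrite /B'' (negbTE ne).
set D := outside (i1 :: s) B.
have mD : measurable D by exact: measurable_outside.
have c0 : (0 <= c)%E by apply: prode_ge0.
have cfin : c \is a fin_num.
  by apply: prode_fin_num => i _; rewrite fin_num_measure// -[X in measurable X]setTI; exact: mY.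
have PD : P D = c.
  have := IHc setT setT measurableT measurableT.
  rewrite preimage_setT !setTI => ->.
  by rewrite !probability_setT !mul1e.
pose S w := \sum_(i <- i0 :: s) a i * Y i w.
pose C := [set yx : measurableTypeR R * measurableTypeR R | A (yx.2 + a i1 * yx.1)].
have -> : [set w | A (\sum_(i <- [:: i0, i1 & s]) a i * Y i w)] =
    [set w | C (Y i1 w, S w)].
  by apply/seteqP; split => w /=; rewrite sumE.
have mC : measurable C.
  have : measurable_fun [set: measurableTypeR R * measurableTypeR R]
      (fun yx : measurableTypeR R * measurableTypeR R =>
        (yx.2 + a i1 * yx.1 : measurableTypeR R)).
    by apply: measurable_funD => //; apply: measurable_funM.
  by move=> /(_ measurableT A mA); rewrite setTI.
have mYS : measurable_fun setT (fun w => (Y i1 w, S w) : measurableTypeR R * measurableTypeR R).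
  by apply: measurable_fun_pair; [exact: mY|exact: mS].
have mCS : measurable [set w | C (Y i1 w, S w)].
  by have := mYS measurableT C mC; rewrite setTI.
(* the joint law below is conditioned on D, which must have positive
   probability *)
have [c00|cn0] := eqVneq c 0%E.
  rewrite -/c c00 mule0; apply/eqP; rewrite eq_le measure_ge0 andbT.
  by rewrite -[leRHS]c00 -PD le_measure// ?inE//; exact: measurableI.
have cp : 0 < fine c by rewrite fine_gt0// lt_def cn0 c0 -ge0_fin_numE.
have cV0 : 0 <= (fine c)^-1 by rewrite invr_ge0 ltW.
pose k : {nonneg R} := NngNum cV0.
pose joint : {measure set (measurableTypeR R * measurableTypeR R) -> \bar R} :=
  measure_function_pushforward__canonical__measure_function_Measure (mrestr P mD) mYS.
have jointE : forall A' B', measurable A' -> measurable B' ->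
    mscale k joint (A' `*` B') = (normal_prob 0 sigma A' * normal_prob 0 (sd s) B')%E.
  move=> A' B' mA' mB'; rewrite /mscale /= /pushforward /mrestr.
  have -> : (fun w => (Y i1 w, S w)) @^-1` (A' `*` B') `&` D =
    [set w | B' (S w)] `&` Y i1 @^-1` A' `&` D.
    by congr (_ `&` _); apply/seteqP; split => w /= [].
  rewrite /S IHc// muleC -muleA -[X in (_ * (X * _))%E](fineK cfin) -EFinM.
  by rewrite divff ?mule1 1?muleC// gt_eqF.
have := product_measure_unique jointE mC.
rewrite /mscale /= /pushforward /mrestr.
set L := P _; rewrite /product_measure1.
have -> : (\int[normal_prob 0 sigma]_x (normal_prob 0 (sd s) \o xsection C) x =
    normal_prob 0 (sd (i1 :: s)) A)%E.
  transitivity (\int[normal_prob 0 sigma]_y normal_prob 0 (sd s) [set x | A (x + a i1 * y)%R])%E.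
    apply: eq_integral => y _ /=; congr (normal_prob 0 (sd s) _).
    by apply/seteqP; split => x; rewrite /xsection /= inE.
  rewrite normal_prob_convolution//; apply: normal_prob_sqr.
  rewrite sqr_sqrtr ?addr_ge0 ?sqr_ge0// !sd2 exprMn !big_cons; ring.
move=> ->; rewrite -/c -[X in (_ * X)%E](fineK cfin) muleC muleA -EFinM.
by rewrite divff ?mul1e// gt_eqF.
Qed.

Lemma gaussian_sum (A : set R) : measurable A ->
  P [set w | A (\sum_i a i * Y i w)] =
  normal_prob 0 (sigma * Num.sqrt (\sum_i a i ^+ 2)) A.
Proof.
move=> mA; pose s := rem i0 (enum 'I_N).
have perm_s : perm_eq (enum 'I_N) (i0 :: s) by apply: perm_to_rem; rewrite mem_enum.
have us : uniq (i0 :: s) by rewrite -(perm_uniq perm_s) enum_uniq.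
have all_s i : i \in i0 :: s by rewrite -(perm_mem perm_s) mem_enum.
have := partial_law us mA (B := fun=> setT) (fun=> measurableT).
have sumE (F : 'I_N -> R) : \sum_(i <- i0 :: s) F i = \sum_i F i.
  by rewrite -(perm_big _ perm_s)/= big_enum.
rewrite /sd sumE [X in (_ * X)%E]big_pred0 => [|i]; last by rewrite all_s.
rewrite mule1 => <-; congr (P _); apply/seteqP; split => [w Aw|w [/= Aw _]].
  by split => //=; rewrite sumE.
by rewrite /= -sumE.
Qed.

End gaussian_sum.

Section conditionally_gaussian.
Context d (Om : measurableType d) (R : realType) (P : probability Om R).
Context (N : nat) (eps : Om -> 'cV[R]_N) (sigma : R).
Hypothesis meps : measurable_fun setT eps.
Hypothesis sigma_gt0 : 0 < sigma.
Hypothesis noise : gaussian_noise P sigma eps.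

Let sigma0 : sigma != 0. Proof. by rewrite gt_eqF. Qed.

Let measurable_preimage_scale a (B : set R) : measurable B ->
  measurable [set x : R | B (x / a)].
Proof.
move=> mB; have : measurable_fun setT (fun x : R => x / a) by exact: measurable_funM.
by move=> /(_ measurableT B mB); rewrite setTI.
Qed.

Lemma gaussian_dot (v : 'cV[R]_N) (B : set R) : 0 < sqr_l2norm v -> measurable B ->
  P [set w | B (dot v (eps w) / (sigma * Num.sqrt (sqr_l2norm v)))] =
  normal_prob 0 1 B.
Proof.
move=> v0 mB; have [indep law] := noise.
have [i0 vi0] : exists i, v i 0 != 0.
  apply/existsP; rewrite -[X in is_true X]negbK negb_exists.
  apply/negP => /forallP vz; move: v0; rewrite /sqr_l2norm big1 ?ltxx// => i _.
  by have := vz i; rewrite negbK => /eqP ->; rewrite expr0n.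
have meps_i i : measurable_fun setT (fun w => eps w i 0).
  by apply: (iffLR (measurable_matrixP eps) meps i 0).
set r := sigma * _; have r0 : r != 0 by rewrite mulf_neq0// gt_eqF// sqrtr_gt0.
have := gaussian_sum meps_i indep sigma0 law (a := fun i => v i 0) vi0
  (measurable_preimage_scale r mB).
rewrite -/(sqr_l2norm v) => h; transitivity (normal_prob 0 r [set x | B (x / r)]).
  exact: h.
have -> : [set x | B (x / r)] = [set x | B (r^-1 * x)].
  by apply/seteqP; split => x /=; rewrite mulrC.
by rewrite normal_prob_scale// ?invr_eq0// divff.
Qed.

Context d1 (T1 : measurableType d1) (X : Om -> T1).
Hypothesis mX : measurable_fun setT X.
Hypothesis X_eps : independent P X eps.

(** Given X = x the ratio is standard normal whatever x is; integrating over
    the law of X, which forms a product with that of eps, factors the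
    probability. *)
Lemma conditional_standard_normal (g : T1 -> 'cV[R]_N) (A : set T1) (B : set R) :
  measurable_fun setT g -> measurable A -> measurable B ->
  (forall x, A x -> 0 < sqr_l2norm (g x)) ->
  (P [set w | A (X w) /\
     B (dot (g (X w)) (eps w) / (sigma * Num.sqrt (sqr_l2norm (g (X w)))))%R] =
   P (X @^-1` A) * normal_prob 0 1 B)%E.
Proof.
move=> mg mA mB g0.
pose h (xe : T1 * 'cV[R]_N) :=
  dot (g xe.1) xe.2 / (sigma * Num.sqrt (sqr_l2norm (g xe.1))).
have mh : measurable_fun setT h.
  apply: measurable_funM.
    by apply: measurable_fun_dot => //; exact: measurableT_comp.
  apply: measurable_funV; apply: measurable_funM => //; apply: measurable_fun_sqrt.
  by apply: measurable_fun_sqr_l2norm; exact: measurableT_comp.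
pose C := [set xe | A xe.1 /\ B (h xe)].
have mC : measurable C.
  apply: measurableI; last by have := mh measurableT B mB; rewrite setTI.
  by have := @measurable_fst _ _ T1 'cV[R]_N measurableT A mA; rewrite setTI.
pose lawX : {measure set T1 -> \bar R} :=
  measure_function_pushforward__canonical__measure_function_Measure P mX.
have mpair : measurable_fun setT (fun w => (X w, eps w)).
  exact: measurable_fun_pair.
pose X_mfun : {mfun Om >-> T1} := HB.pack X (isMeasurableFun.Build _ _ _ _ X mX).
pose eps_mfun : {mfun Om >-> 'cV[R]_N} :=
  HB.pack eps (isMeasurableFun.Build _ _ _ _ eps meps).
pose joint : {measure set (T1 * 'cV[R]_N) -> \bar R} :=
  measure_function_pushforward__canonical__measure_function_Measure P mpair.
have jointE A' B' : measurable A' -> measurable B' ->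
    joint (A' `*` B') = (distribution P X_mfun A' * distribution P eps_mfun B')%E.
  by move=> mA' mB'; exact: X_eps.
have := product_measure_unique jointE mC.
rewrite /joint /= /pushforward => <-.
rewrite /product_measure1.
transitivity (\int[distribution P X_mfun]_x
    ((\1_A x)%:E * (normal_prob 0 1 B : \bar R)))%E.
  apply: eq_integral => x _ /=; rewrite indicE.
  have -> : xsection C x = [set e | A x /\ B (h (x, e))].
    by apply/seteqP; split => e; rewrite /xsection /= inE.
  have [xA|xA] := boolP (x \in A).
    rewrite mul1e -(gaussian_dot (g0 x _) mB); last by move: xA; rewrite inE.
    rewrite /distribution /pushforward /=; congr (P _).
    by apply/seteqP; split => w /= => [[]//|Bw]; split=> //; move: xA; rewrite inE.
  rewrite mul0e (_ : [set e | _] = set0) ?measure0//.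
  by apply/seteqP; split => // e [Ax _]; move: xA; rewrite mem_set.
rewrite ge0_integralZr//=.
- by rewrite integral_indic// setIT.
- by apply/measurable_EFinP; exact: measurable_indic.
Qed.

End conditionally_gaussian.

(** * Concentration of the sample covariance *)

Section union_bound.
Context d (Om : measurableType d) (R : realType) (P : probability Om R).

Lemma union_bound (I : finType) (A : I -> set Om) (e : R) :
  (forall i, measurable (A i)) -> (forall i, P (A i) <= e%:E)%E ->
  (P (\bigcup_i A i) <= (#|I|%:R * e)%:E)%E.
Proof.
move=> mA PA.
have -> : \bigcup_i A i = \big[setU/set0]_(i <- enum I) A i.
  rewrite -bigcup_seq; apply: eq_bigcupl; split => i //= _.
  by rewrite mem_enum.
rewrite cardE; elim: (enum I) => [|i s IH] /=.
  by rewrite big_nil measure0 mul0r.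
rewrite big_cons; apply: (le_trans (measureU2 _ _ _)) => //.
  exact: bigsetU_measurable.
rewrite -addn1 natrD mulrDl mul1r EFinD [leRHS]addeC.
by apply: leeD; [exact: PA|exact: IH].
Qed.

End union_bound.

Section design.
Context d (Om : measurableType d) (R : realType) (P : probability Om R).
Context (N n : nat) (X : Om -> 'M[R]_(N, n)) (sigma : R) (Sigma : 'M[R]_n).
Hypothesis mX : measurable_fun setT X.
Hypothesis sigma0 : 0 < sigma.
Hypothesis N0 : (0 < N)%N.
Hypothesis design : sub_gaussian_design P sigma Sigma X.

Let measurable_lin (u : 'cV[R]_n) i : measurable_fun setT (fun w => (X w *m u) i 0).
Proof.
have : measurable_fun setT (fun w => X w *m u) by exact: measurable_fun_mulmx.
by move=> /measurable_matrixP; apply.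
Qed.

(** The sub-Gaussian bound in the direction of u, rescaled by an upper bound
    kappa of the length of u. *)
Lemma design_exp_sqr (u : 'cV[R]_n) (kappa : R) i : 0 < kappa ->
  sqr_l2norm u <= kappa ^+ 2 ->
  (\int[P]_w (expR ((X w *m u) i 0 ^+ 2 / (4 * sigma ^+ 2 * kappa ^+ 2)))%:E <= 2%:E)%E.
Proof.
move=> k0 uk; have [_ _ sg _] := design.
have [u0|un0] := eqVneq u 0.
  rewrite (eq_integral (cst 1%:E)) => [|w _]; last first.
    by rewrite u0 mulmx0 mxE expr0n/= mul0r expR0.
  by rewrite integral_cst//= probability_setT mule1 lee_fin ler1n.
pose r := Num.sqrt (sqr_l2norm u).
have u2 : 0 < sqr_l2norm u.
  by rewrite lt_def sqr_l2norm_ge0 andbT; apply: contra un0 => /eqP/sqr_l2norm_eq0 ->.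
have r0 : 0 < r by rewrite sqrtr_gt0.
have r2 : r ^+ 2 = sqr_l2norm u by rewrite sqr_sqrtr ?sqr_l2norm_ge0.
pose u' := r^-1 *: u.
have u'1 : sqr_l2norm u' = 1 by rewrite sqr_l2normZ exprVn r2 mulVf// gt_eqF.
have uE w : (X w *m u) i 0 = r * (row i (X w) *m u') 0 0.
  have -> : u = r *: u' by rewrite /u' scalerA divff ?scale1r// gt_eqF.
  by rewrite -scalemxAr -row_mul [LHS]mxE [in RHS]mxE.
have mu' : measurable_fun setT (fun w => (row i (X w) *m u') 0 0).
  rewrite (_ : (fun _ => _) = fun w => (X w *m u') i 0) //.
  by apply/funext => w; rewrite -row_mul mxE.
have [_ /(_ u' u'1) sgu] := sg i.
apply: le_trans (sub_gaussian_exp_sqr sigma0 mu' sgu).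
apply: ge0_le_integral => //=.
- by apply/measurable_EFinP; apply: measurableT_comp => //; apply: measurable_funM => //; exact: measurable_funX.
- by apply/measurable_EFinP; apply: measurableT_comp => //; apply: measurable_funM => //; exact: measurable_funX.
move=> w _; rewrite lee_fin ler_expR uE exprMn r2.
have s2 : 0 < 4 * sigma ^+ 2 by rewrite mulr_gt0 ?exprn_gt0.
rewrite ler_pdivrMr ?mulr_gt0 ?exprn_gt0//.
set z := (_ *m u') 0 0.
rewrite [leRHS](_ : _ = kappa ^+ 2 * z ^+ 2); last by field; rewrite gt_eqF.
by rewrite ler_wpM2r ?sqr_ge0.
Qed.

Section bilinear.
Context (u v : 'cV[R]_n) (ku kv : R).
Hypotheses (ku0 : 0 < ku) (kv0 : 0 < kv).
Hypothesis uk : sqr_l2norm u <= ku ^+ 2.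
Hypothesis vk : sqr_l2norm v <= kv ^+ 2.
Let tau := (4 * sigma ^+ 2 * ku * kv)^-1.

Let tau0 : 0 < tau.
Proof. by rewrite invr_gt0 !mulr_gt0 ?exprn_gt0. Qed.

(** By the inequality of arithmetic and geometric means, used for the
    exponents and then for the exponentials, the exponential of a product is
    at most the half sum of exponentials of squares. *)
Lemma design_exp_product i :
  (\int[P]_w (expR (tau * `|(X w *m u) i 0 * (X w *m v) i 0|))%:E <= 2%:E)%E.
Proof.
pose p w := expR ((X w *m u) i 0 ^+ 2 / (4 * sigma ^+ 2 * ku ^+ 2)).
pose q w := expR ((X w *m v) i 0 ^+ 2 / (4 * sigma ^+ 2 * kv ^+ 2)).
have mexp (z : 'cV[R]_n) k : measurable_fun setT
    (fun w => expR ((X w *m z) i 0 ^+ 2 / k)).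
  by apply: measurableT_comp => //; apply: measurable_funM => //; exact: measurable_funX.
have mp : measurable_fun setT p by exact: mexp.
have mq : measurable_fun setT q by exact: mexp.
apply: (@le_trans _ _ (\int[P]_w ((2^-1)%:E * ((p w)%:E + (q w)%:E)))%E).
  apply: ge0_le_integral => //=.
  - apply/measurable_EFinP; apply: measurableT_comp => //; apply: measurable_funM => //.
    by apply: measurableT_comp => //; exact: measurable_funM.
  - by apply: emeasurable_funM => //; apply: emeasurable_funD; exact/measurable_EFinP.
  - move=> w _; rewrite -EFinD -EFinM lee_fin /p /q.
    set a := (X w *m u) i 0; set b := (X w *m v) i 0.
    set x := a ^+ 2 / _; set y := b ^+ 2 / _.
    pose ea := `|a| / (2 * sigma * ku); pose eb := `|b| / (2 * sigma * kv).
    have abE : tau * `|a * b| = ea * eb.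
      rewrite normrM /tau /ea /eb; field.
      by rewrite !gt_eqF.
    have xE : x = ea ^+ 2.
      rewrite /x -[a ^+ 2]real_normK ?num_real// /ea; field.
      by rewrite !gt_eqF.
    have yE : y = eb ^+ 2.
      rewrite /y -[b ^+ 2]real_normK ?num_real// /eb; field.
      by rewrite !gt_eqF.
    apply: (@le_trans _ _ (expR (ea ^+ 2 / 2) * expR (eb ^+ 2 / 2))).
      by rewrite -expRD ler_expR abE; have := sqr_ge0 (ea - eb); rewrite sqrrB; lra.
    have hx : expR x = expR (ea ^+ 2 / 2) ^+ 2 by rewrite xE [RHS]expr2 -expRD -splitr.
    have hy : expR y = expR (eb ^+ 2 / 2) ^+ 2 by rewrite yE [RHS]expr2 -expRD -splitr.
    rewrite hx hy; set s := expR _; set t := expR _.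
    by have := sqr_ge0 (s - t); rewrite sqrrB; lra.
rewrite ge0_integralZl//=; last 2 first.
- by apply: emeasurable_funD; exact/measurable_EFinP.
- by move=> w _; rewrite -EFinD lee_fin addr_ge0// expR_ge0.
rewrite ge0_integralD//=; last 4 first.
- by move=> w _; rewrite lee_fin expR_ge0.
- exact/measurable_EFinP.
- by move=> w _; rewrite lee_fin expR_ge0.
- exact/measurable_EFinP.
apply: (@le_trans _ _ ((2^-1)%:E * (2%:E + 2%:E))%E).
  rewrite lee_wpmul2l// ?lee_fin// leeD//; exact: design_exp_sqr.
by rewrite -EFinD -EFinM lee_fin; lra.
Qed.

Let mU i : measurable_fun setT (fun w => (X w *m u) i 0 * (X w *m v) i 0).
Proof. exact: measurable_funM. Qed.

Lemma design_product_integrable i :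
  P.-integrable setT (fun w => ((X w *m u) i 0 * (X w *m v) i 0)%:E).
Proof. exact: exp_moment_integrable tau0 (mU i) (design_exp_product i). Qed.

End bilinear.

Lemma design_second_moment i a b :
  (\int[P]_w (X w i a * X w i b)%:E = (Sigma a b)%:E)%E.
Proof.
have [_ _ sg cov] := design.
rewrite -(cov i a b) covariance.unlock expectation.unlock.
apply: eq_integral => w _ /=; congr EFin.
have mean0 c : fine 'E_P[fun w => X w i c] = 0.
  have [/(_ c) h _] := sg i.
  rewrite [X in expectation _ X](_ : _ = (fun w => row i (X w) 0 c)) ?h//.
  by apply/funext => w'; rewrite mxE.
move: mean0; rewrite expectation.unlock => mean0.
transitivity ((X w i a - fine (\int[P]_w0 (X w0 i a)%:E)) *
  (X w i b - fine (\int[P]_w0 (X w0 i b)%:E))); last by [].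
by rewrite !mean0 !subr0.
Qed.

Lemma design_bilinear_mean i (u v : 'cV[R]_n) :
  (\int[P]_w ((X w *m u) i 0 * (X w *m v) i 0)%:E = (dot u (Sigma *m v))%:E)%E.
Proof.
have Xdelta w a : X w i a = (X w *m (delta_mx a 0 : 'cV[R]_n)) i 0.
  by rewrite -colE mxE.
have integrable_ab a b : P.-integrable setT (fun w => (X w i a * X w i b)%:E).
  under eq_fun do rewrite !Xdelta.
  by apply: (design_product_integrable (ku := 1) (kv := 1));
    rewrite ?ltr01// sqr_l2norm_delta expr1n.
have pw w : (((X w *m u) i 0 * (X w *m v) i 0)%:E =
    \sum_a \sum_b ((u a 0 * v b 0)%:E * (X w i a * X w i b)%:E))%E.
  rewrite !mxE mulr_suml -sumEFin; apply: eq_bigr => a _.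
  rewrite mulr_sumr -sumEFin; apply: eq_bigr => b _.
  by rewrite -EFinM; congr EFin; ring.
under eq_integral do rewrite pw.
have integrable_Zab a b : P.-integrable setT
    (fun w => (u a 0 * v b 0)%:E * (X w i a * X w i b)%:E)%E.
  exact: integrableZl.
rewrite integral_sum//; last by move=> a; exact: integrable_sum.
rewrite /dot -sumEFin; apply: eq_bigr => a _.
rewrite integral_sum// mxE mulr_sumr -sumEFin; apply: eq_bigr => b _.
rewrite integralZl// design_second_moment -EFinM; congr EFin; ring.
Qed.

(** The entries of Sigma are means of products of coordinates, whose
    exponential moments are bounded. *)
Lemma covariance_entry_le a b : `|Sigma a b| <= 8 * sigma ^+ 2.
Proof.
pose i : 'I_N := Ordinal N0.
have h1 := design_exp_product ltr01 ltr01 (u := delta_mx a 0) (v := delta_mx b 0).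
rewrite !sqr_l2norm_delta expr1n in h1.
have h2 := h1 (lexx _) (lexx _) i.
have mD c : measurable_fun setT (fun w => (X w *m (delta_mx c 0 : 'cV[R]_n)) i 0).
  exact: measurable_lin.
have := design_bilinear_mean i (delta_mx a 0) (delta_mx b 0).
rewrite -entry_dot => h3.
have t0 : 0 < (4 * sigma ^+ 2 * 1 * 1)^-1 by rewrite invr_gt0 !mulr_gt0 ?exprn_gt0.
have := exp_moment_mean_le t0 (measurable_funM (mD a) (mD b)) h2 h3.
by rewrite invrK; lra.
Qed.

(** The rows contribute independent products (X u)_i (X v)_i of mean <u, Sigma
    v>, whose sum is N times the sample quadratic form. *)
Lemma sample_cov_deviation (u v : 'cV[R]_n) (ku kv t : R)
    (tau := (4 * sigma ^+ 2 * ku * kv)^-1) :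
  0 < ku -> 0 < kv -> sqr_l2norm u <= ku ^+ 2 -> sqr_l2norm v <= kv ^+ 2 ->
  0 < t -> t <= 16 / tau ->
  (P [set w | (t <= `|dot u ((sample_cov (X w) - Sigma) *m v)|)%R] <=
   (2 * expR (- (N%:R * t ^+ 2 * tau ^+ 2 / 64)))%:E)%E.
Proof.
move=> ku0 kv0 uk vk t0 tle.
have [indep _ _ _] := design.
have tau0 : 0 < tau by rewrite invr_gt0 !mulr_gt0 ?exprn_gt0.
pose U (i : 'I_N) w := (X w *m u) i 0 * (X w *m v) i 0.
have mU i : measurable_fun setT (U i) by exact: measurable_funM.
have mrow i : measurable_fun setT (fun w => row i (X w)) by exact: measurable_fun_row.
pose f (r : 'rV[R]_n) := (r *m u) 0 0 * (r *m v) 0 0.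
have mf : measurable_fun setT f.
  have mid : measurable_fun [set: 'rV[R]_n] id by exact: measurable_id.
  apply: measurable_funM.
    have : measurable_fun setT (fun r : 'rV[R]_n => r *m u) by exact: measurable_fun_mulmx.
    by move=> /measurable_matrixP; apply.
  have : measurable_fun setT (fun r : 'rV[R]_n => r *m v) by exact: measurable_fun_mulmx.
  by move=> /measurable_matrixP; apply.
have indepU : mutually_independent P U.
  have -> : U = fun i w => f (row i (X w)).
    by apply/funext => i; apply/funext => w; rewrite /U /f -!row_mul !mxE.
  exact: (mutually_independent_comp indep (fun=> mf)).
have C0 : 0 < 16 / tau ^+ 2 by rewrite divr_gt0// exprn_gt0.
have s0E : 2 * (16 / tau ^+ 2) * (tau / 2) = 16 / tau by field; rewrite gt_eqF.
have mgf i s : `|s| <= tau / 2 ->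
    (\int[P]_w (expR (s * (U i w - dot u (Sigma *m v))))%:E <=
     (expR (16 / tau ^+ 2 * s ^+ 2))%:E)%E.
  move=> hs; apply: mgf_centered => //; first exact: design_exp_product.
  exact: design_bilinear_mean.
have := chernoff_sum mU indepU C0 t0 _ mgf; rewrite s0E => /(_ tle).
have Np : 0 < N%:R :> R by rewrite ltr0n.
rewrite (_ : N%:R * t ^+ 2 * tau ^+ 2 / 64 = N%:R * t ^+ 2 / (4 * (16 / tau ^+ 2))); last first.
  by field; rewrite gt_eqF.
have sumE w : \sum_i (U i w - dot u (Sigma *m v)) =
    N%:R * dot u ((sample_cov (X w) - Sigma) *m v).
  rewrite sumrB sumr_const card_ord -[X in _ - X]mulr_natl mulmxBl dotBr.
  by rewrite dot_sample_cov mulrBr mulrA divff ?mul1r// gt_eqF.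
apply: le_trans; rewrite [X in (P X <= _)%E](_ : _ =
  [set w | N%:R * t <= `|\sum_i (U i w - dot u (Sigma *m v))|])//.
by apply/seteqP; split => w /=; rewrite sumE normrM (ger0_norm (ltW Np)) ler_pM2l.
Qed.

End design.

(** * Exceptional sets and their probabilities *)

Section holds_outside.
Context d (Om : measurableType d) (R : realType) (P : probability Om R).

(** The events of interest assert the existence of matrices or remainders; a
    measurable exceptional set avoids discussing their measurability. *)
Definition holds_outside (e : R) (Q : Om -> Prop) : Prop :=
  exists B, [/\ measurable B, (P B <= e%:E)%E & forall w, ~ B w -> Q w].

Lemma holds_outside_and e1 e2 Q1 Q2 : holds_outside e1 Q1 -> holds_outside e2 Q2 ->
  holds_outside (e1 + e2) (fun w => Q1 w /\ Q2 w).
Proof.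
move=> [B1 [mB1 PB1 BQ1]] [B2 [mB2 PB2 BQ2]]; exists (B1 `|` B2); split.
- exact: measurableU.
- by apply: (le_trans (measureU2 _ _ _)) => //; rewrite EFinD leeD.
- by move=> w /not_orP[nB1 nB2]; split; [exact: BQ1|exact: BQ2].
Qed.

Lemma holds_outside_sub e1 e2 (Q1 Q2 : Om -> Prop) : e1 <= e2 -> (forall w, Q1 w -> Q2 w) ->
  holds_outside e1 Q1 -> holds_outside e2 Q2.
Proof.
move=> e12 Q12 [B [mB PB BQ]]; exists B; split => //.
  by apply: (le_trans PB); rewrite lee_fin.
by move=> w /BQ /Q12.
Qed.

Lemma holds_outside_forall (I : finType) (e : R) (Q : I -> Om -> Prop) :
  (forall i, holds_outside e (Q i)) ->
  holds_outside (#|I|%:R * e) (fun w => forall i, Q i w).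
Proof.
move=> hQ; have [B hB] := choice hQ.
exists (\bigcup_i B i); split.
- by apply: fin_bigcup_measurable => [|i _]; [exact: finite_finset|case: (hB i)].
- by apply: union_bound => i; case: (hB i).
- move=> w nB i; case: (hB i) => _ _; apply => Bi; apply: nB.
  by exists i.
Qed.

Lemma holds_outside_le (e t : R) (f : Om -> R) : measurable_fun setT f ->
  (P [set w | (t <= `|f w|)%R] <= e%:E)%E -> holds_outside e (fun w => `|f w| <= t).
Proof.
move=> mf Pe; exists [set w | t <= `|f w|]; split => //.
  by apply: measurable_le_set => //; exact: measurableT_comp.
by move=> w /negP; rewrite -ltNge => /ltW.
Qed.

End holds_outside.

Section events.
Context d (Om : measurableType d) (R : realType) (P : probability Om R).
Context (N n : nat) (X : Om -> 'M[R]_(N, n)) (sigma : R) (Sigma : 'M[R]_n).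
Hypothesis mX : measurable_fun setT X.
Hypothesis sigma0 : 0 < sigma.
Hypothesis N0 : (0 < N)%N.

(** Used with A = I for the sample covariance itself and with A = Sigma^-1 for
    the feasibility of the precision matrix. Only the Euclidean length of the
    rows of A enters, and for Sigma^-1 it is at most 1 / c in every dimension.
    *)
Lemma max_deviation_bound (A : 'M[R]_n) (kappa t : R)
    (tau := (4 * sigma ^+ 2 * kappa)^-1) :
  sub_gaussian_design P sigma Sigma X ->
  0 < kappa -> (forall a, sqr_l2norm (row a A)^T <= kappa ^+ 2) ->
  0 < t -> t <= 16 / tau ->
  holds_outside P (2 * n%:R ^+ 2 * expR (- (N%:R * t ^+ 2 * tau ^+ 2 / 64)))
    (fun w => forall a b, `|(A *m (sample_cov (X w) - Sigma)) a b| <= t).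
Proof.
move=> design k0 rowA t0 tle; set e := expR _.
have entryE w a b : (A *m (sample_cov (X w) - Sigma)) a b =
    dot (row a A)^T ((sample_cov (X w) - Sigma) *m delta_mx b 0).
  by rewrite entry_dot -mulmxA dot_mulmxr trmx_mul_delta.
have tauE : tau = (4 * sigma ^+ 2 * kappa * 1)^-1 by rewrite mulr1.
have : holds_outside P (#|{: 'I_n * 'I_n}|%:R * (2 * e)) (fun w => forall ab : 'I_n * 'I_n,
    `|dot (row ab.1 A)^T ((sample_cov (X w) - Sigma) *m delta_mx ab.2 0)| <= t).
  apply: holds_outside_forall => -[a b] /=; apply: holds_outside_le.
    apply: measurable_fun_dot; first exact: measurable_cst.
    apply: measurable_fun_mulmx; last exact: measurable_cst.
    by apply: measurable_fun_addmx; [exact: measurable_fun_sample_cov|exact: measurable_cst].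
  rewrite /e tauE; rewrite tauE in tle.
  apply: sample_cov_deviation => //.
  by rewrite sqr_l2norm_delta expr1n.
apply: holds_outside_sub.
  rewrite card_prod card_ord natrM le_eqVlt; apply/orP; left; apply/eqP; ring.
by move=> w h a b; rewrite entryE; exact: (h (a, b)).
Qed.

Context (eps : Om -> 'cV[R]_N) (sigma_eps : R).
Hypothesis meps : measurable_fun setT eps.
Hypothesis sigma_eps0 : 0 < sigma_eps.
Hypothesis noise : gaussian_noise P sigma_eps eps.

(** The correlation of the noise with a nonzero column, divided by sigma_eps
    times the length of the column, is a standard normal variable; a zero
    column contributes nothing. *)
Lemma noise_correlation_bound t : 0 < t -> independent P X eps ->
  holds_outside P (2 * n%:R * expR (- (t ^+ 2 / 2)))
    (fun w => forall a, `|((X w)^T *m eps w) a 0| <=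
       t * (sigma_eps * Num.sqrt (sqr_l2norm (col a (X w))))).
Proof.
move=> t0 X_eps; set e := expR _.
have colE w a : ((X w)^T *m eps w) a 0 = dot (col a (X w)) (eps w).
  by rewrite -dot_delta dot_mulmxr trmxK -colE.
pose Z a w := dot (col a (X w)) (eps w) / (sigma_eps * Num.sqrt (sqr_l2norm (col a (X w)))).
have mcol a : measurable_fun [set: 'M[R]_(N, n)] (col a).
  apply/measurable_matrixP => i j; under eq_fun do rewrite mxE.
  exact: measurable_coord.
have mcolX a : measurable_fun setT (fun w => col a (X w)).
  exact: (measurableT_comp (mcol a) mX).
pose nz a := [set x : 'M[R]_(N, n) | 0 < sqr_l2norm (col a x)].
have mnz a : measurable (nz a).
  by apply: measurable_lt_set => //; exact: measurable_fun_sqr_l2norm.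
have mtail : measurable [set x : R | t <= `|x|].
  by apply: measurable_le_set => //; exact: measurableT_comp.
have : holds_outside P (#|'I_n|%:R * (2 * e))
    (fun w => forall a, ~ (nz a (X w) /\ t <= `|Z a w|)).
  apply: holds_outside_forall => a; exists [set w | nz a (X w) /\ t <= `|Z a w|]; split => //.
    apply: measurableI.
      by have := mX measurableT (mnz a); rewrite setTI.
    apply: measurable_le_set => //; apply: measurableT_comp => //.
    apply: measurable_funM; first exact: measurable_fun_dot.
    apply: measurable_funV; apply: measurable_funM => //; apply: measurable_fun_sqrt.
    exact: measurable_fun_sqr_l2norm.
  rewrite (conditional_standard_normal meps sigma_eps0 noise mX X_eps (mcol a) (mnz a) mtail)//.
  apply: (@le_trans _ _ (1 * normal_prob 0 1 [set x : R | (t <= `|x|)%R])%E).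
    by rewrite lee_wpmul2r// probability_le1// -[X in measurable X]setTI; exact: mX.
  by rewrite mul1e; exact: normal_tail.
apply: holds_outside_sub.
  by rewrite card_ord le_eqVlt; apply/orP; left; apply/eqP; ring.
move=> w h a; rewrite colE.
have [nza|] := ltP 0 (sqr_l2norm (col a (X w))).
  have := h a => /not_andP[//|/negP]; rewrite -ltNge /Z normrM normfV.
  have s0 : 0 < sigma_eps * Num.sqrt (sqr_l2norm (col a (X w))).
    by rewrite mulr_gt0 ?sqrtr_gt0.
  by rewrite (gtr0_norm s0) ltr_pdivrMr// => /ltW.
move=> le0; have -> : col a (X w) = 0.
  by apply: sqr_l2norm_eq0; apply/eqP; rewrite eq_le le0 sqr_l2norm_ge0.
rewrite /dot big1 ?normr0; last by move=> i _; rewrite mxE mul0r.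
by rewrite !mulr_ge0 ?sqrtr_ge0// ltW.
Qed.

(** The left-hand side is the moment generating function of a centred chi-
    square variable. Bounding exp y below by 1 + y and squaring reduces the
    claim to a polynomial inequality. *)
Lemma exp_half_log_bound (s : R) : `|s| <= 8^-1 ->
  expR (- s) * (Num.sqrt (1 - 2 * s))^-1 <= expR (2 * s ^+ 2).
Proof.
rewrite ler_norml => /andP[sl su].
have p0 : 0 < 1 - 2 * s by lra.
have q0 : 0 < Num.sqrt (1 - 2 * s) by rewrite sqrtr_gt0.
rewrite ler_pdivrMr// -(ler_pM2r (expR_gt0 s)) -expRD addNr expR0.
rewrite mulrAC -expRD.
set y := 2 * s ^+ 2 + s.
have y1 : 0 <= 1 + y by rewrite /y; nra.
apply: (@le_trans _ _ ((1 + y) * Num.sqrt (1 - 2 * s))); last first.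
  by rewrite ler_wpM2r ?expR_ge1Dx// ltW.
rewrite -[leLHS]sqrtr1 -(ger0_norm y1) -sqrtr_sqr -sqrtrM ?sqr_ge0//.
rewrite ler_sqrt; last by rewrite mulr_ge0 ?sqr_ge0// ltW.
have -> : (1 + y) ^+ 2 * (1 - 2 * s) =
    1 + s ^+ 2 * (1 - 6 * s - 4 * s ^+ 2 - 8 * s ^+ 3) by rewrite /y; ring.
rewrite lerDl mulr_ge0 ?sqr_ge0//.
have h2 : s ^+ 2 <= 64^-1 by nra.
have h3 : s ^+ 3 <= 64^-1 by rewrite exprS; nra.
by lra.
Qed.

Lemma noise_energy_bound t : 0 < t -> t <= 1 / 2 ->
  holds_outside P (2 * expR (- (N%:R * t ^+ 2 / 8)))
    (fun w => `|N%:R^-1 * sqr_l2norm (eps w) / sigma_eps ^+ 2 - 1| <= t).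
Proof.
move=> t0 t12; have [indep law] := noise.
have s0 : sigma_eps != 0 by rewrite gt_eqF.
have meps_i i : measurable_fun setT (fun w => eps w i 0).
  by apply: (iffLR (measurable_matrixP eps) meps i 0).
pose U (i : 'I_N) w := (eps w i 0 / sigma_eps) ^+ 2.
have mf : measurable_fun setT (fun x : R => (x / sigma_eps) ^+ 2).
  by apply: measurable_funX; exact: measurable_funM.
have mU i : measurable_fun setT (U i) by exact: (measurableT_comp mf (meps_i i)).
have indepU : mutually_independent P U.
  exact: (mutually_independent_comp indep (fun=> mf)).
have mgf i s : `|s| <= 8^-1 ->
    (\int[P]_w (expR (s * (U i w - 1)))%:E <= (expR (2 * s ^+ 2))%:E)%E.
  move=> hs; pose F (x : R) := expR (s * ((x / sigma_eps) ^+ 2 - 1)).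
  have mF : measurable_fun setT F.
    by apply: measurableT_comp => //; apply: measurable_funM => //; exact: measurable_funB.
  have mid : measurable_fun setT (fun w => eps w i 0 : measurableTypeR R) by exact: meps_i.
  have -> : (\int[P]_w (expR (s * (U i w - 1)))%:E =
      \int[normal_prob 0 sigma_eps]_x (F x)%:E)%E.
    rewrite -(@ge0_integral_weight _ _ _ _ R _ mid P (normal_prob 0 sigma_eps) (cst 1))//.
    - by apply: eq_integral => w _; rewrite mule1.
    - move=> B mB; rewrite /= integral_cst// ?mul1e; last first.
        by rewrite -[X in measurable X]setTI; exact: meps_i.
      exact: law.
    - exact/measurable_EFinP.
    - by move=> x; rewrite lee_fin expR_ge0.
  rewrite ge0_integral_normal_prob; last 2 first.
  - exact/measurable_EFinP.
  - by move=> x; rewrite lee_fin expR_ge0.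
  have shs : 2 * (s / sigma_eps ^+ 2) * sigma_eps ^+ 2 = 2 * s by field.
  have s1 : 2 * s < 1 by move: hs; rewrite ler_norml => /andP[_]; lra.
  have -> : (\int[lebesgue_measure]_x ((F x)%:E * (normal_pdf 0 sigma_eps x)%:E) =
    \int[lebesgue_measure]_x ((expR (- s))%:E *
      (expR (s / sigma_eps ^+ 2 * x ^+ 2) * normal_pdf 0 sigma_eps x)%:E))%E.
    apply: eq_integral => x _; rewrite -!EFinM; congr EFin.
    rewrite mulrA -expRD /F; congr (expR _ * _).
    by field.
  rewrite ge0_integralZl//=; last 2 first.
  - apply/measurable_EFinP; apply: measurable_funM; last exact: measurable_normal_pdf.
    by apply: measurableT_comp => //; apply: measurable_funM => //; exact: measurable_funX.
  - by move=> x _; rewrite lee_fin mulr_ge0 ?expR_ge0 ?normal_pdf_ge0.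
  by rewrite normal_exp_sqr// shs// -EFinM lee_fin exp_half_log_bound.
have Np : 0 < N%:R :> R by rewrite ltr0n.
apply: holds_outside_le.
  apply: measurable_funB => //; apply: measurable_funM => //; apply: measurable_funM => //.
  exact: measurable_fun_sqr_l2norm.
have t8 : t <= 2 * 2 * 8^-1 by lra.
have := chernoff_sum mU indepU (ltr0n _ 2) t0 t8 mgf.
rewrite (_ : 4 * 2 = 8); last by ring.
have sumE w : \sum_i (U i w - 1) = N%:R * (N%:R^-1 * sqr_l2norm (eps w) / sigma_eps ^+ 2 - 1).
  rewrite sumrB sumr_const card_ord mulrBr mulr1 !mulrA divff ?mul1r ?gt_eqF//.
  congr (_ - _); rewrite /sqr_l2norm mulr_suml; apply: eq_bigr => i _.
  by rewrite /U exprMn exprVn.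
apply: le_trans; rewrite [X in (P X <= _)%E](_ : _ =
  [set w | N%:R * t <= `|\sum_i (U i w - 1)|])//.
by apply/seteqP; split => w /=; rewrite sumE normrM (ger0_norm (ltW Np)) ler_pM2l.
Qed.

End events.

(** * The studentized statistic as a perturbed noise ratio *)

Section constants.
Context (R : realType) (sigma_x c : R).
(** Bounds the diagonal of the sample covariance as soon as it is within 1 of
    Sigma. *)
Definition variance_bound : R := 8 * sigma_x ^+ 2 + 1.
(** Makes lambda / 2 equal to the noise level 2 sigma_eps sqrt (L / N), for L
    = ln n, times the bound on the length of the normalized columns. *)
Definition lambda_const : R := 4 * Num.sqrt variance_bound.
(** Makes the inverse of Sigma feasible with probability at least 1 - 2 / n,
    by a union bound over the n^2 entries. *)
Definition mu_const : R := 56 * sigma_x ^+ 2 / c.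

Lemma variance_bound_ge1 : 1 <= variance_bound.
Proof. by rewrite /variance_bound lerDr mulr_ge0 ?sqr_ge0. Qed.

Lemma variance_bound_gt0 : 0 < variance_bound.
Proof. exact: lt_le_trans variance_bound_ge1. Qed.

Lemma lambda_const_gt0 : 0 < lambda_const.
Proof. by rewrite mulr_gt0 ?sqrtr_gt0 ?variance_bound_gt0. Qed.

End constants.

Section expansion.
Context (R : realType) (k : nat) (nu sigma_x c sigma : R).
Context (N n : nat) (e : rel 'I_n) (s1 s2 : R) (bstar : 'cV[R]_n) (Sigma : 'M[R]_n).
Context (X : 'M[R]_(N, n)) (eps : 'cV[R]_N) (bhat : 'cV[R]_n) (Theta : 'M[R]_n) (j : 'I_n).
Local Notation K := (variance_bound sigma_x).
Local Notation Cl := (lambda_const sigma_x).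
Local Notation Cm := (mu_const sigma_x c).
Let L : R := ln n%:R.
Let h : R := Num.sqrt (L / N%:R).
Let lambda := Cl * (sigma * h).
Let lambda_g := lambda * Num.sqrt (nu / (2 * max_degree e)%:R ^+ k.+1).
Let mu := Cm * h.
Let y := X *m bstar + eps.
Let v := bhat - bstar.
Let g := score Theta X j.
(** Two regimes are treated together. In the first one the noise level is q =
    1 and v lies in the cone. The failure probability of the noise bound at
    this level is of order 1 / n, which is not small in bounded dimension; so
    when n <= K0 a larger q is used instead, the l1 norm is compared with the
    Euclidean norm through K0, and the sparsity is increased to r = s2 + 1 so
    that sqrt r >= 1. *)
Context (T q d0 K0 r : R).
Let D := 6 + (q + 1) * Num.sqrt K0.

Hypothesis nu0 : 0 <= nu.
Hypothesis sigma_x0 : 0 < sigma_x.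
Hypothesis c0 : 0 < c.
Hypothesis sigma0 : 0 < sigma.
Hypothesis N0 : (0 < N)%N.
Hypothesis n1 : (1 < n)%N.
Hypothesis eG : simple_graph e.
Hypothesis s10 : 0 < s1.
Hypothesis s20 : 0 < s2.
Hypothesis nus : nu <= s2 / s1.
Hypothesis bstarS : param_space e k s1 s2 bstar.
Hypothesis bhatP : is_gpp_lasso e k lambda lambda_g X y bhat.
Hypothesis SigmaC : forall u, c * sqr_l2norm u <= dot u (Sigma *m u).
Hypothesis Sigma_le : forall a, `|Sigma a a| <= 8 * sigma_x ^+ 2.
Hypothesis T0 : 0 <= T.
Hypothesis dev : forall a b, `|(sample_cov X - Sigma) a b| <= T * h.
Hypothesis q0 : 0 <= q.
Hypothesis noise : forall a, `|(X^T *m eps) a 0| <=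
  2 * q * Num.sqrt L * (sigma * Num.sqrt (sqr_l2norm (col a X))).
Hypothesis energy : `|N%:R^-1 * sqr_l2norm eps / sigma ^+ 2 - 1| <= d0.
Hypothesis feasible : clime_feasible mu X Theta.
Hypothesis Th1 : T * h <= 1.
Hypothesis mu12 : mu <= 1 / 2.
Hypothesis regime : (q = 1 /\ r = s2) \/ (n%:R <= K0 /\ r = s2 + 1).
Hypothesis rate_small : T * h * (D ^+ 2 * r) <= c / 2.

Let Np : 0 < N%:R :> R. Proof. by rewrite ltr0n. Qed.

Let L0 : 0 < L. Proof. by rewrite ln_gt0// ltr1n. Qed.

Let h0 : 0 < h. Proof. by rewrite sqrtr_gt0 divr_gt0. Qed.

Let hE : h = Num.sqrt L / Num.sqrt N%:R.
Proof. by rewrite /h sqrtrM ?sqrtrV// ltW. Qed.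

Let h2 : h ^+ 2 = L / N%:R. Proof. by rewrite sqr_sqrtr// divr_ge0// ltW. Qed.

Let lambda0 : 0 < lambda.
Proof. by apply: mulr_gt0; [exact: lambda_const_gt0|exact: mulr_gt0]. Qed.

Let K_gt0 : 0 < K. Proof. exact: variance_bound_gt0. Qed.

Let sample_var_le a : sample_cov X a a <= K.
Proof.
have : sample_cov X a a - Sigma a a <= 1.
  apply: le_trans Th1; apply: le_trans (dev a a); apply: le_trans (ler_norm _).
  by rewrite [in leRHS]mxE [in X in _ <= _ + X]mxE.
have := Sigma_le a; rewrite ler_norml => /andP[_]; rewrite /variance_bound; lra.
Qed.

Let noise_level a : `|(X^T *m eps) a 0 / N%:R| <= q / 2 * lambda.
Proof.
rewrite normrM normfV (gtr0_norm Np) ler_pdivrMr//; apply: (le_trans (noise a)).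
have colE : sqr_l2norm (col a X) = N%:R * sample_cov X a a.
  rewrite entry_dot dot_sample_cov dotvv colE mulrA divff ?mul1r//.
  by rewrite gt_eqF.
have -> : q / 2 * lambda * N%:R =
    2 * q * Num.sqrt L * (sigma * (Num.sqrt N%:R * Num.sqrt K)).
  rewrite /lambda /lambda_const hE -{2}(sqr_sqrtr (ltW Np)).
  by field; rewrite gt_eqF// sqrtr_gt0.
rewrite colE !ler_wpM2l ?mulr_ge0 ?sqrtr_ge0 ?(ltW sigma0)//.
by rewrite sqrtrM ?ler0n// ler_wpM2l ?sqrtr_ge0// ler_wsqrtr.
Qed.

Let s2r : s2 <= r. Proof. by case: regime => -[_ ->]; rewrite ?lerDl. Qed.
Let r0 : 0 <= r. Proof. exact: le_trans (ltW s20) s2r. Qed.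

Let D0 : 0 <= D.
Proof. by rewrite addr_ge0// mulr_ge0 ?sqrtr_ge0// addr_ge0. Qed.

Let l2 := Num.sqrt (sqr_l2norm v).
Let l20 : 0 <= l2. Proof. exact: sqrtr_ge0. Qed.

Let cone : l1norm v <= D * Num.sqrt r * l2 /\
  (2 * N%:R)^-1 * sqr_l2norm (X *m v) <= D * Num.sqrt r * (lambda * l2).
Proof.
have ss : Num.sqrt s2 <= Num.sqrt r by rewrite ler_wsqrtr.
have sr0 : 0 <= Num.sqrt r := sqrtr_ge0 r.
have sK0 : 0 <= Num.sqrt K0 := sqrtr_ge0 K0.
have [[q1 _]|[nK rE]] := regime.
  have noise' a : `|(X^T *m eps) a 0 / N%:R| <= lambda / 2.
    by apply: (le_trans (noise_level a)); rewrite q1; lra.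
  have [l1 pred] := lasso_cone N0 eG nu0 (ltW lambda0) s10 s20 nus bstarS bhatP noise' lambda0.
  have D6 : 6 <= D by rewrite lerDl mulr_ge0// addr_ge0.
  split.
    apply: (le_trans l1); rewrite -/v -/l2 ler_wpM2r// ler_pM// ?sqrtr_ge0//.
  apply: (le_trans pred); rewrite -/v -/l2 ler_wpM2r//; first by rewrite mulr_ge0// ltW.
  by rewrite ler_pM// ?sqrtr_ge0//; lra.
have sr1 : 1 <= Num.sqrt r by rewrite -sqrtr1 ler_wsqrtr// rE lerDr ltW.
have l1 : l1norm v <= Num.sqrt K0 * l2 by exact: l1norm_le_sqrt_dim.
have DK : Num.sqrt K0 <= D by rewrite /D mulrDl mul1r addrA lerDr addr_ge0// mulr_ge0.
split.
  apply: (le_trans l1); rewrite ler_wpM2r//; apply: (le_trans DK).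
  by rewrite ler_peMr.
have := lasso_crude N0 eG nu0 (ltW lambda0) s10 s20 nus bstarS bhatP noise_level.
rewrite -/v -/l2 => /le_trans; apply.
rewrite [leRHS]mulrCA ler_wpM2l ?(ltW lambda0)//.
apply: (@le_trans _ _ ((q / 2 + 1) * (Num.sqrt K0 * l2) + Num.sqrt r * l2)).
  by rewrite lerD// ?ler_wpM2l// ?ler_wpM2r// addr_ge0// divr_ge0.
rewrite mulrA -mulrDl ler_wpM2r//.
have : (q / 2 + 1) * Num.sqrt K0 <= (q + 1) * Num.sqrt K0 * Num.sqrt r.
  apply: (@le_trans _ _ ((q + 1) * Num.sqrt K0)).
    rewrite ler_wpM2r//.
    by have := q0; lra.
  by rewrite ler_peMr// mulr_ge0// addr_ge0.
rewrite /D mulrDl; lra.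
Qed.

Let a := D * Num.sqrt r.
Let a0 : 0 <= a. Proof. by rewrite mulr_ge0// sqrtr_ge0. Qed.
Let a2 : a ^+ 2 = D ^+ 2 * r. Proof. by rewrite exprMn sqr_sqrtr. Qed.

Let dev_small : T * h * a ^+ 2 <= c / 2. Proof. by rewrite a2. Qed.

Let Thge0 : 0 <= T * h. Proof. by rewrite mulr_ge0// ltW. Qed.

Let l1_rate : l1norm v <= 4 * D ^+ 2 * r * lambda / c.
Proof.
have [va vb] := cone.
have := lasso_l1_rate N0 c0 SigmaC dev a0 a0 (ltW lambda0) va vb dev_small Thge0.
by rewrite (_ : 4 * a * a = 4 * D ^+ 2 * r)// -[4 * a * a]mulrA -expr2 a2 mulrA.
Qed.

Let prediction_rate : N%:R^-1 * sqr_l2norm (X *m v) <= 8 * D ^+ 2 * r * lambda ^+ 2 / c.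
Proof.
have [va vb] := cone.
have := lasso_prediction_rate N0 c0 SigmaC dev a0 a0 (ltW lambda0) va vb dev_small Thge0.
by rewrite a2 !mulrA.
Qed.

Definition bias_const := 8 * Cm * Cl * Num.sqrt K * D ^+ 2 / c.
Definition scale_const := (4 * q + 8) * D ^+ 2 * Cl ^+ 2 / c.
Let u := r * L / Num.sqrt N%:R.

Let Cm0 : 0 <= Cm.
Proof. by apply: divr_ge0; [rewrite mulr_ge0 ?sqr_ge0|exact: ltW]. Qed.

Let mu0 : 0 <= mu. Proof. by apply: mulr_ge0 => //; exact: ltW. Qed.

Let qv := N%:R^-1 * sqr_l2norm g.

Let qv_ge : (4 * K)^-1 <= qv.
Proof. exact: clime_variance_lower_bound feasible mu12 (sample_var_le j) K_gt0. Qed.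

Let g0 : 0 < sqr_l2norm g.
Proof.
have : 0 < qv by apply: lt_le_trans qv_ge; rewrite invr_gt0 mulr_gt0.
by rewrite /qv pmulr_rgt0// invr_gt0.
Qed.

Let rho := sigma_hat X y bhat / sigma.
Let b := - (Num.sqrt N%:R * dot ((row j (Theta *m sample_cov X - 1%:M))^T) v
     / (sigma * Num.sqrt qv)).

Let b_le : `|b| <= bias_const * u.
Proof.
have sN : 0 < Num.sqrt N%:R :> R by rewrite sqrtr_gt0.
have sK : 0 < Num.sqrt K by rewrite sqrtr_gt0.
have sqv : (2 * Num.sqrt K)^-1 <= Num.sqrt qv.
  rewrite -[leLHS]ger0_norm ?invr_ge0 ?mulr_ge0 ?sqrtr_ge0// -sqrtr_sqr ler_wsqrtr//.
  by apply: le_trans qv_ge; rewrite exprVn exprMn (sqr_sqrtr (ltW K_gt0)) -natrX.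
have sqv0 : 0 < Num.sqrt qv by apply: lt_le_trans sqv; rewrite invr_gt0 mulr_gt0.
rewrite normrN normrM normfV (gtr0_norm (mulr_gt0 sigma0 sqv0)) normrM (gtr0_norm sN).
rewrite ler_pdivrMr ?mulr_gt0//.
apply: (@le_trans _ _ (Num.sqrt N%:R * (mu * (4 * D ^+ 2 * r * lambda / c)))).
  rewrite ler_wpM2l ?(ltW sN)//; apply: (le_trans (bias_le _ _ _ feasible)).
  by rewrite ler_wpM2l.
apply: (@le_trans _ _ (bias_const * u * (sigma * (2 * Num.sqrt K)^-1))); last first.
  have bc0 : 0 <= bias_const.
    apply: divr_ge0; last exact: ltW.
    apply: mulr_ge0; last exact: sqr_ge0.
    apply: mulr_ge0; last exact: sqrtr_ge0.
    apply: mulr_ge0; last exact/ltW/lambda_const_gt0.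
    exact: mulr_ge0.
  have u0 : 0 <= u by apply: divr_ge0; [exact: mulr_ge0 (ltW L0)|exact: ltW].
  by apply: ler_wpM2l; [exact: mulr_ge0|rewrite ler_wpM2l// ltW].
rewrite le_eqVlt; apply/orP; left; apply/eqP.
have sLE : Num.sqrt L ^+ 2 = L by rewrite sqr_sqrtr// ltW.
rewrite /mu /lambda /bias_const /u hE -{3}sLE; field.
by rewrite !gt_eqF.
Qed.

Let rho2_le : `|rho ^+ 2 - 1| <= d0 + scale_const * u.
Proof.
have rho2E : rho ^+ 2 = N%:R^-1 * sqr_l2norm eps / sigma ^+ 2
    - 2 * dot (N%:R^-1 *: (X^T *m eps)) v / sigma ^+ 2
    + N%:R^-1 * sqr_l2norm (X *m v) / sigma ^+ 2.
  rewrite /rho expr_div_n sigma_hatE sqr_sqrtr; last first.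
    by rewrite mulr_ge0 ?sqr_l2norm_ge0// invr_ge0 ltW.
  rewrite sqr_l2normB dot_mulmxr dotZl; field.
  by rewrite !gt_eqF.
have s2gt0 : 0 < sigma ^+ 2 by rewrite exprn_gt0.
have cross : `|2 * dot (N%:R^-1 *: (X^T *m eps)) v / sigma ^+ 2| <=
    2 * (q / 2 * lambda * (4 * D ^+ 2 * r * lambda / c)) / sigma ^+ 2.
  rewrite normrM normfV (gtr0_norm s2gt0) ler_wpM2r ?invr_ge0 ?(ltW s2gt0)//.
  rewrite normrM ger0_norm// ler_wpM2l//.
  apply: (@le_trans _ _ (q / 2 * lambda * l1norm v)).
    by apply: hoelder_dot => i; rewrite mxE mulrC; exact: noise_level.
  by rewrite ler_wpM2l// mulr_ge0 ?(ltW lambda0)// divr_ge0.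
have pred : `|N%:R^-1 * sqr_l2norm (X *m v) / sigma ^+ 2| <=
    8 * D ^+ 2 * r * lambda ^+ 2 / c / sigma ^+ 2.
  rewrite ger0_norm; first by rewrite ler_wpM2r ?invr_ge0 ?(ltW s2gt0).
  by rewrite divr_ge0 ?(ltW s2gt0)// mulr_ge0 ?sqr_l2norm_ge0 ?invr_ge0 ?(ltW Np).
have total : 2 * (q / 2 * lambda * (4 * D ^+ 2 * r * lambda / c)) / sigma ^+ 2 +
    8 * D ^+ 2 * r * lambda ^+ 2 / c / sigma ^+ 2 <= scale_const * u.
  have -> : 2 * (q / 2 * lambda * (4 * D ^+ 2 * r * lambda / c)) / sigma ^+ 2 +
    8 * D ^+ 2 * r * lambda ^+ 2 / c / sigma ^+ 2 = scale_const * (r * h ^+ 2).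
    by rewrite /lambda /scale_const; field; rewrite !gt_eqF.
  rewrite ler_wpM2l//.
    rewrite divr_ge0 ?(ltW c0)// !mulr_ge0 ?sqr_ge0//.
    by rewrite addr_ge0 ?mulr_ge0.
  rewrite h2 /u -mulrA ler_wpM2l// ler_wpM2l ?(ltW L0)//.
  rewrite lef_pV2 ?posrE ?sqrtr_gt0//.
  rewrite -[leRHS](sqr_sqrtr (ltW Np)) expr2 ler_peMr ?sqrtr_ge0//.
  by rewrite -[leLHS]sqrtr1 ler_wsqrtr// ler1n.
rewrite rho2E; move: energy cross pred total; rewrite !ler_norml.
by do 3 move=> /andP[? ?]; move=> ?; apply/andP; split; lra.
Qed.

(** Both remainders are of the order of u = r L / sqrt N: the bias is at most
    sqrt N mu |v|_1 divided by a quantity bounded below, and rho^2 - 1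
    collects the fluctuation d0 of the noise energy, the correlation of the
    noise with X v, and the prediction error. *)
Lemma studentized_expansion : d0 + scale_const * u < 1 ->
  0 < sqr_l2norm g /\
  exists rho' b', [/\ 0 < rho', `|rho' - 1| <= d0 + scale_const * u,
    `|b'| <= bias_const * u &
    studentized X y bstar bhat Theta j =
      (dot g eps / (sigma * Num.sqrt (sqr_l2norm g)) + b') / rho'].
Proof.
move=> small; split; first exact: g0.
have rho_ge0 : 0 <= rho by rewrite divr_ge0 ?sqrtr_ge0 ?(ltW sigma0).
have rho_gt0 : 0 < rho.
  rewrite lt_def rho_ge0 andbT; apply/eqP => rho0.
  by move: rho2_le; rewrite rho0 expr0n/= sub0r normrN normr1; lra.
exists rho, b; split => //.
  apply: le_trans rho2_le; rewrite (_ : rho ^+ 2 - 1 = (rho - 1) * (rho + 1)); last by ring.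
  by rewrite normrM ler_peMr// ger0_norm ?addr_ge0// lerDr.
exact: studentizedE N0 sigma0 g0 rho_gt0.
Qed.

End expansion.

(** * The expansion holds with high probability *)

Section elementary.
Context (R : realType).

Lemma expRN_le_inv (x : R) : 0 < x -> expR (- x) <= x^-1.
Proof.
move=> x0; rewrite expRN lef_pV2 ?posrE ?expR_gt0//.
by apply: le_trans (expR_ge1Dx _); rewrite lerDr.
Qed.

Lemma ln_nat_ge_half n : (1 < n)%N -> 1 / 2 <= ln (n%:R : R).
Proof.
move=> n1; have h : ln (1 + - (1 / 2) : R) <= - (1 / 2) by apply: le_ln1Dx; lra.
apply: (@le_trans _ _ (ln 2)); last by rewrite ler_ln ?posrE ?ltr0n ?ler_nat// ltnW.
move: h; rewrite (_ : 1 + - (1 / 2) = 2^-1 :> R); last by lra.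
by rewrite lnV ?posrE//; lra.
Qed.

Lemma expR_ln_nat n (a : R) : (0 < n)%N -> n%:R ^+ 2 * expR (- (a * ln n%:R)) =
  expR (- ((a - 2) * ln n%:R)).
Proof.
move=> n0; have np : (n%:R : R) \is Num.pos by rewrite posrE ltr0n.
rewrite -{1}(lnK np) -expRM_natr -expRD; congr expR; ring.
Qed.

End elementary.

Section deterministic_feasibility.
Context (R : realType) (N n : nat) (X : 'M[R]_(N, n)) (Sigma : 'M[R]_n).

(** In bounded dimension, entrywise closeness to Sigma makes the sample
    covariance coercive; it is then invertible and its inverse satisfies the
    constraint exactly. *)
Lemma low_dimension_feasible (c t mu K0 : R) : 0 < c ->
  (forall u, c * sqr_l2norm u <= dot u (Sigma *m u)) ->
  (forall a b, `|(sample_cov X - Sigma) a b| <= t) -> 0 <= t ->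
  n%:R <= K0 -> t * K0 <= c / 2 -> 0 <= mu ->
  exists Theta, clime_feasible mu X Theta.
Proof.
move=> c0 Sc dev t0 nK tK mu0; set S := sample_cov X.
have K0_ge0 : 0 <= K0 by apply: le_trans nK; rewrite ler0n.
have Sc2 (v : 'cV[R]_n) : c / 2 * sqr_l2norm v <= dot v (S *m v).
  have -> : S = Sigma + (S - Sigma) by rewrite addrC subrK.
  rewrite mulmxDl dotDr.
  have := quadratic_form_max_le v dev; rewrite ler_norml => /andP[dl _].
  have l1 : l1norm v ^+ 2 <= K0 * sqr_l2norm v.
    rewrite -[K0]sqr_sqrtr// -[sqr_l2norm v]sqr_sqrtr ?sqr_l2norm_ge0// -exprMn.
    rewrite ler_sqr ?nnegrE ?l1norm_ge0 ?mulr_ge0 ?sqrtr_ge0//.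
    exact: l1norm_le_sqrt_dim.
  have := ler_wpM2l t0 l1; have := Sc v.
  have := ler_wpM2r (sqr_l2norm_ge0 v) tK.
  by lra.
exists (invmx S) => i j; rewrite mulVmx; last first.
  by apply: (coercive_unitmx _ Sc2); rewrite divr_gt0.
by rewrite subrr mxE normr0.
Qed.

Lemma precision_row_norm (c : R) : 0 < c -> Sigma^T = Sigma ->
  (forall u, c * sqr_l2norm u <= dot u (Sigma *m u)) ->
  forall a, sqr_l2norm (row a (invmx Sigma))^T <= c^-1 ^+ 2.
Proof.
move=> c0 SigmaS Sc a; rewrite -trmx_mul_delta trmx_inv SigmaS.
apply: (le_trans (sqr_l2norm_invmx c0 Sc _)).
by rewrite sqr_l2norm_delta mulr1.
Qed.

(** Sigma^-1 S - I = Sigma^-1 (S - Sigma). *)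
Lemma precision_feasible (mu : R) : Sigma \in unitmx ->
  (forall a b, `|(invmx Sigma *m (sample_cov X - Sigma)) a b| <= mu) ->
  clime_feasible mu X (invmx Sigma).
Proof. by move=> unitS h i j; have := h i j; rewrite mulmxBr mulVmx. Qed.

End deterministic_feasibility.

Section finite_sample.
Context (R : realType) (k : nat) (nu sigma_x c eta delta : R).
Hypothesis nu0 : 0 <= nu.
Hypothesis sigma_x0 : 0 < sigma_x.
Hypothesis c0 : 0 < c.
Hypothesis eta0 : 0 < eta.
Hypothesis delta0 : 0 < delta.
Hypothesis delta1 : delta < 1.

(* The dimension K0 is where failure probabilities of order 2 / n drop below
   eta; q is a noise level for which they are below eta already at n = 2, and
   T is the matching multiple of h in the deviation of the sample covariance.
   *)
Let Cl := lambda_const sigma_x.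
Let Cm := mu_const sigma_x c.
Let q : R := 2 + 4 / eta.
Let K0 : R := 2 / eta.
Let T : R := 32 * q * sigma_x ^+ 2.
Let D (q' : R) : R := 6 + (q' + 1) * Num.sqrt K0.
Let d0 : R := delta / 2.

Let q_ge2 : 2 <= q. Proof. by rewrite lerDl divr_ge0// ltW. Qed.
Let K0_gt0 : 0 < K0. Proof. by rewrite divr_gt0. Qed.
Let T_gt0 : 0 < T.
Proof. by apply: mulr_gt0; [have := q_ge2; lra|rewrite exprn_gt0]. Qed.
Let Cm_gt0 : 0 < Cm.
Proof. by apply: divr_gt0; [rewrite mulr_gt0 ?exprn_gt0|]. Qed.
Let d0_gt0 : 0 < d0. Proof. by rewrite divr_gt0. Qed.

(** A common upper bound of all the constants that multiply either h or the
    rate s2 L / sqrt N, so that one smallness condition serves all. *)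
Let C_total : R := 1 + (2 * T * (D 1 ^+ 2 + D q ^+ 2)
  + (bias_const sigma_x c 1 K0 + bias_const sigma_x c q K0)
  + (scale_const sigma_x c 1 K0 + scale_const sigma_x c q K0)
  + (q + T + Cm + T * K0 + 32 / d0 ^+ 2)).
Let tol : R := Num.min (Num.min (c / 2) d0) (Num.min (1 / 2) eta).
Let u_star : R := tol / C_total.
Definition rate_threshold : R := u_star / 2.
Definition h_threshold : R := u_star / (2 * (1 + 2 * K0)).

Let bias_const_ge0 q' : 0 <= q' -> 0 <= bias_const sigma_x c q' K0.
Proof.
move=> q'0; apply: divr_ge0; last exact: ltW.
apply: mulr_ge0; last exact: sqr_ge0.
apply: mulr_ge0; last exact: sqrtr_ge0.
apply: mulr_ge0; last exact/ltW/lambda_const_gt0.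
by apply: mulr_ge0 => //; exact: ltW Cm_gt0.
Qed.

Let scale_const_ge0 q' : 0 <= q' -> 0 <= scale_const sigma_x c q' K0.
Proof.
move=> q'0; apply: divr_ge0; last exact: ltW.
apply: mulr_ge0; last exact: sqr_ge0.
by apply: mulr_ge0; [rewrite addr_ge0 ?mulr_ge0|exact: sqr_ge0].
Qed.

Let q_ge0 : 0 <= q. Proof. by have := q_ge2; lra. Qed.

Let C_total_bounds :
  [/\ 1 <= C_total, forall q', q' = 1 \/ q' = q -> [/\ 2 * T * D q' ^+ 2 <= C_total,
      bias_const sigma_x c q' K0 <= C_total & scale_const sigma_x c q' K0 <= C_total]
    & [/\ q <= C_total, T <= C_total, Cm <= C_total, T * K0 <= C_total &
          32 / d0 ^+ 2 <= C_total]].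
Proof.
have b1 := bias_const_ge0 ler01; have bq := bias_const_ge0 q_ge0.
have t1 := scale_const_ge0 ler01; have tq := scale_const_ge0 q_ge0.
have T0 := ltW T_gt0; have Cm0 := ltW Cm_gt0; have q0 := q_ge0.
have TK : 0 <= T * K0 by rewrite mulr_ge0 ?(ltW K0_gt0).
have d02 : 0 <= 32 / d0 ^+ 2 by rewrite divr_ge0 ?sqr_ge0.
have D1 : 0 <= 2 * T * D 1 ^+ 2 by rewrite mulr_ge0 ?sqr_ge0// mulr_ge0.
have Dq : 0 <= 2 * T * D q ^+ 2 by rewrite mulr_ge0 ?sqr_ge0// mulr_ge0.
rewrite /C_total [2 * T * (_ + _)]mulrDr.
by split; [lra|move=> q' [->|->]; split; lra|split; lra].
Qed.

Let tol_gt0 : 0 < tol.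
Proof. by rewrite !lt_min d0_gt0 eta0 !divr_gt0. Qed.

Let C_total_gt0 : 0 < C_total.
Proof. by have [h _ _] := C_total_bounds; exact: lt_le_trans h. Qed.

Let u_star_gt0 : 0 < u_star. Proof. exact: divr_gt0. Qed.

Lemma rate_threshold_gt0 : 0 < rate_threshold. Proof. exact: divr_gt0. Qed.

Lemma h_threshold_gt0 : 0 < h_threshold.
Proof. by rewrite divr_gt0// mulr_gt0// addr_gt0// mulr_gt0. Qed.

Let below_tol C u : 0 <= u -> u <= u_star -> C <= C_total ->
  [/\ C * u <= c / 2, C * u <= d0, C * u <= 1 / 2 & C * u <= eta].
Proof.
move=> u0 uu CC.
have : C * u <= tol.
  apply: (@le_trans _ _ (C_total * u_star)).
    apply: (@le_trans _ _ (C_total * u)); first by rewrite ler_wpM2r.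
    by rewrite ler_wpM2l// ltW.
  by rewrite mulrC divfK// gt_eqF.
by rewrite !le_min => /andP[/andP[-> ->] /andP[-> ->]].
Qed.

Section fixed_size.
Context d (Om : measurableType d) (P : probability Om R).
Context (sigma_eps : R) (N n : nat) (e : rel 'I_n) (s1 s2 : R).
Context (bstar : 'cV[R]_n) (Sigma : 'M[R]_n).
Context (X : Om -> 'M[R]_(N, n)) (eps : Om -> 'cV[R]_N) (bhat : Om -> 'cV[R]_n).
Context (Theta_hat : 'M[R]_(N, n) -> 'M[R]_n) (j : 'I_n).
Let L : R := ln n%:R.
Let h : R := Num.sqrt (L / N%:R).
Let y w := X w *m bstar + eps w.
Let lambda := Cl * (sigma_eps * h).
Let lambda_g := lambda * Num.sqrt (nu / (2 * max_degree e)%:R ^+ k.+1).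
Let mu := Cm * h.
Let g w := score (Theta_hat (X w)) (X w) j.

Definition expansion_within (w : Om) : Prop :=
  0 < sqr_l2norm (g w) /\
  exists rho b, [/\ 0 < rho, `|rho - 1| <= delta, `|b| <= delta &
    studentized (X w) (y w) bstar (bhat w) (Theta_hat (X w)) j =
      (dot (g w) (eps w) / (sigma_eps * Num.sqrt (sqr_l2norm (g w))) + b) / rho].

Hypothesis mX : measurable_fun setT X.
Hypothesis meps : measurable_fun setT eps.
Hypothesis sigma_eps0 : 0 < sigma_eps.
Hypothesis N0 : (0 < N)%N.
Hypothesis n1 : (1 < n)%N.
Hypothesis eG : simple_graph e.
Hypothesis s10 : 0 < s1.
Hypothesis s20 : 0 < s2.
Hypothesis nus : nu <= s2 / s1.
Hypothesis bstarS : param_space e k s1 s2 bstar.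
Hypothesis design : sub_gaussian_design P sigma_x Sigma X.
Hypothesis SigmaS : Sigma^T = Sigma.
Hypothesis SigmaC : forall u, c * sqr_l2norm u <= dot u (Sigma *m u).
Hypothesis noise : gaussian_noise P sigma_eps eps.
Hypothesis X_eps : independent P X eps.
Hypothesis bhatP : forall w, is_gpp_lasso e k lambda lambda_g (X w) (y w) (bhat w).
Hypothesis Theta_hatP : forall x, (exists Theta, clime_feasible mu x Theta) ->
  is_clime mu x (Theta_hat x).

Let Np : 0 < N%:R :> R. Proof. by rewrite ltr0n. Qed.
Let L_half : 1 / 2 <= L. Proof. exact: ln_nat_ge_half. Qed.
Let L0 : 0 < L. Proof. by apply: lt_le_trans L_half; lra. Qed.
Let h0 : 0 < h. Proof. by rewrite sqrtr_gt0 divr_gt0. Qed.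
Let h2 : h ^+ 2 = L / N%:R. Proof. by rewrite sqr_sqrtr// divr_ge0// ltW. Qed.
Let Nh2 : N%:R * h ^+ 2 = L. Proof. by rewrite h2 mulrC divfK// gt_eqF. Qed.

Let tail_small (a : R) : q ^+ 2 <= a -> expR (- ((a - 2) * L)) <= eta / 2.
Proof.
move=> qa; have [q2 e0] := (q_ge2, eta0).
have x0 : 0 < 2 / eta by rewrite divr_gt0.
have : 2 / eta <= (a - 2) * L.
  apply: (@le_trans _ _ ((a - 2) * (1 / 2))); last first.
    by rewrite ler_wpM2l//; nra.
  have : 4 + 4 * (4 / eta) <= q ^+ 2.
    rewrite /q sqrrD; have := sqr_ge0 (4 / eta); lra.
  have i0 : 0 < eta^-1 by rewrite invr_gt0.
  by move=> h1; lra.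
move=> h1; rewrite -(invrK (eta / 2)) invf_div.
apply: le_trans (expRN_le_inv _) _; last by rewrite lef_pV2 ?posrE// (lt_le_trans x0).
exact: lt_le_trans h1.
Qed.

Let dev_event : q * h <= 2 -> holds_outside P eta
  (fun w => forall a b, `|(sample_cov (X w) - Sigma) a b| <= T * h).
Proof.
move=> qh.
have rows (a : 'I_n) : sqr_l2norm (row a (1%:M : 'M[R]_n))^T <= 1 ^+ 2.
  by rewrite rowE mulmx1 trmx_delta sqr_l2norm_delta expr1n.
have Th0 : 0 < T * h by rewrite mulr_gt0.
have sx2 : sigma_x ^+ 2 != 0 by rewrite gt_eqF// exprn_gt0.
have tle : T * h <= 16 / (4 * sigma_x ^+ 2 * 1)^-1.
  rewrite invrK mulr1 /T; have := ler_wpM2l (ltW (exprn_gt0 2 sigma_x0)) qh; lra.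
have := max_deviation_bound mX sigma_x0 N0 design ltr01 rows Th0 tle.
apply: holds_outside_sub; last by move=> w; rewrite mul1mx.
have -> : N%:R * (T * h) ^+ 2 * (4 * sigma_x ^+ 2 * 1)^-1 ^+ 2 / 64 = q ^+ 2 * L.
  by rewrite exprMn -Nh2 /T; field; rewrite gt_eqF.
rewrite -mulrA expR_ln_nat ?(ltnW n1)//.
by have := tail_small (lexx (q ^+ 2)); lra.
Qed.

Let energy_event : 2 * (8 / d0 ^+ 2) * (2 * h ^+ 2) <= eta -> holds_outside P eta
  (fun w => `|N%:R^-1 * sqr_l2norm (eps w) / sigma_eps ^+ 2 - 1| <= d0).
Proof.
move=> small.
have d02 : d0 <= 1 / 2 by have := delta1; rewrite /d0; lra.
have := noise_energy_bound N0 meps sigma_eps0 noise d0_gt0 d02.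
apply: holds_outside_sub => //; apply: le_trans small.
rewrite -[leRHS]mulrA ler_wpM2l//.
have x0 : 0 < N%:R * d0 ^+ 2 / 8 by rewrite divr_gt0 ?mulr_gt0 ?exprn_gt0.
apply: (le_trans (expRN_le_inv x0)); rewrite h2 invf_div.
have -> : 8 / (N%:R * d0 ^+ 2) = 8 / d0 ^+ 2 * N%:R^-1.
  by field; rewrite !gt_eqF.
rewrite ler_wpM2l ?divr_ge0 ?sqr_ge0// mulrA ler_peMl ?invr_ge0 ?(ltW Np)//.
by move: L_half; lra.
Qed.

Let noise_event (q' : R) : 0 < q' ->
  holds_outside P (2 * expR (- ((2 * q' ^+ 2 - 1) * L)))
  (fun w => forall a, `|((X w)^T *m eps w) a 0| <=
     2 * q' * Num.sqrt L * (sigma_eps * Num.sqrt (sqr_l2norm (col a (X w))))).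
Proof.
move=> q'0.
have t0 : 0 < 2 * q' * Num.sqrt L by rewrite !mulr_gt0 ?sqrtr_gt0.
have := noise_correlation_bound mX meps sigma_eps0 noise t0 X_eps.
apply: holds_outside_sub => //; rewrite -mulrA ler_wpM2l//.
have np : (n%:R : R) \is Num.pos by rewrite posrE ltr0n ltnW.
rewrite -{1}(lnK np) -expRD exprMn (sqr_sqrtr (ltW L0)) -/L ler_expR.
by rewrite le_eqVlt; apply/orP; left; apply/eqP; field.
Qed.

Let feasible_event : h <= 1 -> holds_outside P (2 * expR (- L))
  (fun w => exists Theta, clime_feasible mu (X w) Theta).
Proof.
move=> h1.
have ic0 : 0 < c^-1 by rewrite invr_gt0.
have rows := precision_row_norm c0 SigmaS SigmaC.
have mu0 : 0 < mu by rewrite mulr_gt0.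
have sx2 : 0 < sigma_x ^+ 2 by rewrite exprn_gt0.
have tle : mu <= 16 / (4 * sigma_x ^+ 2 * c^-1)^-1.
  rewrite invrK /mu /Cm /mu_const.
  rewrite (_ : 16 * (4 * sigma_x ^+ 2 * c^-1) = 64 * sigma_x ^+ 2 / c); last by ring.
  rewrite mulrAC ler_wpM2r ?(ltW ic0)//.
  apply: (@le_trans _ _ (56 * sigma_x ^+ 2)); last by rewrite ler_wpM2r ?(ltW sx2)//; lra.
  by rewrite ler_piMr// mulr_ge0// ltW.
have := max_deviation_bound mX sigma_x0 N0 design ic0 rows mu0 tle.
apply: holds_outside_sub; last first.
  move=> w hw; exists (invmx Sigma); apply: precision_feasible => //.
  exact: coercive_unitmx c0 SigmaC.
have -> : N%:R * mu ^+ 2 * (4 * sigma_x ^+ 2 * c^-1)^-1 ^+ 2 / 64 = 49 / 16 * L.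
  rewrite exprMn -Nh2 /Cm /mu_const; field; by rewrite !gt_eqF.
rewrite -mulrA expR_ln_nat ?(ltnW n1)// ler_wpM2l// ler_expR.
by have := L0; rewrite -/L; lra.
Qed.

Let expansion_of (q' r : R) w : 0 <= q' ->
  (q' = 1 /\ r = s2) \/ (n%:R <= K0 /\ r = s2 + 1) ->
  T * h <= 1 -> mu <= 1 / 2 -> T * h * (D q' ^+ 2 * r) <= c / 2 ->
  bias_const sigma_x c q' K0 * (r * L / Num.sqrt N%:R) <= delta ->
  d0 + scale_const sigma_x c q' K0 * (r * L / Num.sqrt N%:R) <= delta ->
  (forall a b, `|(sample_cov (X w) - Sigma) a b| <= T * h) ->
  (forall a, `|((X w)^T *m eps w) a 0| <=
     2 * q' * Num.sqrt L * (sigma_eps * Num.sqrt (sqr_l2norm (col a (X w))))) ->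
  `|N%:R^-1 * sqr_l2norm (eps w) / sigma_eps ^+ 2 - 1| <= d0 ->
  (exists Theta, clime_feasible mu (X w) Theta) ->
  expansion_within w.
Proof.
move=> q'0 regime Th1 mu12 small biasd scaled dev noisew energyw feas.
have [feasw _] := Theta_hatP feas.
have Sle a := covariance_entry_le mX sigma_x0 N0 design a a.
have lt1 : d0 + scale_const sigma_x c q' K0 * (r * L / Num.sqrt N%:R) < 1.
  exact: le_lt_trans scaled delta1.
have [g0 [rho [b [rho0 rho1 bb eqW]]]] := studentized_expansion j nu0 c0 sigma_eps0
  N0 n1 eG s10 s20 nus bstarS (bhatP w) SigmaC Sle (ltW T_gt0) dev q'0 noisew energyw
  feasw Th1 mu12 regime small lt1.
split; first exact: g0.
exists rho, b; split => //; first exact: le_trans rho1 scaled.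
exact: le_trans bb biasd.
Qed.

(** The thresholds depend only on sigma_x, c, eta and delta, so the bound is
    uniform in the sizes, the graph and the distributions. For n >= K0 the
    union bounds over the coordinates fail with probability at most eta and
    the precision matrix is feasible; for n <= K0 the noise level is raised to
    q, and feasibility comes from inverting the sample covariance. *)
Lemma expansion_likely : h <= h_threshold -> s2 * L / Num.sqrt N%:R <= rate_threshold ->
  holds_outside P (4 * eta) expansion_within.
Proof.
move=> hh su.
have [C1 CD [Cq CT CCm CTK Cd0]] := C_total_bounds.
have K0p : 0 < 1 + 2 * K0 by rewrite addr_gt0// mulr_gt0.
have hstar : (1 + 2 * K0) * h <= u_star / 2.
  by move: hh; rewrite /h_threshold invfM mulrA ler_pdivlMr// mulrC.
have h_u : h <= u_star.
  apply: (@le_trans _ _ ((1 + 2 * K0) * h)); last by have := ltW u_star_gt0; lra.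
  by rewrite ler_peMl ?(ltW h0)// lerDl mulr_ge0// ltW.
have hge0 := ltW h0.
have [_ _ h12 _] := below_tol hge0 h_u C1; rewrite mul1r in h12.
have [_ _ qh _] := below_tol hge0 h_u Cq.
have [_ _ Th _] := below_tol hge0 h_u CT.
have [_ _ Cmh _] := below_tol hge0 h_u CCm.
have [TK _ _ _] := below_tol hge0 h_u CTK.
have [_ _ _ dh] := below_tol hge0 h_u Cd0.
have qh2 : q * h <= 2 by lra.
have dev := dev_event qh2.
have energy : holds_outside P eta
    (fun w => `|N%:R^-1 * sqr_l2norm (eps w) / sigma_eps ^+ 2 - 1| <= d0).
  apply: energy_event; apply: le_trans dh.
  rewrite (_ : 2 * (8 / d0 ^+ 2) * (2 * h ^+ 2) = 32 / d0 ^+ 2 * h ^+ 2); last by ring.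
  rewrite ler_wpM2l ?divr_ge0 ?sqr_ge0// expr2 ler_piMl//; lra.
have sN : 0 < Num.sqrt N%:R :> R by rewrite sqrtr_gt0.
have sL : 0 < Num.sqrt L by rewrite sqrtr_gt0.
have sL2 : Num.sqrt L ^+ 2 = L by rewrite sqr_sqrtr// ltW.
have sL_half : 1 / 2 <= Num.sqrt L by have := L_half; nra.
have hE : h = Num.sqrt L / Num.sqrt N%:R by rewrite /h sqrtrM ?sqrtrV// ltW.
have invN : (Num.sqrt N%:R)^-1 <= 2 * h.
  by rewrite hE mulrA ler_peMl ?invr_ge0 ?(ltW sN)//; lra.
(* u stays below u_star in both regimes: when n <= K0 the extra sparsity adds
   L / sqrt N <= 2 K0 h *)
have main q' r : q' = 1 \/ q' = q ->
    (q' = 1 /\ r = s2) \/ (n%:R <= K0 /\ r = s2 + 1) ->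
    forall w, (forall a b, `|(sample_cov (X w) - Sigma) a b| <= T * h) ->
    (forall a, `|((X w)^T *m eps w) a 0| <=
      2 * q' * Num.sqrt L * (sigma_eps * Num.sqrt (sqr_l2norm (col a (X w))))) ->
    `|N%:R^-1 * sqr_l2norm (eps w) / sigma_eps ^+ 2 - 1| <= d0 ->
    (exists Theta, clime_feasible mu (X w) Theta) -> expansion_within w.
  move=> q'E regime w devw noisew energyw feasw.
  have q'0 : 0 <= q' by case: q'E => ->.
  have r0 : 0 <= r by case: regime => -[_ ->]; rewrite ?addr_ge0// ltW.
  pose u := r * L / Num.sqrt N%:R.
  have u0 : 0 <= u by rewrite divr_ge0 ?mulr_ge0// ltW.
  have uu : u <= u_star.
    rewrite /u; case: regime => -[H ->].
      by apply: (le_trans su); rewrite /rate_threshold; have := u_star_gt0; lra.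
    rewrite mulrDl mul1r mulrDl.
    have LK : L / Num.sqrt N%:R <= K0 * (2 * h).
      apply: ler_pM => //; rewrite ?invr_ge0 ?(ltW L0) ?(ltW sN)//.
      by apply: le_trans H; apply: ltW; apply: ln_sublinear; rewrite ltr0n ltnW.
    by move: su; rewrite /rate_threshold; lra.
  have [CDq Cb Cs] := CD _ q'E.
  have [Dsmall _ _ _] := below_tol u0 uu CDq.
  have [_ bsmall _ _] := below_tol u0 uu Cb.
  have [_ ssmall _ _] := below_tol u0 uu Cs.
  apply: (expansion_of q'0 regime) => //.
  - by lra.
  - apply: le_trans Dsmall.
    rewrite (_ : T * h * (D q' ^+ 2 * r) = T * D q' ^+ 2 * (r * h)); last by ring.
    rewrite (_ : 2 * T * D q' ^+ 2 * u = T * D q' ^+ 2 * (2 * u)); last by ring.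
    apply: ler_wpM2l.
      by apply: mulr_ge0; [exact: ltW T_gt0|exact: sqr_ge0].
    rewrite /u hE -[in leRHS]sL2 [leLHS]mulrA.
    have -> : 2 * (r * Num.sqrt L ^+ 2 / Num.sqrt N%:R) =
        r * Num.sqrt L * (2 * Num.sqrt L) / Num.sqrt N%:R by ring.
    rewrite ler_wpM2r ?invr_ge0 ?(ltW sN)// ler_peMr ?mulr_ge0 ?(ltW sL)//.
    by lra.
  - by rewrite -/u; move: bsmall; rewrite /d0; have := delta0; lra.
  - by rewrite -/u; move: ssmall; rewrite /d0; lra.
have [nK|nK] := leP K0 n%:R.
  have expL : 2 * expR (- L) <= eta.
    have np : (n%:R : R) \is Num.pos by rewrite posrE ltr0n ltnW.
    rewrite expRN lnK// ler_pdivrMr ?ltr0n ?(ltnW n1)//.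
    by rewrite mulrC -ler_pdivrMr.
  have h1 : h <= 1 by lra.
  have feas := feasible_event h1.
  have noise1 := noise_event ltr01.
  have := holds_outside_and dev (holds_outside_and noise1 (holds_outside_and energy feas)).
  apply: holds_outside_sub.
    rewrite (_ : 2 * 1 ^+ 2 - 1 = 1 :> R); last by rewrite expr1n; ring.
    by rewrite mul1r; lra.
  move=> w [devw [noisew [energyw feasw]]].
  by apply: (main 1 s2) => //; left.
have q_gt0 : 0 < q by have := q_ge2; lra.
have noiseq := noise_event q_gt0.
have := holds_outside_and dev (holds_outside_and noiseq energy).
apply: holds_outside_sub.
  have qq : q ^+ 2 <= 2 * q ^+ 2 + 1 by have := sqr_ge0 q; lra.
  have := tail_small qq.
  rewrite (_ : 2 * q ^+ 2 + 1 - 2 = 2 * q ^+ 2 - 1); last by ring.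
  by have := eta0; lra.
move=> w [devw [noisew energyw]].
have feasw : exists Theta, clime_feasible mu (X w) Theta.
  apply: (low_dimension_feasible c0 SigmaC devw _ (ltW nK)).
  - by rewrite mulr_ge0// ltW.
  - by rewrite mulrAC.
  - by rewrite mulr_ge0// ltW.
apply: (main q (s2 + 1)) => //; first by right.
by right; rewrite (ltW nK).
Qed.

End fixed_size.
End finite_sample.

(** * From the expansion to the limit law *)

Section covariance_matrix.
Context d (Om : measurableType d) (R : realType) (P : probability Om R).
Context (N n : nat) (sigma_x c : R) (Sigma : 'M[R]_n) (X : Om -> 'M[R]_(N, n)).
Hypothesis sigma_x0 : 0 < sigma_x.
Hypothesis c0 : 0 < c.
Hypothesis mX : measurable_fun setT X.
Hypothesis N0 : (0 < N)%N.
Hypothesis design : sub_gaussian_design P sigma_x Sigma X.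

Lemma design_covariance_sym : Sigma^T = Sigma.
Proof.
have [_ _ _ cov] := design; apply/matrixP => a b; rewrite mxE.
by apply: EFin_inj; rewrite -!(cov (Ordinal N0)) covarianceC.
Qed.

(** A diagonal entry of Sigma^-1 Sigma is 1 while the entries of Sigma are
    bounded. So the row sums of the precision matrix are bounded below, and
    sqrt (ln n / N) tends to 0 if its product with their bound M does. *)
Lemma precision_row_sum_ge (M : R) (j : 'I_n) :
  (forall u, c * sqr_l2norm u <= dot u (Sigma *m u)) ->
  (forall i, \sum_i' `|invmx Sigma i i'| <= M) ->
  1 <= M * (8 * sigma_x ^+ 2).
Proof.
move=> Sc rowM.
have S1 : invmx Sigma *m Sigma = 1%:M by rewrite mulVmx// (coercive_unitmx c0 Sc).
have {S1} : (invmx Sigma *m Sigma) j j = 1 by rewrite S1 mxE eqxx.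
rewrite mxE => {1}<-; apply: (le_trans (ler_norm _)); apply: (le_trans (ler_norm_sum _ _ _)).
apply: (@le_trans _ _ (\sum_i `|invmx Sigma j i| * (8 * sigma_x ^+ 2))).
  apply: ler_sum => i _; rewrite normrM ler_wpM2l//.
  exact: (covariance_entry_le mX sigma_x0 N0 design).
rewrite -mulr_suml; apply: ler_wpM2r; last exact: rowM.
by rewrite mulr_ge0// sqr_ge0.
Qed.

End covariance_matrix.

Lemma measurable_fun_studentized d (Om : measurableType d) (R : realType) (N n : nat)
    (X : Om -> 'M[R]_(N, n)) (y : Om -> 'cV[R]_N) (bstar : 'cV[R]_n)
    (bhat : Om -> 'cV[R]_n) (Theta : Om -> 'M[R]_n) (j : 'I_n) :
  measurable_fun setT X -> measurable_fun setT y -> measurable_fun setT bhat ->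
  measurable_fun setT Theta ->
  measurable_fun setT (fun w => studentized (X w) (y w) bstar (bhat w) (Theta w) j).
Proof.
move=> mX my mb mT.
have mXb : measurable_fun setT (fun w => X w *m bhat w) by exact: measurable_fun_mulmx.
have mres : measurable_fun setT (fun w => y w - X w *m bhat w).
  by apply: measurable_fun_addmx => //; exact: measurable_fun_oppmx.
apply: measurable_funM.
  apply: measurable_funM => //; apply: measurable_funB => //.
  apply: (iffLR (measurable_matrixP _)).
  apply: measurable_fun_addmx => //; apply: measurable_fun_scalemx.
  apply: measurable_fun_mulmx => //; apply: measurable_fun_mulmx => //.
  exact: measurable_fun_trmx.
apply: measurable_funV; apply: measurable_funM; apply: measurable_fun_sqrt.
  apply: measurable_funM => //; apply: measurable_sum => i; apply: measurable_funX.
  move/measurable_matrixP : my => my; move/measurable_matrixP : mXb => mXb.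
  by apply: measurable_funB.
apply: (iffLR (measurable_matrixP _)).
apply: measurable_fun_mulmx; last exact: measurable_fun_trmx.
by apply: measurable_fun_mulmx => //; exact: measurable_fun_sample_cov.
Qed.

Section studentized_cdf.
Context d (Om : measurableType d) (R : realType) (P : probability Om R).
Context (N : nat) (eps : Om -> 'cV[R]_N) (sigma : R).
Hypothesis meps : measurable_fun setT eps.
Hypothesis sigma_gt0 : 0 < sigma.
Hypothesis noise : gaussian_noise P sigma eps.
Context d1 (T1 : measurableType d1) (X : Om -> T1).
Hypothesis mX : measurable_fun setT X.
Hypothesis X_eps : independent P X eps.
Context (g : T1 -> 'cV[R]_N) (W : Om -> R).
Hypothesis mg : measurable_fun setT g.
Hypothesis mW : measurable_fun setT W.

Let A := [set x | 0 < sqr_l2norm (g x)].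
Let Z w := dot (g (X w)) (eps w) / (sigma * Num.sqrt (sqr_l2norm (g (X w)))).

Let mA : measurable A.
Proof.
by apply: measurable_lt_set => //; exact: measurable_fun_sqr_l2norm.
Qed.

Let mXA : measurable (X @^-1` A).
Proof. by rewrite -[X in measurable X]setTI; exact: mX. Qed.

Let mWt t : measurable [set w | W w <= t].
Proof. exact: measurable_le_set. Qed.

Let cdfE t : P [set w | A (X w) /\ `]-oo, t]%classic (Z w)] =
  (P (X @^-1` A) * normal_prob 0 1 `]-oo, t])%E.
Proof. exact: conditional_standard_normal. Qed.

Let mZt t : measurable [set w | A (X w) /\ `]-oo, t]%classic (Z w)].
Proof.
apply: measurableI => //.
have mZ : measurable_fun setT Z.
  have mgX : measurable_fun setT (fun w => g (X w)) by exact: measurableT_comp.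
  apply: measurable_funM; first exact: measurable_fun_dot.
  apply: measurable_funV; apply: measurable_funM => //; apply: measurable_fun_sqrt.
  exact: measurable_fun_sqr_l2norm.
by have := mZ measurableT _ (@measurable_itv R `]-oo, t]%R); rewrite setTI.
Qed.

Let cdf_le t : (P [set w | A (X w) /\ `]-oo, t]%classic (Z w)] <=
  normal_prob 0 1 `]-oo, t])%E.
Proof.
by rewrite cdfE gee_pMl ?probability_le1 ?fin_num_measure.
Qed.

(** A quantitative form of Slutsky's lemma. Outside the exceptional set W <= t
    means Z <= t rho - b, and t rho - b differs from t by at most delta (|t| +
    1). The law of Z is known on the event that the score is nonzero, the
    complement of which lies in the exceptional set. *)
Lemma studentized_cdf_sandwich (e delta t : R) : 0 <= delta -> 
  holds_outside P e (fun w => A (X w) /\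
    exists rho b, [/\ 0 < rho, `|rho - 1| <= delta, `|b| <= delta &
      W w = (Z w + b) / rho]) ->
  (P [set w | (W w <= t)%R] <= normal_prob 0 1 `]-oo, (t + delta * (`|t| + 1))%R] + e%:E)%E /\
  (normal_prob 0 1 `]-oo, (t - delta * (`|t| + 1))%R] <=
     P [set w | (W w <= t)%R] + (2 * e)%:E)%E.
Proof.
move=> delta0 [B [mB PB good]].
have shift w rho b : 0 < rho -> `|rho - 1| <= delta -> `|b| <= delta ->
    W w = (Z w + b) / rho ->
    (W w <= t -> Z w <= t + delta * (`|t| + 1)) /\
    (Z w <= t - delta * (`|t| + 1) -> W w <= t).
  move=> rho0 rho1 bd ->; rewrite ler_pdivrMr//.
  have : `|t * (rho - 1)| <= `|t| * delta by rewrite normrM ler_wpM2l.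
  rewrite ler_norml => /andP[l1 l2].
  by move: bd; rewrite ler_norml => /andP[b1 b2]; split=> H; lra.
have notA : (P (~` (X @^-1` A)) <= e%:E)%E.
  apply: le_trans PB; apply: le_measure; rewrite ?inE//; first exact: measurableC.
  by move=> w nA; apply: contrapT => /good [].
split.
  apply: (@le_trans _ _ (P ([set w | A (X w) /\
      `]-oo, t + delta * (`|t| + 1)]%classic (Z w)] `|` B))).
    apply: le_measure; rewrite ?inE//; first exact: measurableU.
    move=> w /= Wt; have [Bw|nB] := pselect (B w); [by right|left].
    have [Aw [rho [b [r0 r1 bd Ww]]]] := good w nB; split => //.
    by rewrite /= in_itv/=; apply: (shift _ _ _ r0 r1 bd Ww).1.
  apply: (le_trans (measureU2 _ _ _)) => //; apply: leeD => //.
  exact: cdf_le.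
set s := t - _; set Phi := normal_prob 0 1 _.
have le1 : (P (X @^-1` A) * Phi <= P [set w | (W w <= t)%R] + e%:E)%E.
  rewrite -cdfE; apply: (@le_trans _ _ (P ([set w | W w <= t] `|` B))).
    apply: le_measure; rewrite ?inE//; first exact: measurableU.
    move=> w /= [_ Zs]; have [Bw|nB] := pselect (B w); [by right|left].
    have [Aw [rho [b [r0 r1 bd Ww]]]] := good w nB => /=.
    by apply: (shift _ _ _ r0 r1 bd Ww).2; move: Zs; rewrite /= in_itv.
  by apply: (le_trans (measureU2 _ _ _)) => //; rewrite leeD2l.
have -> : (Phi = P (X @^-1` A) * Phi + P (~` (X @^-1` A)) * Phi)%E.
  rewrite -ge0_muleDl//; rewrite probability_setC//.
  by rewrite addeC subeK ?mul1e// fin_num_measure.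
rewrite (_ : 2 * e = e + e); last by ring.
rewrite EFinD addeA; apply: leeD => //.
have mnA : measurable (~` (X @^-1` A)) by exact: measurableC.
apply: le_trans notA; rewrite -[leRHS]mule1 lee_wpmul2l//.
exact: probability_le1.
Qed.

End studentized_cdf.

(** Continuity of Phi at t lets the shift tend to 0; delta and eta are chosen
    from a modulus of continuity at t. *)
Lemma cvg_cdf_of_sandwich (R : realType) (F : nat -> \bar R) (Phi : R -> \bar R) (t : R) :
  (forall m, F m \is a fin_num) -> (forall s, Phi s \is a fin_num) ->
  {for t, continuous Phi} ->
  (forall eta delta : R, 0 < eta -> 0 < delta -> delta < 1 -> \forall m \near \oo,
     (F m <= Phi (t + delta * (`|t| + 1))%R + (4 * eta)%:E)%E /\
     (Phi (t - delta * (`|t| + 1))%R <= F m + (2 * (4 * eta))%:E)%E) ->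
  F m @[m --> \oo] --> Phi t.
Proof.
move=> Ffin Pfin Pcont sand.
have {}Pcont : Phi s @[s --> t] --> (fine (Phi t))%:E by rewrite fineK.
move/fine_cvgP : Pcont => [_ Pcont].
rewrite -[Phi t]fineK//; apply/fine_cvgP; split; first exact: nearW.
apply/cvgrPdist_le => /= gam gam0.
move/cvgrPdist_le : Pcont => /(_ (gam / 2)).
have g2 : 0 < gam / 2 by rewrite divr_gt0.
move=> /(_ g2) /= /nbhs_ballP [r /= r0 Pball].
have T0 : 0 < `|t| + 1 by rewrite ltr_wpDl.
pose delta := Num.min (r / 2 / (`|t| + 1)) (1 / 2).
have delta0 : 0 < delta by rewrite lt_min !divr_gt0.
have delta1 : delta < 1 by rewrite (@le_lt_trans _ _ (1 / 2)) ?ge_min ?lexx ?orbT//; lra.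
have dr : delta * (`|t| + 1) < r.
  apply: (@le_lt_trans _ _ (r / 2)); last by lra.
  by rewrite -ler_pdivlMr// ge_min lexx.
have dT0 : 0 <= delta * (`|t| + 1) by rewrite mulr_ge0// ltW.
have ballp : ball t r (t + delta * (`|t| + 1)).
  by rewrite /ball/= opprD addrA subrr sub0r normrN ger0_norm.
have ballm : ball t r (t - delta * (`|t| + 1)).
  by rewrite /ball/= opprB addrC subrK ger0_norm.
have {ballp} := Pball _ ballp; have {ballm} := Pball _ ballm.
have e0 : 0 < gam / 16 by rewrite divr_gt0.
move=> hm hp; near=> m.
have [] : (F m <= Phi (t + delta * (`|t| + 1))%R + (4 * (gam / 16))%:E)%E /\
     (Phi (t - delta * (`|t| + 1))%R <= F m + (2 * (4 * (gam / 16)))%:E)%E.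
  by near: m; exact: sand.
rewrite -(fineK (Ffin m)) -(fineK (Pfin (t + _)%R)) -(fineK (Pfin (t - _))).
rewrite -!EFinD !lee_fin /=.
move: hm hp; rewrite !ler_norml => /andP[a1 a2] /andP[b1 b2] u l.
by apply/andP; split; lra.
Unshelve. all: by end_near. Qed.

Theorem corollary3 (R : realType) (k : nat) (nu sigma_x c c' : R) :
  0 <= nu < 1 -> 0 < sigma_x -> 0 < c <= c' ->
  exists C_lambda C_mu : R, 0 < C_lambda /\ 0 < C_mu /\
  forall (sigma_eps : R) (N n : nat -> nat)
    (e : forall m, rel 'I_(n m))
    (s1 s2 M : nat -> R)
    (beta_star : forall m, 'cV[R]_(n m))
    (Sigma_x : forall m, 'M[R]_(n m))
    (d : nat -> measure_display) (Om : forall m, measurableType (d m))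
    (P : forall m, probability (Om m) R)
    (X : forall m, {RV (P m) >-> 'M[R]_(N m, n m)})
    (eps : forall m, {RV (P m) >-> 'cV[R]_(N m)})
    (beta_hat : forall m, {RV (P m) >-> 'cV[R]_(n m)})
    (Theta_hat : forall m, {mfun 'M[R]_(N m, n m) >-> 'M[R]_(n m)})
    (j : forall m, 'I_(n m)),
  let y m w := X m w *m beta_star m + eps m w in
  let lambda m := C_lambda * (sigma_eps * Num.sqrt (ln (n m)%:R / (N m)%:R)) in
  let lambda_g m :=
    lambda m * Num.sqrt (nu / (2 * max_degree (e m))%:R ^+ k.+1) in
  let mu m := C_mu * Num.sqrt (ln (n m)%:R / (N m)%:R) in
  0 < sigma_eps ->
  (forall m, (0 < N m)%N /\ (1 < n m)%N) ->
  (forall m, simple_graph (e m)) ->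
  (forall m, 0 < s1 m /\ 0 < s2 m) ->
  (forall m, nu <= s2 m / s1 m) ->
  (forall m, param_space (e m) k (s1 m) (s2 m) (beta_star m)) ->
  (forall m, sub_gaussian_design (P m) sigma_x (Sigma_x m) (X m)) ->
  (forall m a, eigenvalue (Sigma_x m) a -> c <= a <= c') ->
  (forall m i, \sum_i' `|invmx (Sigma_x m) i i'| <= M m) ->
  (forall m, gaussian_noise (P m) sigma_eps (eps m)) ->
  (forall m, independent (P m) (X m) (eps m)) ->
  (forall m w, is_gpp_lasso (e m) k (lambda m) (lambda_g m) (X m w) (y m w)
                 (beta_hat m w)) ->
  (forall m x, (exists Theta, clime_feasible (mu m) x Theta) ->
     is_clime (mu m) x (Theta_hat m x)) ->
  s2 m * ln (n m)%:R / Num.sqrt (N m)%:R @[m --> \oo] --> (0 : R) ->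
  M m * Num.sqrt (ln (n m)%:R / (N m)%:R) @[m --> \oo] --> (0 : R) ->
  cvg_in_distribution P
    (fun m w => studentized (X m w) (y m w) (beta_star m) (beta_hat m w)
                  (Theta_hat m (X m w)) (j m))
    (normal_prob 0 1).
Proof.
move=> /andP[nu0 _] sx0 /andP[c0 _].
exists (lambda_const sigma_x), (mu_const sigma_x c); split.
  exact: lambda_const_gt0.
split; first by rewrite divr_gt0// mulr_gt0// exprn_gt0.
move=> sigma_eps N n e s1 s2 M beta_star Sigma_x d Om P X eps beta_hat Theta_hat j.
move=> y lambda lambda_g mu se0 Nn eG s12 nus bS design eigS rowM noise X_eps lasso clime.
move=> rate Mrate.
have mX m : measurable_fun setT (X m) by [].
have meps m : measurable_fun setT (eps m) by [].
have N0 m : (0 < N m)%N by case: (Nn m).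
have n1 m : (1 < n m)%N by case: (Nn m).
have SigmaS m : (Sigma_x m)^T = Sigma_x m by exact: (design_covariance_sym (N0 m) (design m)).
have SigmaC m u : c * sqr_l2norm u <= dot u (Sigma_x m *m u).
  by apply: eigenvalue_lower_bound => // a /eigS /andP[].
pose h m := Num.sqrt (ln (n m)%:R / (N m)%:R) : R.
(* the lower bound on M turns the second rate condition into h -> 0 *)
have h_cvg : h m @[m --> \oo] --> (0 : R).
  apply: (@squeeze_cvgr _ _ _ _ (fun=> 0)
    (fun m => 8 * sigma_x ^+ 2 * (M m * h m))).
  - apply: nearW => m; rewrite sqrtr_ge0/= mulrA ler_peMl ?sqrtr_ge0// mulrC.
    exact: (precision_row_sum_ge sx0 c0 (mX m) (N0 m) (design m) (j m)).
  - exact: cvg_cst.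
  - by rewrite -[X in _ --> X](mulr0 (8 * sigma_x ^+ 2)); apply: cvgMr.
have mTheta m : measurable_fun setT (fun w => Theta_hat m (X m w)).
  by apply: measurableT_comp.
have mW m : measurable_fun setT (fun w => studentized (X m w) (y m w) (beta_star m)
    (beta_hat m w) (Theta_hat m (X m w)) (j m)).
  apply: measurable_fun_studentized => //.
  apply: measurable_fun_addmx => //; apply: measurable_fun_mulmx => //.
split=> // t Phi_cont.
have mg m : measurable_fun setT (fun x => score (Theta_hat m x) x (j m)).
  apply: measurable_fun_mulmx => //; apply: measurable_fun_trmx.
  exact: measurable_fun_row.
apply: (cvg_cdf_of_sandwich (Phi := fun s => normal_prob 0 1 `]-oo, s]) _ _ Phi_cont).
- by move=> m; apply: fin_num_measure; exact: measurable_le_set.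
- by move=> s; exact: fin_num_measure.
move=> eta delta eta0 delta0 delta1.
have hm := h_threshold_gt0 sx0 c0 eta0 delta0.
have rm := rate_threshold_gt0 sx0 c0 eta0 delta0.
near=> m.
have likely := expansion_likely nu0 sx0 c0 eta0 delta0 delta1 (j m) (mX m) (meps m) se0
  (N0 m) (n1 m) (eG m) (proj1 (s12 m)) (proj2 (s12 m)) (nus m) (bS m) (design m)
  (SigmaS m) (SigmaC m) (noise m) (X_eps m) (lasso m) (clime m).
apply: (studentized_cdf_sandwich (meps m) se0 (noise m) (mX m) (X_eps m) (mg m) (mW m) t
  (ltW delta0)).
apply: likely.
- near: m; have /cvgrPdist_le /(_ _ hm) := h_cvg; apply: filterS => m.
  by rewrite sub0r normrN => /(le_trans (ler_norm _)).
- near: m; have /cvgrPdist_le /(_ _ rm) := rate; apply: filterS => m.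
  by rewrite sub0r normrN => /(le_trans (ler_norm _)).
Unshelve. all: by end_near. Qed.
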